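(* Consider the sensor connectivity game with $N$ sensors with positions $x_i\in\mathbb R^2$ and costs $$f_i(\mathbf x)=x_i^Tr_{ii}x_i+x_i^Tr_i+b_i+\sum_{j\in\mathcal N_i^p}c_{ij}\|x_i-x_j\|^2,\quad i\in\mathcal N,$$ where each $r_{ii}$ is symmetric positive definite and strictly diagonally dominant and $c_{ij}>0$, with sensor dynamics $\dot x_i=u_i+g_i(\mathbf x)+d_i(t)$, communication graph $\mathcal G$, and the closed-loop system given by the control law $u_i=-\frac{\partial f_i}{\partial x_i}(\mathbf y_i)-\hat z_i$ together with the consensus/observer dynamics for $y_{ij},\hat x_i,\hat z_i$ with positive gains $\theta$, $k_s=(k_i^s)_i$, $c=(c_i)_i$, $\beta=(\beta_i)_i$ (all described in the context). Suppose that: (1) the communication graph $\mathcal G$ is undirected and connected; (2) the functions $g_i$, $i\in\mathcal N$, are sufficiently smooth, and their first-order and second-order partial derivatives $\frac{\partial g_i(\mathbf x)}{\partial x_j}$, $\frac{\partial^2 g_i(\mathbf x)}{\partial x_j\partial x_k}$, $i,j,k\in\mathcal N$, are bounded given that $\mathbf x$ is bounded; the disturbances $d_i$, $i\in\mathcal N$, are sufficiently smooth, and $\dot d_i(t),\ddot d_i(t)$ are bounded for $i\in\mathcal N$, $t\ge t_0$. Then for any positive constant $v_1$ there exists $\theta^*(v_1)>0$ such that for each $\theta\in(\theta^*,\infty)$ there exists a positive constant $k_s^r(v_1,\theta)$ such that for each choice of $k_i^s\in(k_s^r,\infty)$, $i\in\mathcal N$, there exists a positive constant $c^r(v_1,\theta,k_s)$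 such that for each choice of $c_i\in(c^r,\infty)$, $i\in\mathcal N$, there exists a positive constant $\beta^r(v_1,\theta,c,k_s)$ such that for each choice of $\beta_i\in(\beta^r,\infty)$, $i\in\mathcal N$, $$\|\mathcal E_f(t)\|\to0\quad\text{as } t\to\infty,$$ given that $\|\mathcal E_f(t_0)\|\le v_1$.
   Context: Game and dynamics. There are $N\ge2$ sensors, $\mathcal N=\{1,\dots,N\}$. Sensor $i$ has position $x_i=[x_{i1},x_{i2}]^T\in\mathbb R^2$, control input $u_i\in\mathbb R^2$, and dynamics $\dot x_i=u_i+g_i(\mathbf x)+d_i(t)$, $t\ge t_0$, where $g_i:\mathbb R^{2N}\to\mathbb R^2$ is an unmodeled term, $d_i:[t_0,\infty)\to\mathbb R^2$ is an external disturbance and $t_0$ is the initial time; $\mathbf x=[x_1^T,\dots,x_N^T]^T$. In the costs, $r_{ii}\in\mathbb R^{2\times2}$, $r_i\in\mathbb R^2$, $b_i\in\mathbb R$, $c_{ij}>0$ are constants (the cost weights $c_{ij}$ are unrelated to the control gains $c_i$), and $\mathcal N_i^p\subseteq\mathcal N\setminus\{i\}$ is the physical neighbor set of sensor $i$ (the sensors on whose positions $f_i$ depends); it need not coincide with the neighbor set of $i$ in the communication graph. A Nash equilibrium is a profile $\mathbf x^*=(x_i^*,\mathbf x_{-i}^* )$ such that for every $i\in\mathcal N$, $f_i(x_i^*,\mathbf x_{-i}^* )\le f_i(x_i,\mathbf x_{-i}^* )$ for all $x_i\in\mathbb R^2$, where $\mathbf x_{-i}$ collects the positions of all sensors other than $i$.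 $\mathbf x^*$ denotes the (unique) Nash equilibrium of this game. Communication graph. $\mathcal G$ is a weighted graph with node set $\mathcal N$ and adjacency matrix $\mathcal A=[a_{ij}]$: $a_{ij}>0$ if $(j,i)$ is an edge, $a_{ij}=0$ otherwise, and $a_{ii}=0$. It is undirected if $a_{ij}=a_{ji}$ for all $i,j$; an undirected graph is connected if there is a path between any two distinct nodes. Seeking strategy. All of $y_{ij},\hat x_i,\hat z_i$ take values in $\mathbb R^2$. The control law is $$u_i=-\frac{\partial f_i}{\partial x_i}(\mathbf y_i)-\hat z_i,\qquad \frac{\partial f_i}{\partial x_i}(\mathbf y_i)=\frac{\partial f_i(\mathbf x)}{\partial x_i}\Big|_{\mathbf x=\mathbf y_i}\in\mathbb R^2,\quad \mathbf y_i=[y_{i1}^T,\dots,y_{iN}^T]^T,$$ where, for $i,j\in\mathcal N$, $$\dot y_{ij}=-\theta_{ij}\Big(\sum_{k=1}^N a_{ik}(y_{ij}-y_{kj})+a_{ij}(y_{ij}-x_j)\Big),$$ $$\dot{\hat x}_i=u_i+\hat z_i+(k_i^s+c_i)(x_i-\hat x_i),\qquad \dot{\hat z}_i=k_i^sc_i(x_i-\hat x_i)+\beta_i\,\mathrm{sgn}(x_i-\hat x_i),$$ with $\theta_{ij}=\theta\bar\theta_{ij}$, where $\bar\theta_{ij}$ are fixed positive constants, $\theta,k_i^s,c_i,\beta_i$ are positive scalar control gains, and $\mathrm{sgn}$ is the standard signum function applied componentwise. Error variables. With $z_i=g_i(\mathbf x)+d_i(t)$, set $\zeta_{i1}=x_i-\hat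 x_i$, $\zeta_{i2}=z_i-\hat z_i$, $\xi_i=x_i-x_i^*$, $\eta_{ij}=y_{ij}-x_j$, and $\gamma_i=\dot\zeta_{i1}+c_i\zeta_{i1}$ (equivalently $\gamma_i=\zeta_{i2}-k_i^s\zeta_{i1}$). Let $\zeta_1,\zeta_2,\xi,\gamma\in\mathbb R^{2N}$ and $\eta\in\mathbb R^{2N^2}$ be the corresponding stacked column vectors, and $\mathcal E_f=[\zeta_1^T,\zeta_2^T,\xi^T,\eta^T,\gamma^T]^T$. $\|\cdot\|$ is the Euclidean norm. *)

(* Defs.v *)
From HB Require Import structures.
From mathcomp Require Import all_boot all_order all_algebra.
From mathcomp Require Import all_classical all_reals all_analysis.

Set Implicit Arguments.
Unset Strict Implicit.
Unset Printing Implicit Defensive.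

Import Order.TTheory GRing.Theory Num.Theory.
Import numFieldNormedType.Exports.

Local Open Scope classical_set_scope.
Local Open Scope ring_scope.

(* A profile of N planar positions is a matrix X : 'M[R]_(2, N) whose column   *)
(* col j X is the position of sensor j, so 'M[R]_(2, N) plays the role of      *)
(* R^(2N) and delta_mx a j is the basis direction of coordinate a of sensor j. *)

(* The norm that 'M[R]_(m, n) carries in the library is the max norm. *)
Definition enorm (R : realType) (m n : nat) (v : 'M[R]_(m, n)) : R :=
  Num.sqrt (\sum_(a < m) \sum_(j < n) v a j ^+ 2).

Section Game.
Variables (R : realType) (N : nat).

Record game := Game {
  quad : 'I_N -> 'M[R]_2;
  lin : 'I_N -> 'cV[R]_2;
  cst : 'I_N -> R;
  weight : 'I_N -> 'I_N -> R;
  nbr : 'I_N -> {set 'I_N} }.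

Definition pos_def (n : nat) (A : 'M[R]_n) : Prop :=
  forall v : 'cV[R]_n, v != 0 -> 0 < (v^T *m A *m v) ord0 ord0.

Definition strictly_diag_dominant (n : nat) (A : 'M[R]_n) : Prop :=
  forall a, \sum_(b < n | b != a) `|A a b| < `|A a a|.

Definition connectivity_game (G : game) : Prop :=
  forall i, [/\ (quad G i)^T = quad G i,
                pos_def (quad G i),
                strictly_diag_dominant (quad G i),
                i \notin nbr G i &
                forall j, j \in nbr G i -> 0 < weight G i j].

Definition cost (G : game) (i : 'I_N) (X : 'M[R]_(2, N)) : R :=
  ((col i X)^T *m quad G i *m col i X) ord0 ord0
  + ((col i X)^T *m lin G i) ord0 ord0 + cst G i
  + \sum_(j in nbr G i) weight G i j * enorm (col i X - col j X) ^+ 2.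

Definition deviate (X : 'M[R]_(2, N)) (i : 'I_N) (p : 'cV[R]_2) : 'M[R]_(2, N) :=
  \matrix_(a, j) (if j == i then p a ord0 else X a j).

Definition is_nash (G : game) (X : 'M[R]_(2, N)) : Prop :=
  forall (i : 'I_N) (p : 'cV[R]_2), cost G i X <= cost G i (deviate X i p).

Definition grad_own (G : game) (i : 'I_N) (X : 'M[R]_(2, N)) : 'cV[R]_2 :=
  \col_a 'D_(delta_mx a i) (cost G i) X.

End Game.

Section Graph.
Variables (R : realType) (N : nat).

(* (j, i) is an edge iff 0 < A i j. *)
Definition weighted_adjacency (A : 'M[R]_N) : Prop :=
  (forall i j, 0 <= A i j) /\ (forall i, A i i = 0).

Definition undirected (A : 'M[R]_N) : Prop := forall i j, A i j = A j i.

Definition connected_graph (A : 'M[R]_N) : Prop :=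
  forall i j, i != j -> connect (fun k l => 0 < A l k) i j.

End Graph.

Section Regularity.
Variables (R : realType) (N : nat).

Definition pderiv (h : 'M[R]_(2, N) -> 'cV[R]_2) (a : 'I_2) (j : 'I_N) :
  'M[R]_(2, N) -> 'cV[R]_2 := fun X => 'D_(delta_mx a j) h X.

Definition C1 (h : 'M[R]_(2, N) -> 'cV[R]_2) : Prop :=
  forall a j, (forall X, derivable h X (delta_mx a j)) /\ continuous (pderiv h a j).

Definition C2 (h : 'M[R]_(2, N) -> 'cV[R]_2) : Prop :=
  C1 h /\ forall a j, C1 (pderiv h a j).

Definition bounded_on_bounded (h : 'M[R]_(2, N) -> 'cV[R]_2) : Prop :=
  forall r : R, exists M : R, forall X, enorm X <= r -> enorm (h X) <= M.

Definition regular_unmodeled (h : 'M[R]_(2, N) -> 'cV[R]_2) : Prop :=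
  [/\ C2 h,
      forall a j, bounded_on_bounded (pderiv h a j) &
      forall a j b k, bounded_on_bounded (pderiv (pderiv h a j) b k)].

(* Values of d before t0 are irrelevant, and the library's derivative is       *)
(* two-sided, so derivatives are only taken at times t > t0; right-continuity  *)
(* is required at t0 itself. The bounds below then hold at t0 as well for the  *)
(* one-sided derivatives, whenever these exist.                                *)
Definition regular_disturbance (t0 : R) (d : R -> 'cV[R]_2) : Prop :=
  [/\ derivable_oy_Rcontinuous d t0,
      forall t, t0 < t -> derivable (derive1 d) t 1,
      forall t, t0 < t -> {for t, continuous (derive1 (derive1 d))},
      exists M : R, forall t, t0 < t -> enorm (derive1 d t) <= M &
      exists M : R, forall t, t0 < t -> enorm (derive1 (derive1 d) t) <= M].

End Regularity.

Section ClosedLoop.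
Variables (R : realType) (N : nat).

(* Locally absolutely continuous solution on [t0, +oo) of w' = F(t) for almost *)
(* every t, written as the equivalent Lebesgue integral equation.              *)
Definition solves (t0 : R) (w F : R -> 'cV[R]_2) : Prop :=
  forall (a : 'I_2) (t : R), t0 <= t ->
    (@lebesgue_measure R).-integrable `[t0, t] (fun s => (F s a ord0)%:E) /\
    w t a ord0 = w t0 a ord0
      + \int[@lebesgue_measure R]_(s in `[t0, t]) F s a ord0.

(* Filippov regularisation of the signum function. *)
Definition Sgn (e : R) : set R :=
  [set s : R | if e == 0 then (-1 <= s <= 1 : Prop) else s = Num.sg e].

Record trajectory := Trajectory {
  pos : R -> 'M[R]_(2, N);
  xhat : R -> 'M[R]_(2, N);
  zhat : R -> 'M[R]_(2, N);
  (* column j of est i t is y_ij(t) *)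
  est : 'I_N -> R -> 'M[R]_(2, N) }.

Definition control (G : game R N) (T : trajectory) (i : 'I_N) (t : R) : 'cV[R]_2 :=
  - grad_own G i (est T i t) - col i (zhat T t).

(* Solutions are understood in the sense of Filippov, the right-hand side      *)
(* being discontinuous through sgn: s t a i is a measurable selection of       *)
(* Sgn applied to coordinate a of x_i - xhat_i (measurability is part of the   *)
(* integrability required by [solves]). Since sgn e belongs to Sgn e, every    *)
(* classical or Caratheodory solution is covered.                              *)
Definition closed_loop (G : game R N) (A thbar : 'M[R]_N)
    (g : 'I_N -> 'M[R]_(2, N) -> 'cV[R]_2) (d : 'I_N -> R -> 'cV[R]_2) (t0 : R)
    (theta : R) (k c beta : 'I_N -> R) (T : trajectory) : Prop :=
  let x i t := col i (pos T t) in
  let xh i t := col i (xhat T t) in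
  let zh i t := col i (zhat T t) in
  let y i j t := col j (est T i t) in
  let u i t := control G T i t in
  exists s : R -> 'M[R]_(2, N),
    (forall t a i, t0 <= t -> Sgn (pos T t a i - xhat T t a i) (s t a i)) /\
    forall i,
      [/\ solves t0 (x i) (fun t => u i t + g i (pos T t) + d i t),
          solves t0 (xh i)
            (fun t => u i t + zh i t + (k i + c i) *: (x i t - xh i t)),
          solves t0 (zh i)
            (fun t => (k i * c i) *: (x i t - xh i t) + beta i *: col i (s t)) &
          forall j, solves t0 (y i j)
            (fun t => - (theta * thbar i j) *:
               (\sum_(l < N) A i l *: (y i j t - y l j t)
                + A i j *: (y i j t - x j t)))].

Section Errors.
Variables (g : 'I_N -> 'M[R]_(2, N) -> 'cV[R]_2) (d : 'I_N -> R -> 'cV[R]_2).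
Variables (k : 'I_N -> R) (xstar : 'M[R]_(2, N)) (T : trajectory).

Definition zeta1 (t : R) : 'M[R]_(2, N) := pos T t - xhat T t.

Definition zeta2 (t : R) : 'M[R]_(2, N) :=
  \matrix_(a, i) (g i (pos T t) + d i t) a ord0 - zhat T t.

Definition xi (t : R) : 'M[R]_(2, N) := pos T t - xstar.

Definition eta (i : 'I_N) (t : R) : 'M[R]_(2, N) := est T i t - pos T t.

(* gamma_i = zeta1_i' + c_i zeta1_i = zeta2_i - k_i zeta1_i along solutions;   *)
(* the derivative-free form also makes sense at the initial time.              *)
Definition gamma (t : R) : 'M[R]_(2, N) :=
  \matrix_(a, i) (zeta2 t a i - k i * zeta1 t a i).

(* Euclidean norm of the stacked vector [zeta1; zeta2; xi; eta; gamma]. *)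
Definition error_norm (t : R) : R :=
  Num.sqrt (enorm (zeta1 t) ^+ 2 + enorm (zeta2 t) ^+ 2 + enorm (xi t) ^+ 2
            + \sum_(i < N) enorm (eta i t) ^+ 2 + enorm (gamma t) ^+ 2).

End Errors.
End ClosedLoop.

(* Main.v *)
(** The observer splits the loop into two parts. With [zeta = x - xhat], the
    estimate [xhat] obeys [xhat' = - grad f(y) + (k + c) zeta], which does not
    contain [gamma]; together with the consensus variables it is a linear system
    driven by [zeta]. For large [theta] this system has a quadratic Lyapunov
    function: the weights [u] making the pseudo-gradient monotone come from a
    diagonally dominant M-matrix, and the weights [1 / thbar i j] symmetrise the
    consensus part, whose pinned Laplacian is coercive on a connected graph.

    Replacing [gamma_i] by [p_i = gamma_i - (g_i(x) - g_i(xhat))] removes the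
    velocity of the other sensors from the sliding dynamics
    [zeta_i' = p_i + (g_i(x) - g_i(xhat)) - c_i zeta_i],
    [p_i' = - k_i gamma_i + (g_i(xhat))' + d_i' - beta_i sgn(zeta_i)], so that
    [|p_i|^2 / (2 beta_i) + |zeta_i|_1 - zeta_i . d_i' / beta_i] is dissipated up
    to terms which large gains absorb. Adding [kappa (sqrt (1 + W) - 1)], where
    [W] is the quadratic function above, gives a function [V] whose initial value
    and sublevel sets are bounded independently of the gains, and whose upper
    right Dini derivative is at most [- rate * V] on a sublevel set. *)
Require Import Defs.
From HB Require Import structures.
From mathcomp Require Import all_boot all_order all_algebra.
From mathcomp Require Import all_classical all_reals all_analysis.
From mathcomp Require Import ring lra.
Import Order.TTheory GRing.Theory Num.Theory.
Import numFieldNormedType.Exports.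
Local Open Scope classical_set_scope.
Local Open Scope ring_scope.

Set Implicit Arguments.
Unset Strict Implicit.
Unset Printing Implicit Defensive.

(** The sliding part dissipates only linearly, through [c_i |zeta_i|], whereas the injection
    [(k_i + c_i) zeta_i] enters [W'] multiplied by the state of the quadratic part. The square root
    removes that factor: the derivative is divided by [sqrt (1 + W)], which dominates the state.
    Once [k_i <= c_i] the injection is at most twice the dissipation, so the weight [kap] can be
    fixed from constants that no gain enters. This breaks a circularity: the level [K], hence the
    box containing the trajectory and the Lipschitz constant of [g] on it, must be known before the
    gains are chosen. The correction [- zeta_i . d_i' / beta_i] is there because its derivative
    cancels [p_i . d_i' / beta_i], a term linear in [p_i] that [- |p_i|^2] cannot dominate near
    zero; what remains carries a factor [zeta]. As [d_i'] need not exist at [t0], the decay argument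
    starts at a slightly later time. Dini derivatives are used because neither [p_i] nor [|zeta_i|]
    need be differentiable where the sign switches. *)

(** * Upper right Dini derivatives and decay *)

Section Dini.
Variable R : realType.
Implicit Types (f : R -> R) (t l : R).

(* The upper right Dini derivative of f at t is at most l. *)
Definition dini f t l : Prop :=
  forall e, 0 < e -> \forall h \near 0^'+, f (t + h) <= f t + h * (l + e).

Lemma dini_le f t l l' : l <= l' -> dini f t l -> dini f t l'.
Proof.
move=> ll' df e e0; near=> h.
have h0 : 0 < h by [].
have : f (t + h) <= f t + h * (l + e) by near: h; exact: df.
move=> /le_trans; apply; rewrite lerD2l ler_pM2l// lerD2r//.
Unshelve. all: by end_near. Qed.

Lemma diniD f g t l m :
  dini f t l -> dini g t m -> dini (fun r => f r + g r) t (l + m).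
Proof.
move=> df dg e e0; have e20 : 0 < e / 2 by rewrite divr_gt0.
near=> h.
have : f (t + h) <= f t + h * (l + e / 2) by near: h; exact: df.
have : g (t + h) <= g t + h * (m + e / 2) by near: h; exact: dg.
lra.
Unshelve. all: by end_near. Qed.

Lemma diniZ f t l k : 0 <= k -> dini f t l -> dini (fun r => k * f r) t (k * l).
Proof.
rewrite le_eqVlt => /predU1P[<- _ e e0|k0 df e e0].
  by near=> h; have h0 : 0 < h by []; rewrite !mul0r !add0r mulr_ge0// ltW.
have ek0 : 0 < e / k by rewrite divr_gt0.
near=> h.
have : f (t + h) <= f t + h * (l + e / k) by near: h; exact: df.
rewrite -(ler_pM2l k0) => /le_trans; apply.
rewrite le_eqVlt; apply/orP; left; apply/eqP; field; exact: lt0r_neq0.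
Unshelve. all: by end_near. Qed.

Lemma dini0 t : dini (fun=> 0) t 0.
Proof.
by move=> e e0; near=> h; have h0 : 0 < h by []; rewrite !add0r mulr_ge0// ltW.
Unshelve. all: by end_near. Qed.

Lemma dini_sum (I : finType) (F : I -> R -> R) (L : I -> R) t :
  (forall i, dini (F i) t (L i)) ->
  dini (fun r => \sum_i F i r) t (\sum_i L i).
Proof.
move=> dF; elim: (index_enum I) => [|i s IH].
  rewrite big_nil; have -> : (fun r => \sum_(i <- [::]) F i r) = (fun=> 0).
    by apply/funext => r; rewrite big_nil.
  exact: dini0.
have -> : (fun r => \sum_(j <- i :: s) F j r) =
    (fun r => F i r + \sum_(j <- s) F j r) by apply/funext => r; rewrite big_cons.
by rewrite big_cons; apply: (@diniD (F i)).
Qed.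

Lemma is_derive_right f t l e : is_derive t 1 f l -> 0 < e ->
  \forall h \near 0^'+, `|f (t + h) - f t - h * l| <= h * e.
Proof.
move=> fl e0.
have : (fun h => h^-1 *: ((f \o shift t) (h *: 1) - f t)) @ 0^' --> l.
  by case: fl => dfl <-; exact: dfl.
move=> /cvgr_dist_le /(_ _ e0).
move=> /nbhs_ballP[d /= d0 H].
near=> h.
have h0 : 0 < h by [].
have hd : h < d by near: h; exact: nbhs_right_lt.
have := H h; rewrite /ball /= sub0r normrN gtr0_norm// => /(_ hd).
move=> /(_ (lt0r_neq0 h0)).
rewrite -(ler_pM2l h0) -{1}(gtr0_norm h0) -normrM mulrBr.
rewrite [h *: 1]mulr1 [h^-1 *: _]/GRing.scale /= mulrA divff ?lt0r_neq0// mul1r distrC.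
by rewrite (addrC h t).
Unshelve. all: by end_near. Qed.

Lemma is_derive_dini f t l : is_derive t 1 f l -> dini f t l.
Proof.
move=> fl e e0; near=> h.
have : `|f (t + h) - f t - h * l| <= h * e.
  by near: h; exact: is_derive_right.
by rewrite ler_norml => /andP[_]; lra.
Unshelve. all: by end_near. Qed.

Lemma dini_growth f (a b K : R) : a <= b ->
  (forall t, a <= t <= b -> {for t, continuous f}) ->
  (forall t, a <= t < b -> f t <= K -> dini f t 0) ->
  f a < K -> f b <= f a.
Proof.
move=> ab cf df faK.
suff H e : 0 < e -> f a + e * (b - a) <= K -> f b <= f a + e * (b - a).
  apply/ler_addgt0Pr => e e0.
  (* The total rise [e' * (b - a)] must stay below both [e] and [K - f a]; the added 1 covers
     [a = b]. *)
  pose e' := Num.min (e / (b - a + 1)) ((K - f a) / (b - a + 1)).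
  have ba1 : 0 < b - a + 1 by lra.
  have e'0 : 0 < e' by rewrite lt_min !divr_gt0// subr_gt0.
  have e'1 : e' * (b - a + 1) <= e.
    by rewrite -ler_pdivlMr// ge_min lexx.
  have e'2 : e' * (b - a + 1) <= K - f a.
    by rewrite -ler_pdivlMr// ge_min lexx orbT.
  have /(_ e'0) := H e'.
  have -> : e' * (b - a) = e' * (b - a + 1) - e' by ring.
  lra.
move=> e0 eK.
pose S := [set t | a <= t <= b /\ forall s, a <= s <= t -> f s <= f a + e * (s - a)].
have Sa : S a.
  split; first by rewrite lexx.
  by move=> s /le_anti <-; rewrite subrr mulr0 addr0.
have ubS : ubound S b by move=> t [/andP[]].
have hsS : has_sup S by split; [exists a|exists b].
set m := sup S.
have am : a <= m by apply: ub_le_sup => //; exists b.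
have mb : m <= b by apply: ge_sup => //; exists a.
have ltm s : a <= s < m -> f s <= f a + e * (s - a).
  move=> /andP[as_ sm]; have ms : 0 < m - s by rewrite subr_gt0.
  have [t [_ St]] := sup_adherent ms hsS.
  rewrite -/m opprB addrC subrK => st; apply: St; rewrite as_ ltW//.
have fm : f m <= f a + e * (m - a).
  move: am; rewrite le_eqVlt => /predU1P[<-|am].
    by rewrite subrr mulr0 addr0.
  rewrite leNgt; apply/negP => fm.
  have : \forall s \near m, f a + e * (s - a) < f s.
    have cg : {for m, continuous (fun s => f s - (f a + e * (s - a)))}.
      apply: continuousB; first by apply: cf; rewrite ltW.
      apply: continuousD; first exact: cvg_cst.
      apply: continuousM; first exact: cvg_cst.
      by apply: continuousB; [exact: cvg_id|exact: cvg_cst].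
    have gm : 0 < f m - (f a + e * (m - a)) by rewrite subr_gt0.
    near=> s; rewrite -subr_gt0; near: s.
    exact: (cvgr_gt _ cg).
  move=> /nbhs_ballP[d /= d0 /= H].
  pose s := Num.max a (m - d / 2).
  have sm : s < m by rewrite gt_max am ltrBlDr ltrDl divr_gt0.
  have ams : a <= s by rewrite le_max lexx.
  have : ball m d s.
    rewrite /ball /= gtr0_norm ?subr_gt0//.
    have : m - d / 2 <= s by rewrite le_max lexx orbT.
    lra.
  by move=> /H; rewrite ltNge ltm// ams.
move: mb; rewrite le_eqVlt => /predU1P[<-//|mb].
have fmK : f m <= K.
  by apply: le_trans fm _; apply: le_trans eK; rewrite lerD2l ler_pM2l// lerD2r ltW.
have : \forall h \near 0^'+, f (m + h) <= f m + h * (0 + e).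
  by apply: df; rewrite ?(le_trans am)// am mb.
move=> /nbhs_ballP[d /= d0 /= H].
pose h := Num.min (d / 2) (b - m).
have h0 : 0 < h by rewrite lt_min divr_gt0//= subr_gt0.
have hd : h <= d / 2 by rewrite ge_min lexx.
have hb : h <= b - m by rewrite ge_min lexx orbT.
suff /(ub_le_sup (ex_intro _ b ubS)) : S (m + h) by rewrite -/m; lra.
split; first by apply/andP; split; lra.
move=> s /andP[as_ sm].
have [|ms] := leP s m.
  rewrite le_eqVlt => /predU1P[->//|sm']; by apply: ltm; rewrite as_.
have := H (s - m); rewrite /ball/= sub0r normrN gtr0_norm ?subr_gt0// subrKC.
have -> : s - m < d by lra.
by move=> /(_ isT ms); lra.
Unshelve. all: by end_near. Qed.

(** [V t * (1 + eps * (t - a))] does not increase: its rate is at most [eps * V * (1 - A) <= 0],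
    where [A >= 1] is the linear factor. A linear factor already forces the limit 0 and keeps the
    product estimate polynomial, unlike an exponential. *)
Lemma dini_decay (V : R -> R) (a K eps : R) : 0 < eps ->
  (forall t, a <= t -> 0 <= V t) ->
  (forall t, a <= t -> {for t, continuous V}) ->
  (forall t, a <= t -> V t <= K -> dini V t (- (eps * V t))) ->
  V a < K ->
  (forall t, a <= t -> V t <= V a) /\ V t @[t --> +oo] --> 0.
Proof.
move=> eps0 V0 cV dV VaK.
have main t : a <= t -> V t * (1 + eps * (t - a)) <= V a.
  move=> at_.
  suff : V t * (1 + eps * (t - a)) <= V a * (1 + eps * (a - a)).
    by rewrite subrr mulr0 addr0 mulr1.
  apply: (@dini_growth (fun t => V t * (1 + eps * (t - a))) a t K) => //.
  - move=> s /andP[as_ _]; apply: continuousM; first exact: cV.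
    apply: continuousD; first exact: cvg_cst.
    apply: continuousM; first exact: cvg_cst.
    by apply: continuousB; [exact: cvg_id|exact: cvg_cst].
  - move=> s /andP[as_ _] VK.
    have Vs0 := V0 _ as_.
    set A := 1 + eps * (s - a).
    have A1 : 1 <= A by rewrite lerDl mulr_ge0 ?subr_ge0// ltW.
    have VK' : V s <= K by apply: le_trans VK; rewrite ler_peMr.
    move=> e e0.
    (* Half of the slack [e] pays for [q * A]; the other half, through the bound on [h] below, pays
       for the second-order term [eps * q * h]. *)
    have [q q0 eA] : exists2 q, 0 < q & q * A = e / 2.
      exists (e / (2 * A)); first by rewrite divr_gt0//; lra.
      by field; lra.
    have d0 : 0 < e / (2 * (eps * q + 1)).
      by rewrite divr_gt0// mulr_gt0// ltr_pwDr// mulr_ge0// ltW.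
    near=> h.
    have h0 : 0 < h by [].
    have : V (s + h) <= V s + h * (- (eps * V s) + q) by near: h; exact: dV.
    have hd : h <= e / (2 * (eps * q + 1)) by near: h; exact: nbhs_right_le.
    have -> : 1 + eps * (s + h - a) = A + eps * h by rewrite /A; ring.
    have Ah : 0 < A + eps * h by have := mulr_gt0 eps0 h0; lra.
    rewrite -(ler_pM2r Ah) => /le_trans; apply.
    have q1 : 0 < 2 * (eps * q + 1) by rewrite mulr_gt0// ltr_pwDr// mulr_ge0// ltW.
    move: hd; rewrite ler_pdivlMr// => hd.
    have : (V s + h * (- (eps * V s) + q)) * (A + eps * h) =
      V s * A + h * (eps * V s * (1 - A) + q * A + (eps * q) * h
         - eps * eps * V s * h) by ring.
    move=> ->; rewrite lerD2l add0r ler_pM2l// eA.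
    have : eps * V s * (1 - A) <= 0 by apply: mulr_ge0_le0; [rewrite mulr_ge0// ltW|lra].
    have : 0 <= eps * eps * V s * h by rewrite !mulr_ge0// ltW.
    lra.
  - by rewrite subrr mulr0 addr0 mulr1.
split=> [t at_|].
  apply: le_trans (main _ at_); rewrite ler_peMr ?V0//.
  by rewrite lerDl mulr_ge0 ?subr_ge0// ltW.
apply/cvgrPdist_le => e e0.
near=> t.
have at_ : a <= t by near: t; apply: nbhs_pinfty_ge; exact: num_real.
rewrite sub0r normrN ger0_norm ?V0//.
have A0 : 0 < 1 + eps * (t - a) by rewrite ltr_pwDl// mulr_ge0 ?subr_ge0// ltW.
rewrite -(ler_pM2r A0); apply: le_trans (main _ at_) _.
have : a + V a / (e * eps) <= t by near: t; apply: nbhs_pinfty_ge; exact: num_real.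
rewrite addrC -lerBrDr ler_pdivrMr ?mulr_gt0//.
have : 0 <= V a by exact: V0.
by move=> ? ?; rewrite mulrDr mulr1 mulrA (le_trans (y := (t - a) * (e * eps)))//; lra.
Unshelve. all: by end_near. Qed.

End Dini.

(** * Scalar integral equations *)

Section IntegralSolution.
Variables (R : realType) (t0 : R) (w f : R -> R).
Notation mu := (@lebesgue_measure R).

Definition integral_solution : Prop := forall t, t0 <= t ->
  mu.-integrable `[t0, t] (EFin \o f) /\
  w t = w t0 + \int[mu]_(s in `[t0, t]) f s.

Hypothesis wf : integral_solution.

Let within_solution u : t0 < u ->
  {within `[t0, u], continuous (fun t => w t0 + \int[mu]_(s in `[t0, t]) f s)}.
Proof.
move=> t0u; have [fi _] := wf (ltW t0u).
have := parameterized_integral_continuous (ltW t0u) fi.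
move=> /(continuous_within_itvP _ t0u)[ci cl cr].
apply/(continuous_within_itvP _ t0u); split.
- by move=> t /ci ct; apply: cvgD; [exact: cvg_cst|exact: ct].
- by apply: cvgD; [exact: cvg_cst|exact: cl].
- by apply: cvgD; [exact: cvg_cst|exact: cr].
Qed.

Lemma integral_solution_continuous t : t0 < t -> {for t, continuous w}.
Proof.
move=> t0t; have t0u : t0 < t + 1 by lra.
have /(continuous_within_itvP _ t0u)[ci _ _] := within_solution t0u.
have tin : t \in `]t0, t + 1[ by rewrite in_itv/= t0t ltrDl ltr01.
rewrite /prop_for /continuous_at (wf (ltW t0t)).2.
apply: cvg_trans (ci _ tin); apply: near_eq_cvg.
near=> s; rewrite (wf (_ : t0 <= s)).2//.
by apply/ltW; near: s; exact: lt_nbhsr.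
Unshelve. all: by end_near. Qed.

Lemma integral_solution_right : w @ t0^'+ --> w t0.
Proof.
have t0u : t0 < t0 + 1 by lra.
have /(continuous_within_itvP _ t0u)[_ cl _] := within_solution t0u.
rewrite [in X in _ --> X](wf (lexx t0)).2.
apply: cvg_trans cl; apply: near_eq_cvg.
by near=> s; rewrite (wf (_ : t0 <= s)).2.
Unshelve. all: by end_near. Qed.

(** Bounding [f] on the open interval is essential for the sign term: when [zeta t = 0] the
    selection at [t] itself is arbitrary, although its sign may be determined immediately
    afterwards. *)
Lemma integral_solution_incr t t' lo hi : t0 <= t -> t < t' ->
  (forall r, t < r < t' -> lo <= f r <= hi) ->
  lo * (t' - t) <= w t' - w t <= hi * (t' - t).
Proof.
move=> t0t tt' fb.
have t0t' : t0 <= t' by lra.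
have [fi _] := wf t0t'.
have -> : w t' - w t = \int[mu]_(s in `]t, t'[) f s.
  rewrite (wf t0t).2 (wf t0t').2 opprD addrACA subrr add0r Rintegral_itvB ?bnd_simp//.
    rewrite Rintegral_itv_bndo_bndc//.
    apply: integrableS fi => // s /=; rewrite !in_itv/= => /andP[ts st'].
    by rewrite (le_trans t0t (ltW ts)) ltW.
  exact: ltW.
have fi' : mu.-integrable `]t, t'[ (EFin \o f).
  apply: integrableS fi => // s /=; rewrite !in_itv/= => /andP[ts st'].
  by rewrite (le_trans t0t (ltW ts)) ltW.
have muE : fine (mu `]t, t'[) = t' - t.
  by rewrite lebesgue_measure_itv/= lte_fin tt'.
have ci (c : R) : mu.-integrable `]t, t'[ (EFin \o cst c).
  apply: (@integrableS _ _ _ mu `[t, t']) => //; first exact: subset_itv_oo_cc.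
  by apply: continuous_compact_integrable; [exact: segment_compact|move=> x; exact: cvg_cst].
have cE c : c * (t' - t) = \int[mu]_(s in `]t, t'[) cst c s.
  by rewrite Rintegral_cst// muE.
rewrite !cE; apply/andP; split; apply: le_Rintegral => // s;
  by rewrite /= in_itv/= => /fb/andP[].
Qed.

Lemma integral_solution_derive t : t0 < t -> {for t, continuous f} ->
  is_derive t 1 w (f t).
Proof.
move=> t0t cf; have tu : t < t + 1 by lra.
have t0u : t0 <= t + 1 by lra.
have [fi _] := wf t0u.
have [dF F'] := continuous_FTC1_closed tu fi t0t cf.
have : is_derive t 1 (fun x => w t0 + \int[mu]_(s in `[t0, x]) f s) (0 + f t).
  apply: is_deriveD; rewrite -F' derive1E; exact: derivableP.
rewrite add0r; apply: near_eq_is_derive.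
near=> s; rewrite (wf (_ : t0 <= s)).2//.
by apply/ltW; near: s; exact: lt_nbhsr.
Unshelve. all: by end_near. Qed.

End IntegralSolution.

(** * The pseudo-gradient of the game *)

Section Gradient.
Variables (R : realType) (N : nat) (G : game R N).
Implicit Types (X Y V : 'M[R]_(2, N)) (i j : 'I_N) (a b : 'I_2).

Lemma enorm_sqr m n (v : 'M[R]_(m, n)) :
  enorm v ^+ 2 = \sum_(a < m) \sum_(j < n) v a j ^+ 2.
Proof.
by rewrite sqr_sqrtr//; apply: sumr_ge0 => a _; apply: sumr_ge0 => j _; exact: sqr_ge0.
Qed.

Lemma quad_formE n (Q : 'M[R]_n) (v : 'cV[R]_n) :
  (v^T *m Q *m v) ord0 ord0 = \sum_a \sum_b Q a b * v a ord0 * v b ord0.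
Proof.
rewrite mxE; under eq_bigr do rewrite mxE big_distrl /=.
rewrite exchange_big; apply: eq_bigr => a _; apply: eq_bigr => b _.
by rewrite !mxE; ring.
Qed.

Definition pgrad_lin i V a : R :=
  2 * \sum_b quad G i a b * V b i
  + 2 * \sum_(j in nbr G i) weight G i j * (V a i - V a j).

Definition pgrad i X a : R := pgrad_lin i X a + lin G i a ord0.

Lemma pgradB i X Y a : pgrad i X a - pgrad i Y a = pgrad_lin i (X - Y) a.
Proof.
rewrite /pgrad /pgrad_lin opprD addrACA subrr addr0.
rewrite opprD addrACA -!mulrBr -!sumrB; congr (2 * _ + 2 * _).
  by apply: eq_bigr => b _; rewrite !mxE; ring.
by apply: eq_bigr => j _; rewrite !mxE; ring.
Qed.

Lemma costE i X : cost G i X =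
  \sum_a \sum_b quad G i a b * X a i * X b i + \sum_a lin G i a ord0 * X a i
  + Defs.cst G i
  + \sum_(j in nbr G i) weight G i j * \sum_a (X a i - X a j) ^+ 2.
Proof.
rewrite /cost; congr (_ + _ + _ + _).
- rewrite quad_formE; apply: eq_bigr => a _; apply: eq_bigr => b _.
  by rewrite !mxE.
- by rewrite mxE; apply: eq_bigr => a _; rewrite !mxE mulrC.
- apply: eq_bigr => j _; rewrite enorm_sqr; congr (_ * _).
  by apply: eq_bigr => a _; rewrite big_ord_recl big_ord0 addr0 !mxE.
Qed.

Hypothesis hG : connectivity_game G.

(** Each cost is quadratic, so its expansion along a coordinate is exact. It yields both the partial
    derivative and, by nonnegativity of the increment at an equilibrium, the first-order
    condition. *)
Lemma cost_line i X a (h : R) :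
  cost G i (X + h *: delta_mx a i) = cost G i X + h * pgrad i X a
    + h ^+ 2 * (quad G i a a + \sum_(j in nbr G i) weight G i j).
Proof.
have [symG _ _ inbr _] := hG i.
have sE b c : quad G i b c = quad G i c b by rewrite -{1}symG mxE.
pose D b : R := (b == a)%:R.
have E b : (X + h *: delta_mx a i) b i = X b i + h * D b.
  by rewrite !mxE eqxx andbT.
have E' b j : j != i -> (X + h *: delta_mx a i) b j = X b j.
  by move=> ji; rewrite !mxE (negbTE ji) andbF mulr0 addr0.
have sD (F : 'I_2 -> R) : \sum_b F b * D b = F a.
  rewrite (bigD1 a)//= /D eqxx mulr1 big1 ?addr0// => b /negbTE ->.
  by rewrite mulr0.
rewrite !costE /pgrad /pgrad_lin.
have -> : \sum_a0 \sum_b quad G i a0 b * (X + h *: delta_mx a i) a0 i *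
    (X + h *: delta_mx a i) b i =
    \sum_a \sum_b quad G i a b * X a i * X b i
    + h * (2 * \sum_b quad G i a b * X b i) + h ^+ 2 * quad G i a a.
  transitivity (\sum_c (\sum_b quad G i c b * X c i * X b i
      + h * \sum_b quad G i c b * X c i * D b
      + h * (\sum_b quad G i c b * X b i) * D c
      + h ^+ 2 * (\sum_b quad G i c b * D b) * D c)).
    apply: eq_bigr => c _; rewrite !mulr_sumr !mulr_suml -!big_split /=.
    by apply: eq_bigr => b _; rewrite !E; ring.
  rewrite !big_split /= !sD; congr (_ + _).
  rewrite -addrA; congr (_ + _).
  rewrite -mulr_sumr -mulrDr mulr2n mulrDl !mul1r; congr (h * (_ + _)).
  by apply: eq_bigr => c _; rewrite sD sE.
have -> : \sum_a0 lin G i a0 ord0 * (X + h *: delta_mx a i) a0 i =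
    \sum_a lin G i a ord0 * X a i + h * lin G i a ord0.
  rewrite -(sD (fun b => lin G i b ord0)) mulr_sumr -big_split /=; apply: eq_bigr => b _.
  by rewrite E; ring.
have -> : \sum_(j in nbr G i) weight G i j *
   \sum_a0 ((X + h *: delta_mx a i) a0 i - (X + h *: delta_mx a i) a0 j) ^+ 2 =
   \sum_(j in nbr G i) weight G i j * \sum_a (X a i - X a j) ^+ 2
   + h * (2 * \sum_(j in nbr G i) weight G i j * (X a i - X a j))
   + h ^+ 2 * \sum_(j in nbr G i) weight G i j.
  rewrite !mulr_sumr -!big_split /=; apply: eq_bigr => j ji.
  have jni : j != i by apply/eqP => e; move: inbr; rewrite -{1}e ji.
  transitivity (weight G i j * \sum_b ((X b i - X b j) ^+ 2
     + h * 2 * (X b i - X b j) * D b + h ^+ 2 * D b * D b)).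
    congr (_ * _); apply: eq_bigr => b _; rewrite E E'//; move: (D b) => Db; ring.
  rewrite !big_split /= !sD (_ : D a = 1); last by rewrite /D eqxx.
  by ring.
ring.
Qed.

Lemma grad_ownE i X a : grad_own G i X a ord0 = pgrad i X a.
Proof.
rewrite mxE /derive.
set A := quad G i a a + \sum_(j in nbr G i) weight G i j.
apply/cvg_lim => //.
apply: (@cvg_trans _ ((fun h => pgrad i X a + h * A) @ 0^')).
  apply: near_eq_cvg; near=> h.
  have h0 : h != 0 by near: h; exact: nbhs_dnbhs_neq.
  rewrite /= [_ *: _ + X]addrC cost_line -/A /GRing.scale /=; field.
  exact: h0.
have : (fun h => pgrad i X a + h * A) @ (0 : R) --> pgrad i X a + 0 * A.
  by apply: cvgD; [exact: cvg_cst|apply: cvgM; [exact: cvg_id|exact: cvg_cst]].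
by rewrite mul0r addr0; exact: cvg_within_filter.
Unshelve. all: by end_near. Qed.

Lemma nash_pgrad X i a : is_nash G X -> pgrad i X a = 0.
Proof.
move=> nX; set A := quad G i a a + \sum_(j in nbr G i) weight G i j.
have H h : 0 <= h * pgrad i X a + h ^+ 2 * A.
  have := nX i (col i X + h *: delta_mx a ord0).
  have -> : deviate X i (col i X + h *: delta_mx a ord0) = X + h *: delta_mx a i.
    apply/matrixP => b j; rewrite !mxE eqxx; have [->|ji] := eqVneq j i; rewrite ?mxE ?eqxx ?andbT//.
    by rewrite andbF mulr0 addr0.
  by rewrite cost_line -/A -addrA lerDl.
apply/eqP/negPn/negP => B0.
(* If [A <= 0], the increment is negative at [h = - pgrad]; otherwise it is negative at its vertex
   [- pgrad / (2 A)]. *)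
have [A0|A0] := leP A 0.
  have := H (- pgrad i X a).
  have : 0 < pgrad i X a ^+ 2 by rewrite exprn_even_gt0.
  have : (- pgrad i X a) ^+ 2 * A <= 0 by rewrite mulr_ge0_le0// sqr_ge0.
  rewrite mulNr -expr2; lra.
have := H (- (pgrad i X a / (2 * A))).
have -> : - (pgrad i X a / (2 * A)) * pgrad i X a +
   (- (pgrad i X a / (2 * A))) ^+ 2 * A = - (pgrad i X a ^+ 2 / (4 * A)).
  by field; exact: lt0r_neq0.
rewrite oppr_ge0 leNgt => /negP; apply; rewrite divr_gt0 ?exprn_even_gt0//; lra.
Qed.

End Gradient.

(** * Left weights for a diagonally dominant M-matrix *)

Section Weights.
Variables (R : realType) (n : nat) (C : 'I_n -> 'I_n -> R) (lam : 'I_n -> R).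
Hypotheses (C0 : forall i j, 0 <= C i j) (lam0 : forall i, 0 < lam i).

(** At an index where [x] is smallest every difference [x i - x j] is nonpositive, so [lam i * x i]
    alone must be nonnegative. *)
Lemma minimum_principle (x : 'I_n -> R) :
  (forall i, 0 <= lam i * x i + \sum_j C i j * (x i - x j)) ->
  forall i, 0 <= x i.
Proof.
move=> Mx i0; pose i := [arg min_(i < i0) x i]%O.
have xi j : x i <= x j by rewrite /i; case: arg_minP => // k _ /(_ j isT).
apply: le_trans (xi i0); rewrite -(pmulr_rge0 _ (lam0 i)).
apply: le_trans (Mx i) _; rewrite gerDl; apply: sumr_le0 => j _.
by rewrite mulr_ge0_le0// subr_le0.
Qed.

Let M : 'M[R]_n :=
  \matrix_(i, j) ((lam i + \sum_l C i l) * (i == j)%:R - C i j).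

Let MxE (x : 'cV[R]_n) i :
  (M *m x) i ord0 = lam i * x i ord0 + \sum_j C i j * (x i ord0 - x j ord0).
Proof.
rewrite mxE; under eq_bigr do rewrite [M _ _]mxE mulrBl.
rewrite sumrB; set K := lam i + _.
have -> : \sum_j K * (i == j)%:R * x j ord0 = K * x i ord0.
  rewrite (bigD1 i)//= eqxx mulr1 big1 ?addr0// => j ji.
  by rewrite eq_sym (negbTE ji) mulr0 mul0r.
rewrite mulrDl -addrA; congr (_ + _).
by rewrite mulr_suml -sumrB; apply: eq_bigr => j _; rewrite mulrBr.
Qed.

(** The minimum principle applied to [x] and [- x] makes [M] injective; applied to the columns of
    the inverse it makes them nonnegative. The weights are the row vector [u] with
    [u M = (1, ..., 1)]. *)
Lemma dominant_weights : exists u : 'I_n -> R, (forall i, 0 < u i) /\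
  forall j, u j * (lam j + \sum_i C j i) - \sum_i u i * C i j = 1.
Proof.
have Munit : M \in unitmx.
  rewrite -unitmx_tr -row_free_unit; apply: inj_row_free => v vM.
  have Mv : M *m v^T = 0 by rewrite -[M]trmxK -trmx_mul vM trmx0.
  apply/rowP => i; rewrite mxE; apply/eqP; rewrite eq_le; apply/andP; split.
    rewrite -oppr_ge0; move: i; apply: minimum_principle => i.
    have <- : (M *m (- v^T)) i ord0 =
        lam i * - v ord0 i + \sum_j C i j * (- v ord0 i - - v ord0 j).
      by rewrite MxE !mxE; congr (_ + _); apply: eq_bigr => j _; rewrite !mxE.
    by rewrite mulmxN Mv oppr0 mxE.
  move: i; apply: minimum_principle => i.
  have <- : (M *m v^T) i ord0 =
      lam i * v ord0 i + \sum_j C i j * (v ord0 i - v ord0 j).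
    by rewrite MxE !mxE; congr (_ + _); apply: eq_bigr => j _; rewrite !mxE.
  by rewrite Mv mxE.
have iM0 i j : 0 <= invmx M i j.
  pose x := invmx M *m (delta_mx j ord0 : 'cV_n).
  suff : 0 <= x i ord0 by rewrite /x -colE mxE.
  move: i; apply: minimum_principle => i; rewrite -MxE mulKVmx//.
  by rewrite mxE ler0n.
pose u := \row_i (1 : R) *m invmx M.
have uM : u *m M = \row_i 1 by rewrite mulmxKV.
have eqn j : u ord0 j * (lam j + \sum_i C j i) - \sum_i u ord0 i * C i j = 1.
  have <- : (u *m M) ord0 j = 1 by rewrite uM mxE.
  rewrite [RHS]mxE.
  under [in RHS]eq_bigr do rewrite [M _ _]mxE mulrBr.
  rewrite sumrB; congr (_ - _).
  rewrite [RHS](bigD1 j)//= eqxx mulr1 [X in _ = _ + X]big1 ?addr0// => i ij.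
  by rewrite (negbTE ij) !mulr0.
have u0 i : 0 <= u ord0 i.
  by rewrite mxE; apply: sumr_ge0 => j _; rewrite !mxE mul1r.
exists (fun i => u ord0 i); split=> // i.
(* If [u i] vanished, equation [i] would equate 1 with a nonpositive number. *)
rewrite lt_neqAle u0 andbT; apply/eqP => ui0.
have := eqn i; rewrite -ui0 mul0r sub0r => /eqP.
rewrite lt_eqF//; apply: le_lt_trans ltr01; rewrite oppr_le0.
by apply: sumr_ge0 => j _; rewrite mulr_ge0.
Qed.
End Weights.

(** * The entrywise l1 norm *)

Section Norm1.
Variables (R : realType) (m n : nat).
Implicit Types V W : 'M[R]_(m, n).

Definition n1 V : R := \sum_a \sum_j `|V a j|.

Lemma n1_ge0 V : 0 <= n1 V.
Proof. by apply: sumr_ge0 => a _; apply: sumr_ge0 => j _. Qed.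

Lemma le_n1 V a j : `|V a j| <= n1 V.
Proof.
rewrite /n1 (bigD1 a)//= (bigD1 j)//= -addrA lerDl addr_ge0//.
  exact: sumr_ge0.
by apply: sumr_ge0 => b _; exact: sumr_ge0.
Qed.

Lemma n1_sum_const V (K : R) : (forall a j, `|V a j| <= K) -> n1 V <= K *+ (m * n).
Proof.
move=> VK; apply: (le_trans (y := \sum_(a < m) \sum_(j < n) K)).
  by apply: ler_sum => a _; apply: ler_sum.
by rewrite !sumr_const !card_ord -mulrnA mulnC.
Qed.

Lemma ler_n1D V W : n1 (V + W) <= n1 V + n1 W.
Proof.
rewrite /n1 -big_split ler_sum// => a _; rewrite -big_split ler_sum// => j _.
by rewrite mxE ler_normD.
Qed.

Lemma sum_sqr_le_n1 V : \sum_a \sum_j V a j ^+ 2 <= n1 V ^+ 2.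
Proof.
rewrite [leRHS]expr2 {1}/n1 mulr_suml ler_sum// => a _.
rewrite mulr_suml ler_sum// => j _.
by rewrite -real_normK ?num_real// expr2 ler_wpM2l// le_n1.
Qed.

(** Cauchy-Schwarz against the constant family, by expanding the nonnegative double sum of
    [(x p - x q) ^+ 2]. *)
Lemma n1_le_sum_sqr V : n1 V ^+ 2 <= (m * n)%:R * \sum_a \sum_j V a j ^+ 2.
Proof.
pose x (p : 'I_m * 'I_n) := `|V p.1 p.2|.
have -> : n1 V = \sum_p x p by rewrite /n1 pair_bigA.
have -> : \sum_a \sum_j V a j ^+ 2 = \sum_p x p ^+ 2.
  rewrite pair_bigA; apply: eq_bigr => p _; rewrite /x real_normK ?num_real//.
have card : (m * n)%:R = \sum_(p : 'I_m * 'I_n) (1 : R).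
  by rewrite sumr_const card_prod !card_ord.
have : 0 <= \sum_p \sum_q (x p - x q) ^+ 2.
  by apply: sumr_ge0 => p _; apply: sumr_ge0 => q _; exact: sqr_ge0.
have -> : \sum_p \sum_q (x p - x q) ^+ 2 =
    2 * ((m * n)%:R * \sum_p x p ^+ 2) - 2 * (\sum_p x p) ^+ 2.
  transitivity (\sum_p \sum_q (x p ^+ 2 * 1 + 1 * x q ^+ 2 - 2 * (x p * x q))).
    by apply: eq_bigr => p _; apply: eq_bigr => q _; ring.
  under eq_bigr do rewrite sumrB big_split /= -!mulr_sumr mulrA.
  rewrite sumrB big_split /= -!mulr_suml -!mulr_sumr -card; ring.
lra.
Qed.

End Norm1.

(** * Weighted strong monotonicity of the pseudo-gradient *)

Section Monotone.
Variables (R : realType) (N : nat) (G : game R N).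
Hypothesis hG : connectivity_game G.

(** In dimension two, [2 q v0 v1 >= - |q| (v0^2 + v1^2)], so the smaller diagonal entry minus [|q|]
    is a coercivity constant. Positive definiteness gives the sign of the diagonal, diagonal
    dominance that of the constant. *)
Lemma quad_coercive i : exists lam : R, 0 < lam /\ forall v : 'I_2 -> R,
  lam * \sum_a v a ^+ 2 <= \sum_a v a * \sum_b quad G i a b * v b.
Proof.
have [symG pdG sdd _ _] := hG i; set Q := quad G i.
have sQ a b : Q a b = Q b a by rewrite /Q -{1}symG mxE.
have sum1 a (F : 'I_2 -> R) : \sum_b F b * (b == a)%:R = F a.
  rewrite (bigD1 a)//= eqxx mulr1 big1 ?addr0// => b /negbTE ->.
  by rewrite mulr0.
have Qpos a : 0 < Q a a.
  have := pdG (\col_b (b == a)%:R) _.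
  rewrite quad_formE.
  under eq_bigr do under eq_bigr do rewrite !mxE.
  under eq_bigr do rewrite sum1; rewrite sum1; apply.
  apply/eqP => /matrixP/(_ a ord0); rewrite !mxE eqxx => /eqP.
  by rewrite oner_eq0.
set a1 : 'I_2 := lift ord0 ord0.
have Q0p := Qpos ord0; have Q1p := Qpos a1.
have Q1 : `|Q ord0 a1| < `|Q a1 a1|.
  have := sdd a1; rewrite big_mkcond !big_ord_recl big_ord0 /= -/a1 -/Q (sQ a1).
  by rewrite !addr0.
have Q0 : `|Q ord0 a1| < `|Q ord0 ord0|.
  have := sdd ord0; rewrite big_mkcond !big_ord_recl big_ord0 /= -/a1 -/Q.
  by rewrite addr0 add0r.
rewrite (gtr0_norm Q1p) in Q1; rewrite (gtr0_norm Q0p) in Q0.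
exists (Num.min (Q ord0 ord0) (Q a1 a1) - `|Q ord0 a1|).
split=> [|v]; first by rewrite subr_gt0 lt_min Q0 Q1.
rewrite !big_ord_recl !big_ord0 /= -/a1 !addr0 (sQ a1).
set lam := _ - _; set q := Q ord0 a1 in Q0 Q1 lam *.
have l0 : lam <= Q ord0 ord0 - `|q| by rewrite lerD2r ge_min lexx.
have l1 : lam <= Q a1 a1 - `|q| by rewrite lerD2r ge_min lexx orbT.
have : - (`|q| * (v ord0 ^+ 2 + v a1 ^+ 2)) <= 2 * q * v ord0 * v a1.
  have [q0|q0] := leP 0 q.
    have : 0 <= q * (v ord0 + v a1) ^+ 2 by rewrite mulr_ge0 ?sqr_ge0.
    by rewrite ger0_norm//; lra.
  have : 0 <= - q * (v ord0 - v a1) ^+ 2 by rewrite mulr_ge0 ?sqr_ge0//; lra.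
  by rewrite ltr0_norm//; lra.
have := ler_wpM2r (sqr_ge0 (v ord0)) l0; have := ler_wpM2r (sqr_ge0 (v a1)) l1.
lra.
Qed.

(** The weights [c_ij] need not be symmetric, so the plain sum can fail to be monotone. From
    [2 x (x - y) >= x^2 - y^2] each coupling term is bounded below by a difference of squares;
    collecting the coefficient of each [V a j ^+ 2] gives exactly the left side of
    [dominant_weights], with [2 * lam] as diagonal excess, hence 1. *)
Lemma monotone_weights : exists u : 'I_N -> R, (forall i, 0 < u i) /\
  forall V : 'M[R]_(2, N), \sum_a \sum_i V a i ^+ 2 <=
    \sum_a \sum_i u i * (V a i * pgrad_lin G i V a).
Proof.
have [lam lamP] := choice quad_coercive.
pose C i j := if j \in nbr G i then weight G i j else 0.
have C0 i j : 0 <= C i j.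
  rewrite /C; case: ifPn => // ji; have [_ _ _ _ w0] := hG i.
  by rewrite ltW// w0.
have lam20 i : 0 < 2 * lam i by rewrite mulr_gt0// (lamP i).1.
have [u [u0 uE]] := dominant_weights C0 lam20.
exists u; split=> // V.
have plE i a : pgrad_lin G i V a =
    2 * \sum_b quad G i a b * V b i + 2 * \sum_j C i j * (V a i - V a j).
  congr (_ + 2 * _); rewrite [LHS]big_mkcond; apply: eq_bigr => j _.
  by rewrite /C; case: ifP => //; rewrite mul0r.
have quadP : \sum_a \sum_i u i * (2 * lam i) * V a i ^+ 2 <=
    \sum_a \sum_i u i * (V a i * (2 * \sum_b quad G i a b * V b i)).
  rewrite [leLHS]exchange_big [leRHS]exchange_big; apply: ler_sum => i _ /=.
  have -> : \sum_a u i * (2 * lam i) * V a i ^+ 2 =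
      u i * 2 * (lam i * \sum_a V a i ^+ 2).
    by rewrite !mulr_sumr; apply: eq_bigr => a _; ring.
  have -> : \sum_a u i * (V a i * (2 * \sum_b quad G i a b * V b i)) =
      u i * 2 * \sum_a V a i * \sum_b quad G i a b * V b i.
    by rewrite [RHS]mulr_sumr; apply: eq_bigr => a _; ring.
  by rewrite ler_pM2l ?mulr_gt0//; apply: (lamP i).2.
have weightP a : \sum_i u i * \sum_j C i j * (V a i ^+ 2 - V a j ^+ 2) <=
    \sum_i u i * (V a i * (2 * \sum_j C i j * (V a i - V a j))).
  apply: ler_sum => i _; rewrite ler_pM2l// mulr_sumr mulr_sumr.
  apply: ler_sum => j _.
  rewrite -subr_ge0; have -> : V a i * (2 * (C i j * (V a i - V a j))) -
    C i j * (V a i ^+ 2 - V a j ^+ 2) = C i j * (V a i - V a j) ^+ 2 by ring.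
  by rewrite mulr_ge0 ?sqr_ge0.
have key a : \sum_i V a i ^+ 2 = \sum_i u i * (2 * lam i) * V a i ^+ 2 +
   \sum_i u i * \sum_j C i j * (V a i ^+ 2 - V a j ^+ 2).
  have -> : \sum_i u i * \sum_j C i j * (V a i ^+ 2 - V a j ^+ 2) =
     \sum_i u i * (\sum_j C i j) * V a i ^+ 2 -
     \sum_j (\sum_i u i * C i j) * V a j ^+ 2.
    have -> : \sum_j (\sum_i u i * C i j) * V a j ^+ 2 =
        \sum_i \sum_j u i * C i j * V a j ^+ 2.
      by rewrite exchange_big; apply: eq_bigr => j _; rewrite mulr_suml.
    rewrite -sumrB; apply: eq_bigr => i _.
    rewrite !mulr_sumr mulr_suml -sumrB; apply: eq_bigr => j _; ring.
  rewrite addrA -big_split -sumrB; apply: eq_bigr => i _ /=.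
  rewrite -[LHS]mulr1 -[X in _ * X = _](uE i); ring.
under eq_bigr do rewrite key.
rewrite big_split /=.
apply: (le_trans (lerD quadP (ler_sum _ (fun a _ => weightP a)))).
rewrite -big_split le_eqVlt; apply/orP; left; apply/eqP.
apply: eq_bigr => a _; rewrite -big_split; apply: eq_bigr => i _ /=.
by rewrite plE; ring.
Qed.

Lemma pgrad_lin_bound : exists b : R, 0 < b /\ forall i (V : 'M[R]_(2, N)) a,
  `|pgrad_lin G i V a| <= b * n1 V.
Proof.
pose c i a := 2 * \sum_b `|quad G i a b| + 4 * \sum_(j in nbr G i) `|weight G i j|.
have c0 i a : 0 <= c i a.
  by rewrite addr_ge0// mulr_ge0// sumr_ge0.
exists (1 + \sum_i \sum_a c i a); split.
  rewrite ltr_pwDl//; apply: sumr_ge0 => i _; exact: sumr_ge0.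
move=> i V a; apply: (le_trans (y := c i a * n1 V)); last first.
  rewrite ler_wpM2r ?n1_ge0//.
  rewrite (bigD1 i)//= (bigD1 a)//=.
  have h1 : 0 <= \sum_(b | b != a) c i b by exact: sumr_ge0.
  have h2 : 0 <= \sum_(j | j != i) \sum_b c j b.
    by apply: sumr_ge0 => j _; exact: sumr_ge0.
  lra.
have H1 : `|\sum_b quad G i a b * V b i| <= (\sum_b `|quad G i a b|) * n1 V.
  rewrite mulr_suml; apply: (le_trans (ler_norm_sum _ _ _)).
  by apply: ler_sum => b _; rewrite normrM ler_wpM2l// le_n1.
have H2 : `|\sum_(j in nbr G i) weight G i j * (V a i - V a j)| <=
    (\sum_(j in nbr G i) `|weight G i j|) * (n1 V + n1 V).
  rewrite mulr_suml; apply: (le_trans (ler_norm_sum _ _ _)).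
  apply: ler_sum => j _; rewrite normrM ler_wpM2l//.
  by apply: (le_trans (ler_normB _ _)); rewrite lerD// le_n1.
rewrite /pgrad_lin /c; move: H1 H2; rewrite !ler_norml => /andP[? ?] /andP[? ?].
by apply/andP; split; lra.
Qed.

End Monotone.

(** * Coercivity of the pinned Laplacian *)

Section GraphCoercivity.
Variables (R : realType) (N : nat) (A : 'M[R]_N).
Hypotheses (N2 : (2 <= N)%N) (hA : weighted_adjacency A).
Hypotheses (hund : undirected A) (hconn : connected_graph A).

Let form j (e : 'I_N -> R) : R :=
  \sum_i e i * (\sum_l A i l * (e i - e l) + A i j * e i).

Let formE j e : form j e =
  2^-1 * (\sum_i \sum_l A i l * (e i - e l) ^+ 2) + \sum_i A i j * e i ^+ 2.
Proof.
rewrite /form; under eq_bigr do rewrite mulrDr.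
rewrite big_split /=; congr (_ + _); last by apply: eq_bigr => i _; ring.
set S := \sum_i _.
have SE : S = \sum_i \sum_l A i l * (e i - e l) * e i.
  by apply: eq_bigr => i _; rewrite mulrC mulr_suml.
have SE' : S = \sum_i \sum_l A i l * (e l - e i) * e l.
  rewrite SE exchange_big; apply: eq_bigr => i _; apply: eq_bigr => l _.
  by rewrite hund.
have : S + S = \sum_i \sum_l A i l * (e i - e l) ^+ 2.
  rewrite {1}SE SE' -big_split; apply: eq_bigr => i _ /=.
  rewrite -big_split; apply: eq_bigr => l _ /=; ring.
by move=> <-; field.
Qed.

(** Symmetry turns the form into edge energies plus pinning terms. The pinning controls [e] at the
    neighbours of [j], not at [j] itself since [A j j = 0]; at least one neighbour exists because
    the graph is connected with two or more nodes. Edge energies then carry the control along paths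
    to every node. *)
Lemma graph_coercive : exists h : R, 0 < h /\ forall j (e : 'I_N -> R),
  h * \sum_i e i ^+ 2 <=
  \sum_i e i * (\sum_l A i l * (e i - e l) + A i j * e i).
Proof.
have [A0 _] := hA.
have edge_le i l e : A i l * (e i - e l) ^+ 2 <=
    \sum_i \sum_l A i l * (e i - e l) ^+ 2.
  rewrite (bigD1 i)//= (bigD1 l)//= -addrA lerDl addr_ge0//.
    by apply: sumr_ge0 => k _; rewrite mulr_ge0 ?sqr_ge0.
  by apply: sumr_ge0 => k _; apply: sumr_ge0 => k' _; rewrite mulr_ge0 ?sqr_ge0.
have pin_le i j e : A i j * e i ^+ 2 <= \sum_i A i j * e i ^+ 2.
  rewrite (bigD1 i)//= lerDl.
  by apply: sumr_ge0 => k _; rewrite mulr_ge0 ?sqr_ge0.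
have sum0 e : 0 <= \sum_i \sum_l A i l * (e i - e l) ^+ 2.
  by apply: sumr_ge0 => k _; apply: sumr_ge0 => k' _; rewrite mulr_ge0 ?sqr_ge0.
have pin0 j e : 0 <= \sum_i A i j * e i ^+ 2.
  by apply: sumr_ge0 => k _; rewrite mulr_ge0 ?sqr_ge0.
pose P j i := exists c : R, 0 <= c /\ forall e, e i ^+ 2 <= c * form j e.
have Pedge j i l : P j i -> 0 < A l i -> P j l.
  (* From [(e l)^2 <= 2 (e l - e i)^2 + 2 (e i)^2], the edge energy bounding [(e l - e i)^2] by
     twice the form divided by [A l i]. *)
  move=> [c [c0 ce]] Ali; exists (2 * c + 4 * (A l i)^-1).
  split; first by rewrite addr_ge0// mulr_ge0// invr_ge0 ltW.
  move=> e; have := ce e.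
  have : (e l - e i) ^+ 2 <= (A l i)^-1 * (2 * form j e).
    rewrite ler_pdivlMl// formE mulrDr mulVKf//.
    by have := edge_le l i e; have := pin0 j e; lra.
  have : 0 <= (e l - 2 * e i) ^+ 2 by exact: sqr_ge0.
  lra.
have Pconn j i l : P j i -> connect (fun k l => 0 < A l k) i l -> P j l.
  move=> Pi /connectP[p]; elim: p i Pi => [|k p IH] i Pi /=; first by move=> _ ->.
  by move=> /andP[ik pth] e; apply: (IH k) => //; exact: Pedge ik.
have Pall j i : P j i.
  have [i0 i0j] : exists i0, i0 != j.
    have : (0 < #|predC1 j|)%N by rewrite cardC1 card_ord -subn1 subn_gt0.
    by move=> /card_gt0P[i0]; rewrite !inE; exists i0.
  have [k kj] : exists k, 0 < A k j.
    have : j != i0 by rewrite eq_sym.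
    move=> /hconn/connectP[[|k p]] /=; first by move=> _ e; rewrite e eqxx in i0j.
    by move=> /andP[]; exists k.
  have Pk : P j k.
    exists (A k j)^-1; split; first by rewrite invr_ge0 ltW.
    move=> e; rewrite ler_pdivlMl// formE.
    by have := pin_le k j e; have := sum0 e; lra.
  by have [<-//|ki] := eqVneq k i; apply: Pconn Pk _; exact: hconn.
have [c cP] := @choice ('I_N * 'I_N)%type R
  (fun p c => 0 <= c /\ forall e, e p.2 ^+ 2 <= c * form p.1 e)
  (fun p => Pall p.1 p.2).
have K0 : 0 < 1 + \sum_p c p by rewrite ltr_pwDl// sumr_ge0// => p _; exact: (cP p).1.
have form0 j e : 0 <= form j e by rewrite formE addr_ge0// mulr_ge0.
exists (1 + \sum_p c p)^-1; split; first by rewrite invr_gt0.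
move=> j e; rewrite ler_pdivrMl// -/(form j e).
apply: (le_trans (y := \sum_i c (j, i) * form j e)).
  by apply: ler_sum => i _; exact: (cP (j, i)).2.
rewrite -mulr_suml ler_wpM2r//.
have -> : \sum_p c p = \sum_j \sum_i c (j, i).
  by rewrite pair_bigA; apply: eq_bigr => -[].
rewrite [X in _ <= _ + X](bigD1 j)//=.
have : 0 <= \sum_(k | k != j) \sum_i c (k, i).
  by apply: sumr_ge0 => k _; apply: sumr_ge0 => i _; exact: (cP (k, i)).1.
lra.
Qed.
End GraphCoercivity.

(** * Lipschitz bounds on boxes *)

Section Lipschitz.
Variables (R : realType).

Lemma enorm_le_n1 m n (v : 'M[R]_(m, n)) : enorm v <= n1 v.
Proof.
rewrite -[leRHS]ger0_norm ?n1_ge0// -sqrtr_sqr ler_sqrt ?sqr_ge0//.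
exact: sum_sqr_le_n1.
Qed.

Lemma le_enorm m n (v : 'M[R]_(m, n)) a j : `|v a j| <= enorm v.
Proof.
rewrite -sqrtr_sqr ler_sqrt; last first.
  by apply: sumr_ge0 => b _; apply: sumr_ge0 => k _; exact: sqr_ge0.
rewrite (bigD1 a)//= (bigD1 j)//= -addrA lerDl addr_ge0//.
  by apply: sumr_ge0 => k _; exact: sqr_ge0.
by apply: sumr_ge0 => b _; apply: sumr_ge0 => k _; exact: sqr_ge0.
Qed.

Variable N : nat.
Implicit Types (X Y : 'M[R]_(2, N)) (h : 'M[R]_(2, N) -> 'cV[R]_2).

Lemma is_derive_line h X a j b (r : R) :
  derivable h (X + r *: delta_mx a j) (delta_mx a j) ->
  is_derive r (1 : R) (fun s => h (X + s *: delta_mx a j) b ord0)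
    (pderiv h a j (X + r *: delta_mx a j) b ord0).
Proof.
set d := delta_mx a j; set p := X + r *: d => dh.
have dhb : derivable (fun Z => h Z b ord0) p d by move/derivable_mxP : dh.
have E : (fun e : R => e^-1 *: (((fun s => h (X + s *: d) b ord0) \o shift r) (e *: (1 : R)) -
     (fun s => h (X + s *: d) b ord0) r)) =
   (fun e : R => e^-1 *: (((fun Z => h Z b ord0) \o shift p) (e *: d) - h p b ord0)).
  apply/funext => e /=; congr (_ *: (h _ _ _ - _)).
  by rewrite /p [e *: 1]mulr1 scalerDl addrCA addrC -addrA.
apply: DeriveDef; first by rewrite /derivable E.
by rewrite /derive E /pderiv derive_mx// mxE.
Qed.

Lemma lipschitz_coord h (M : R) X a j (s : R) b :
  C1 h ->
  (forall r, (0 <= r <= s) || (s <= r <= 0) ->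
     `|pderiv h a j (X + r *: delta_mx a j) b ord0| <= M) ->
  `|h (X + s *: delta_mx a j) b ord0 - h X b ord0| <= M * `|s|.
Proof.
move=> C1h hM; pose phi r := h (X + r *: delta_mx a j) b ord0.
have dphi r : is_derive r (1 : R) phi (pderiv h a j (X + r *: delta_mx a j) b ord0).
  by apply: is_derive_line; exact: (C1h a j).1.
have cphi u v : {within `[u, v], continuous phi}.
  apply: derivable_within_continuous => r _; exact: (@ex_derive _ _ _ _ _ _ _ (dphi r)).
have -> : h X b ord0 = phi 0 by rewrite /phi scale0r addr0.
rewrite -/(phi s); have [s0|s0] := leP 0 s.
  have [c cin ->] := MVT_segment s0 (fun r _ => dphi r) (cphi 0 s).
  rewrite subr0 normrM ler_wpM2r//; apply: hM.
  by move: cin; rewrite in_itv/= => ->.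
have [c cin] := MVT_segment (ltW s0) (fun r _ => dphi r) (cphi s 0).
rewrite sub0r distrC => ->; rewrite normrM normrN ler_wpM2r//; apply: hM.
by move: cin; rewrite in_itv/= => ->; rewrite orbT.
Qed.

(** Only partial derivatives along coordinates are given, so one coordinate is changed at a time and
    the mean value theorem is applied to each change. All intermediate points take each coordinate
    between those of [X] and [Y]; this is why a box, rather than a Euclidean ball, is the domain. *)
Lemma regular_lipschitz h : regular_unmodeled h -> forall rho : R,
  exists L : R, 0 < L /\ forall X Y,
    (forall a j, `|X a j| <= rho) -> (forall a j, `|Y a j| <= rho) ->
    forall b, `|h X b ord0 - h Y b ord0| <= L * n1 (X - Y).
Proof.
move=> [[C1h _] bh _] rho.
have [M MP] := @choice ('I_2 * 'I_N)%type R
  (fun p M => forall X, enorm X <= rho *+ (2 * N) -> enorm (pderiv h p.1 p.2 X) <= M)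
  (fun p => bh p.1 p.2 (rho *+ (2 * N))).
pose L := 1 + \sum_p `|M p|.
have L0 : 0 < L by rewrite ltr_pwDl// sumr_ge0.
have ML p : M p <= L.
  apply: le_trans (ler_norm _) _; rewrite /L (bigD1 p)//= addrCA lerDl.
  by rewrite addr_ge0// sumr_ge0.
exists L; split=> // Y X Yr Xr b.
pose upd (s : seq ('I_2 * 'I_N)) : 'M[R]_(2, N) :=
  \matrix_(a, j) if (a, j) \in s then Y a j else X a j.
have step s : uniq s -> `|h (upd s) b ord0 - h X b ord0| <=
    L * \sum_(p <- s) `|Y p.1 p.2 - X p.1 p.2|.
  elim: s => [_|[a j] s IH /= /andP[ajs us]].
    rewrite big_nil mulr0; have -> : upd [::] = X.
      by apply/matrixP => a j; rewrite mxE in_nil.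
    by rewrite subrr normr0.
  set w := Y a j - X a j.
  have updE : upd ((a, j) :: s) = upd s + w *: delta_mx a j.
    apply/matrixP => c k; rewrite !mxE in_cons xpair_eqE.
    have [->|ca] := eqVneq c a; last by rewrite /= mulr0 addr0.
    have [->|kj] := eqVneq k j; last by rewrite /= mulr0 addr0.
    by rewrite /= (negbTE ajs) /w mulr1 addrC subrK.
  have -> : h (upd ((a, j) :: s)) b ord0 - h X b ord0 =
     (h (upd s + w *: delta_mx a j) b ord0 - h (upd s) b ord0) +
     (h (upd s) b ord0 - h X b ord0) by rewrite updE addrA subrK.
  rewrite big_cons mulrDr; apply: (le_trans (ler_normD _ _)).
  rewrite lerD ?IH//; apply: lipschitz_coord => // r rw.
  apply: le_trans (ML (a, j)); apply: le_trans (le_enorm _ _ _) _.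
  apply: (MP (a, j)); apply: le_trans (enorm_le_n1 _) _.
  apply: n1_sum_const => c k.
  rewrite !mxE.
  have [-> {c}|ca] := eqVneq c a; last first.
    by rewrite /= mulr0 addr0; case: ifP.
  have [-> {k}|kj] := eqVneq k j; last by rewrite /= mulr0 addr0; case: ifP.
  rewrite (negbTE ajs) /= mulr1.
  move: rw (Xr a j) (Yr a j); rewrite /w !ler_norml.
  by move=> /orP[] /andP[? ?] /andP[? ?] /andP[? ?]; apply/andP; split; lra.
have := step (index_enum _) (index_enum_uniq _).
have -> : upd (index_enum _) = Y.
  by apply/matrixP => a j; rewrite mxE mem_index_enum.
move=> /le_trans; apply; rewrite ler_pM2l// /n1 pair_bigA.
by apply: ler_sum => p _; rewrite !mxE.
Qed.

Lemma regular_lipschitz_family (g : 'I_N -> 'M[R]_(2, N) -> 'cV[R]_2) :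
  (forall i, regular_unmodeled (g i)) -> forall rho : R,
  exists L : R, 0 < L /\ forall X Y,
    (forall a j, `|X a j| <= rho) -> (forall a j, `|Y a j| <= rho) ->
    forall i b, `|g i X b ord0 - g i Y b ord0| <= L * n1 (X - Y).
Proof.
move=> hg rho.
have [L LP] := choice (fun i => regular_lipschitz (hg i) rho).
exists (1 + \sum_i L i); split.
  by rewrite ltr_pwDl// sumr_ge0// => i _; rewrite ltW// (LP i).1.
move=> X Y Xr Yr i b; apply: le_trans ((LP i).2 X Y Xr Yr b) _.
rewrite ler_wpM2r ?n1_ge0// (bigD1 i)//= addrCA lerDl addr_ge0// sumr_ge0// => j _.
by rewrite ltW// (LP j).1.
Qed.

End Lipschitz.

(** * Dissipation through the signum selection *)

Section SignDissipation.
Variable R : realType.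

Lemma near_right_itv (P : R -> Prop) (t : R) :
  (\forall h \near 0^'+, P (t + h)) ->
  \forall h \near 0^'+, forall r, t < r < t + h -> P r.
Proof.
move=> /nbhs_ballP[d /= d0 H]; near=> h => r /andP[tr rh].
have hd : h < d by near: h; exact: nbhs_right_lt.
have := H (r - t); rewrite /ball /= sub0r normrN gtr0_norm ?subr_gt0// subrKC.
by apply=> //; lra.
Unshelve. all: by end_near. Qed.

Lemma ler_mul_norm (a x b : R) : `|x| <= b -> a * x <= `|a| * b.
Proof.
by move=> xb; apply: le_trans (ler_norm _) _; rewrite normrM ler_wpM2l.
Qed.

Lemma Sgn_norm (e s : R) : Sgn e s -> -1 <= s <= 1.
Proof.
rewrite /Sgn /=; case: eqP => // _ ->.
by have [_|_|_] := sgrP e; apply/andP; split; lra.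
Qed.

Variables (zeta z f s G Q : R -> R) (t0 t K beta L c delta mQ : R).
Hypotheses (t0t : t0 <= t) (beta0 : 0 < beta) (L0 : 0 <= L).
Hypothesis zf : integral_solution t0 z f.
Hypothesis fE : forall r, t0 <= r -> f r = K * zeta r + beta * s r.
Hypothesis sS : forall r, t0 <= r -> Sgn (zeta r) (s r).
Hypothesis Gt : forall e, 0 < e ->
  \forall h \near 0^'+, `|G (t + h) - G t| <= h * (L + e).
Hypothesis dQ : is_derive t 1 Q mQ.

(** [Q] collects the differentiable terms, [z] integrates the sign, and [G] stands for [g_i(xhat)],
    of which only an increment bound to the right is required. *)
Let p r := Q r - z r + G r.

Hypothesis dzeta : is_derive t 1 zeta (p t + delta - c * zeta t).

Let zeta_right e : 0 < e -> \forall h \near 0^'+, `|zeta (t + h) - zeta t| <= e.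
Proof.
move=> e0; set v := p t + delta - c * zeta t.
have q0 : 0 < e / (`|v| + 1) by rewrite divr_gt0// ltr_wpDl.
near=> h; have h0 : 0 < h by [].
have : `|zeta (t + h) - zeta t - h * v| <= h * 1.
  by near: h; apply: is_derive_right.
have : h <= e / (`|v| + 1) by near: h; exact: nbhs_right_le.
rewrite ler_pdivlMr ?ltr_wpDl// => he H.
rewrite -[zeta _ - _](subrK (h * v)); apply: le_trans (ler_normD _ _) _.
rewrite normrM gtr0_norm//; lra.
Unshelve. all: by end_near. Qed.

Let z_incr e lo hi : 0 < e ->
  (\forall h \near 0^'+, lo <= beta * s (t + h) <= hi) ->
  \forall h \near 0^'+, h * (K * zeta t + lo - e) <= z (t + h) - z t
    <= h * (K * zeta t + hi + e).
Proof.
move=> e0 slohi; have q0 : 0 < e / (`|K| + 1) by rewrite divr_gt0// ltr_wpDl.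
near=> h; have h0 : 0 < h by [].
have H : forall r, t < r < t + h -> lo <= beta * s r <= hi.
  by near: h; exact: near_right_itv.
have H' : forall r, t < r < t + h -> `|zeta r - zeta t| <= e / (`|K| + 1).
  near: h; apply: (@near_right_itv (fun r => `|zeta r - zeta t| <= e / (`|K| + 1))).
  exact: zeta_right.
have th : t < t + h by rewrite ltrDl.
have := integral_solution_incr zf t0t th
  (lo := K * zeta t + lo - e) (hi := K * zeta t + hi + e).
have -> : t + h - t = h by ring.
rewrite [_ * h]mulrC [(_ + _) * h]mulrC; apply.
move=> r tr; rewrite fE; last by move: tr => /andP[/ltW/(le_trans t0t)].
have : `|K * zeta r - K * zeta t| <= e.
  rewrite -mulrBr normrM; have := H' _ tr.
  rewrite ler_pdivlMr ?ltr_wpDl//; apply: le_trans.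
  by rewrite mulrC ler_wpM2l// lerDl.
have /andP[? ?] := H _ tr.
by rewrite ler_norml => /andP[? ?]; apply/andP; split; lra.
Unshelve. all: by end_near. Qed.

Let s_bound r : t0 <= r -> - beta <= beta * s r <= beta.
Proof.
move=> /sS/Sgn_norm/andP[s1 s2]; apply/andP; split.
  by rewrite -[- beta]mulrN1 ler_pM2l.
by rewrite -[leRHS]mulr1 ler_pM2l.
Qed.

Let s_right_bound : \forall h \near 0^'+, - beta <= beta * s (t + h) <= beta.
Proof.
near=> h; have h0 : 0 < h by [].
by apply: s_bound; rewrite (le_trans t0t)// lerDl ltW.
Unshelve. all: by end_near. Qed.

(* When [zeta t = 0 <> zeta' t] the sign is eventually that of [zeta' t];      *)
(* when both vanish, [p t = - delta] bounds the contribution of any selection. *)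
Let sign_cancel e : 0 < e -> \forall h \near 0^'+,
  - (p t * (z (t + h) - z t - h * (K * zeta t)))
  + beta * (`|zeta (t + h)| - `|zeta t|) <=
  h * (beta * (`|delta| - c * `|zeta t|) + e).
Proof.
move=> e0; set P := p t; set v := P + delta - c * zeta t.
pose e' := e / (`|P| + beta + 1).
have D0 : 0 < `|P| + beta + 1 by rewrite ltr_wpDl// addr_ge0// ltW.
have e'0 : 0 < e' by rewrite divr_gt0.
have e'E : e' * `|P| + e' * beta + e' = e.
  rewrite -!mulrDr -{2}[e']mulr1 -!mulrDr /e'; field; exact: lt0r_neq0.
(* With the sign equal to [sg] just after [t], [z] gains [beta * sg] beyond [K * zeta] and [|zeta|]
   grows like [sg * v]. In [- P * beta * sg + beta * sg * (P + delta - c * zeta t)] the terms in [P]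
   cancel, leaving [beta * (sg * delta - c * |zeta t|)]. *)
have constant_sign (sg : R) : `|sg| = 1 -> sg * zeta t = `|zeta t| ->
    (\forall h \near 0^'+, `|zeta (t + h)| = sg * zeta (t + h) /\ s (t + h) = sg) ->
    \forall h \near 0^'+,
      - (P * (z (t + h) - z t - h * (K * zeta t)))
      + beta * (`|zeta (t + h)| - `|zeta t|) <=
      h * (beta * (`|delta| - c * `|zeta t|) + e).
  move=> sg1 sgz near_sg.
  have sl : \forall h \near 0^'+, beta * sg <= beta * s (t + h) <= beta * sg.
    by near=> h; have [|_ ->] := near near_sg h => //; rewrite lexx.
  near=> h; have h0 : 0 < h by [].
  have [zE _] : `|zeta (t + h)| = sg * zeta (t + h) /\ s (t + h) = sg.
    by near: h.
  have /andP[z1 z2] : h * (K * zeta t + beta * sg - e') <= z (t + h) - z t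
      <= h * (K * zeta t + beta * sg + e') by near: h; exact: z_incr.
  have H1 : `|zeta (t + h) - zeta t - h * v| <= h * e'.
    by near: h; exact: is_derive_right.
  have H2 : - (P * (z (t + h) - z t - h * (K * zeta t) - h * (beta * sg)))
      <= h * (e' * `|P|).
    rewrite -mulNr [leRHS]mulrA [leRHS]mulrC -(normrN P).
    by apply: ler_mul_norm; rewrite ler_norml; apply/andP; split; lra.
  have H3 : sg * (zeta (t + h) - zeta t - h * v) <= h * e'.
    by apply: le_trans (ler_norm _) _; rewrite normrM sg1 mul1r.
  have H4 : sg * delta <= `|delta|.
    by apply: le_trans (ler_norm _) _; rewrite normrM sg1 mul1r.
  have H5 : beta * (sg * (zeta (t + h) - zeta t - h * v)) <= beta * (h * e').
    by rewrite ler_pM2l.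
  have H6 : h * beta * (sg * delta) <= h * beta * `|delta|.
    by rewrite ler_pM2l// mulr_gt0.
  have H7 : h * (e' * `|P| + e' * beta + e') = h * e by rewrite e'E.
  have H8 : 0 < h * e' by rewrite mulr_gt0.
  rewrite zE -sgz; move: H5 H2 H6 H7; rewrite /v; lra.
have [z0|z0|z0] := ltgtP (zeta t) 0.
- apply: (constant_sign (-1)); rewrite ?normrN1// ?mulN1r ?ltr0_norm//.
  near=> h; have h0 : 0 < h by [].
  have zneg : zeta (t + h) < 0.
    have : `|zeta (t + h) - zeta t| <= - zeta t / 2.
      by near: h; apply: zeta_right; lra.
    by rewrite ler_norml => /andP[_]; lra.
  rewrite ltr0_norm// mulN1r; split=> //.
  have := sS (_ : t0 <= t + h); rewrite /Sgn /= lt_eqF// ltr0_sg//; apply.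
  by rewrite (le_trans t0t)// lerDl ltW.
- apply: (constant_sign 1); rewrite ?normr1// ?mul1r ?gtr0_norm//.
  near=> h; have h0 : 0 < h by [].
  have zpos : 0 < zeta (t + h).
    have : `|zeta (t + h) - zeta t| <= zeta t / 2.
      by near: h; apply: zeta_right; lra.
    by rewrite ler_norml => /andP[]; lra.
  rewrite gtr0_norm// mul1r; split=> //.
  have := sS (_ : t0 <= t + h); rewrite /Sgn /= gt_eqF// gtr0_sg//; apply.
  by rewrite (le_trans t0t)// lerDl ltW.
have [v0|v0|v0] := ltgtP v 0.
- apply: (constant_sign (-1)); rewrite ?normrN1// ?z0 ?mulr0 ?normr0//.
  near=> h; have h0 : 0 < h by [].
  have zneg : zeta (t + h) < 0.
    have : `|zeta (t + h) - zeta t - h * v| <= h * (- v / 2).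
      by near: h; apply: is_derive_right => //; lra.
    have : 0 < h * - v by rewrite mulr_gt0// oppr_gt0.
    by rewrite ler_norml z0 => ? /andP[_]; lra.
  rewrite ltr0_norm// mulN1r; split=> //.
  have := sS (_ : t0 <= t + h); rewrite /Sgn /= lt_eqF// ltr0_sg//; apply.
  by rewrite (le_trans t0t)// lerDl ltW.
- apply: (constant_sign 1); rewrite ?normr1// ?z0 ?mulr0 ?normr0//.
  near=> h; have h0 : 0 < h by [].
  have zpos : 0 < zeta (t + h).
    have : `|zeta (t + h) - zeta t - h * v| <= h * (v / 2).
      by near: h; apply: is_derive_right => //; lra.
    have : 0 < h * v by rewrite mulr_gt0.
    by rewrite ler_norml z0 => ? /andP[]; lra.
  rewrite gtr0_norm// mul1r; split=> //.
  have := sS (_ : t0 <= t + h); rewrite /Sgn /= gt_eqF// gtr0_sg//; apply.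
  by rewrite (le_trans t0t)// lerDl ltW.
have Pd : `|P| = `|delta|.
  by rewrite -normrN; congr (`| _ |); move: v0; rewrite /v z0; lra.
near=> h; have h0 : 0 < h by [].
have /andP[z1 z2] : h * (K * zeta t - beta - e') <= z (t + h) - z t
    <= h * (K * zeta t + beta + e') by near: h; exact: z_incr.
have H1 : `|zeta (t + h) - zeta t - h * v| <= h * e'.
  by near: h; exact: is_derive_right.
rewrite v0 mulr0 subr0 z0 subr0 in H1.
have H2 : - (P * (z (t + h) - z t - h * (K * zeta t))) <= h * ((beta + e') * `|P|).
  rewrite -mulNr [leRHS]mulrA [leRHS]mulrC -(normrN P).
  by apply: ler_mul_norm; rewrite ler_norml; apply/andP; split; lra.
have H5 : beta * `|zeta (t + h)| <= beta * (h * e') by rewrite ler_pM2l.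
have H7 : h * (e' * `|P| + e' * beta + e') = h * e by rewrite e'E.
have H8 : 0 < h * e' by rewrite mulr_gt0.
move: H2; rewrite z0 normr0 -Pd; lra.
Unshelve. all: by end_near. Qed.

(** Writing [p (t + h) = P + D], the square contributes [P * D] and a term in [D ^+ 2] of order
    [h ^+ 2]. The sign part of [P * D] is compensated by the increment of [beta * |zeta|], as in
    [sign_cancel]. *)
Lemma dini_energy : dini (fun r => 2^-1 * p r ^+ 2 + beta * `|zeta r|) t
  (p t * (mQ - K * zeta t) + `|p t| * L + beta * (`|delta| - c * `|zeta t|)).
Proof.
move=> e e0; set P := p t.
pose e' := e / (2 * `|P| + 3).
have D0 : 0 < 2 * `|P| + 3 by rewrite ltr_wpDl// mulr_ge0.
have e'0 : 0 < e' by rewrite divr_gt0.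
have e'E : 2 * (e' * `|P|) + 3 * e' = e by rewrite /e'; field; exact: lt0r_neq0.
(* [C] bounds [|D| / h] when the three increments of [p] are each estimated with slack 1; taking
   [h <= e' / C ^+ 2] then gives [D ^+ 2 <= h * e']. *)
pose C := `|mQ| + `|K * zeta t| + beta + L + 3.
have C0 : 0 < C.
  by have := normr_ge0 mQ; have := normr_ge0 (K * zeta t); have := beta0; have := L0; rewrite /C; lra.
have qC0 : 0 < e' / C ^+ 2 by rewrite divr_gt0// exprn_gt0.
near=> h; have h0 : 0 < h by [].
have H1 : `|Q (t + h) - Q t - h * mQ| <= h * e'.
  by near: h; exact: is_derive_right.
have H1' : `|Q (t + h) - Q t - h * mQ| <= h * 1.
  by near: h; exact: is_derive_right.
have H2 : `|G (t + h) - G t| <= h * (L + e') by near: h; exact: Gt.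
have H2' : `|G (t + h) - G t| <= h * (L + 1) by near: h; exact: Gt.
have H3 : - (P * (z (t + h) - z t - h * (K * zeta t)))
    + beta * (`|zeta (t + h)| - `|zeta t|) <=
    h * (beta * (`|delta| - c * `|zeta t|) + e') by near: h; exact: sign_cancel.
have /andP[z1 z2] : h * (K * zeta t - beta - 1) <= z (t + h) - z t
    <= h * (K * zeta t + beta + 1) by near: h; apply: z_incr.
have H4 : h <= e' / C ^+ 2 by near: h; exact: nbhs_right_le.
pose D := p (t + h) - P.
have DE : D = (Q (t + h) - Q t) - (z (t + h) - z t) + (G (t + h) - G t).
  rewrite /D /P /p; ring.
have DC : `|D| <= h * C.
  have hK : h * `|K * zeta t| = `|h * (K * zeta t)| by rewrite [RHS]normrM (gtr0_norm h0).
  have hm : h * `|mQ| = `|h * mQ| by rewrite [RHS]normrM (gtr0_norm h0).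
  have /andP[? ?] : - `|h * (K * zeta t)| <= h * (K * zeta t) <= `|h * (K * zeta t)|.
    by rewrite -ler_norml.
  have /andP[? ?] : - `|h * mQ| <= h * mQ <= `|h * mQ| by rewrite -ler_norml.
  move: H1' H2'; rewrite /C !ler_norml => /andP[? ?] /andP[? ?].
  by apply/andP; split; rewrite DE; lra.
have D2 : D ^+ 2 <= h * e'.
  rewrite -real_normK ?num_real//; apply: (le_trans (y := (h * C) ^+ 2)).
    by rewrite lerXn2r// nnegrE// mulr_ge0// ltW.
  move: H4; rewrite ler_pdivlMr ?exprn_gt0// => H4.
  by rewrite exprMn expr2 -mulrA ler_pM2l.
have P1 : P * (Q (t + h) - Q t - h * mQ) <= h * (e' * `|P|).
  by rewrite [leRHS]mulrA [leRHS]mulrC; exact: ler_mul_norm.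
have P2 : P * (G (t + h) - G t) <= h * ((L + e') * `|P|).
  by rewrite [leRHS]mulrA [leRHS]mulrC; exact: ler_mul_norm.
have -> : p (t + h) = P + D by rewrite /D; ring.
have H7 : h * (2 * (e' * `|P|) + 3 * e') = h * e by rewrite e'E.
have PD : P * D = P * (Q (t + h) - Q t) - P * (z (t + h) - z t)
   + P * (G (t + h) - G t) by rewrite DE; ring.
have : 0 < h * e' by rewrite mulr_gt0.
rewrite -/P; lra.
Unshelve. all: by end_near. Qed.

End SignDissipation.

(** * Finite families: common bounds and derivatives *)

Section FiniteBounds.
Variable R : realType.

Lemma finite_pos_bounds (I : finType) (f : I -> R) : (forall i, 0 < f i) ->
  exists lo hi : R, [/\ 0 < lo, 0 < hi & forall i, lo <= f i <= hi].
Proof.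
move=> f0.
have le_sum (F : I -> R) i : (forall i, 0 < F i) -> F i <= 1 + \sum_i F i.
  move=> F0; rewrite (bigD1 i)//= addrCA lerDl addr_ge0// sumr_ge0// => j _.
  exact: ltW.
have sum0 (F : I -> R) : (forall i, 0 < F i) -> 0 < 1 + \sum_i F i.
  by move=> F0; rewrite ltr_pwDl// sumr_ge0// => i _; exact: ltW.
have f0' i : 0 < (f i)^-1 by rewrite invr_gt0.
exists (1 + \sum_i (f i)^-1)^-1, (1 + \sum_i f i); split.
- by rewrite invr_gt0; exact: (sum0 (fun i => (f i)^-1)).
- exact: sum0.
move=> i; rewrite le_sum// andbT -[leRHS]invrK lef_pV2 ?posrE//.
  exact: (le_sum (fun i => (f i)^-1)).
exact: (sum0 (fun i => (f i)^-1)).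
Qed.

Lemma is_derive_bigsum (I : finType) (F : I -> R -> R) (L : I -> R) t :
  (forall i, is_derive t (1 : R) (F i) (L i)) ->
  is_derive t (1 : R) (fun r => \sum_i F i r) (\sum_i L i).
Proof.
move=> dF; elim: (index_enum I) => [|i s IH].
  rewrite big_nil; have -> : (fun r => \sum_(i <- [::]) F i r) = cst 0.
    by apply/funext => r; rewrite big_nil.
  exact: is_derive_cst.
have -> : (fun r => \sum_(j <- i :: s) F j r) =
    F i + (fun r => \sum_(j <- s) F j r) by apply/funext => r; rewrite big_cons.
by rewrite big_cons; exact: is_deriveD.
Qed.

Lemma is_derive_sqr (k : R) (f : R -> R) (t l : R) : is_derive t (1 : R) f l ->
  is_derive t (1 : R) (fun r => k * f r ^+ 2) (2 * (k * (f t * l))).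
Proof.
move=> df; have -> : (fun r => k * f r ^+ 2) = k *: (f * f).
  by apply/funext => r.
apply: (is_derive_eq (is_deriveZ _ _)).
by rewrite /GRing.scale /=; ring.
Qed.

End FiniteBounds.

(** * The quadratic Lyapunov function of observer and consensus errors *)

Section ConsensusLyapunov.
Variables (R : realType) (N : nat) (G : game R N).
Variables (A thbar : 'M[R]_N).
Implicit Types (xi zeta e : 'M[R]_(2, N)) (eta : 'I_N -> 'M[R]_(2, N)).

Lemma pgrad_linD i xi xi' a :
  pgrad_lin G i (xi + xi') a = pgrad_lin G i xi a + pgrad_lin G i xi' a.
Proof.
have -> : pgrad_lin G i xi' a = pgrad G i (xi + xi') a - pgrad G i xi a.
  by rewrite pgradB addrC addKr.
by rewrite /pgrad; ring.
Qed.

Definition n1s eta : R := \sum_i n1 (eta i).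

Lemma n1s_ge0 eta : 0 <= n1s eta.
Proof. by apply: sumr_ge0 => i _; exact: n1_ge0. Qed.

Lemma n1_le_n1s eta i : n1 (eta i) <= n1s eta.
Proof.
rewrite /n1s (bigD1 i)//= lerDl; apply: sumr_ge0 => j _; exact: n1_ge0.
Qed.

Definition lyap (u : 'I_N -> R) xi eta : R :=
  \sum_a \sum_i u i * xi a i ^+ 2
  + \sum_i \sum_a \sum_j (thbar i j)^-1 * eta i a j ^+ 2.

(* Velocities of the errors [xhat - x*] and [y_i - xhat]; [e] stands for the   *)
(* injection [(k_i + c_i) zeta_i].                                             *)
Definition xi_dot xi eta e a i : R := - pgrad_lin G i (xi + eta i) a + e a i.

Definition eta_dot theta xi eta zeta e i a j : R :=
  - (theta * thbar i j) * (\sum_l A i l * (eta i a j - eta l a j)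
                           + A i j * (eta i a j - zeta a j))
  - xi_dot xi eta e a j.

Definition lyap_dot u theta xi eta zeta e : R :=
  2 * (\sum_a \sum_i u i * (xi a i * xi_dot xi eta e a i)
  + \sum_i \sum_a \sum_j
      (thbar i j)^-1 * (eta i a j * eta_dot theta xi eta zeta e i a j)).

Lemma is_derive_lyap u theta (xi : R -> 'M[R]_(2, N))
    (eta : 'I_N -> R -> 'M[R]_(2, N)) zeta e t :
  (forall a i, is_derive t (1 : R) (fun r => xi r a i)
     (xi_dot (xi t) (eta ^~ t) e a i)) ->
  (forall i a j, is_derive t (1 : R) (fun r => eta i r a j)
     (eta_dot theta (xi t) (eta ^~ t) zeta e i a j)) ->
  is_derive t (1 : R) (fun r => lyap u (xi r) (eta ^~ r))
    (lyap_dot u theta (xi t) (eta ^~ t) zeta e).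
Proof.
move=> dxi deta; rewrite /lyap_dot mulrDr !mulr_sumr.
apply: is_deriveD.
  apply: is_derive_bigsum => a; rewrite mulr_sumr.
  by apply: is_derive_bigsum => i; exact: is_derive_sqr.
apply: is_derive_bigsum => i; rewrite mulr_sumr.
apply: is_derive_bigsum => a; rewrite mulr_sumr.
by apply: is_derive_bigsum => j; exact: is_derive_sqr.
Qed.

Lemma n1s_sqr eta :
  n1s eta ^+ 2 <= (N * (2 * N))%:R * \sum_i \sum_a \sum_j eta i a j ^+ 2.
Proof.
have : n1 (\row_i n1 (eta i)) ^+ 2 <=
    (1 * N)%:R * \sum_(a < 1) \sum_j (\row_i n1 (eta i)) a j ^+ 2.
  exact: n1_le_sum_sqr.
have -> : n1 (\row_i n1 (eta i)) = n1s eta.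
  rewrite /n1 big_ord_recl big_ord0 addr0; apply: eq_bigr => i _.
  by rewrite mxE ger0_norm ?n1_ge0.
move=> /le_trans; apply; rewrite mul1n natrM -mulrA ler_wpM2l//.
rewrite big_ord_recl big_ord0 addr0 mulr_sumr; apply: ler_sum => i _.
by rewrite mxE; exact: n1_le_sum_sqr.
Qed.

Hypotheses (N2 : (2 <= N)%N) (hG : connectivity_game G).
Hypotheses (hA : weighted_adjacency A) (hund : undirected A).
Hypotheses (hconn : connected_graph A) (hthbar : forall i j, 0 < thbar i j).

(** The order of the quantifiers matters: only [Cth], the price of replacing [x] by [xhat] in the
    consensus law, depends on [theta]. The constants [w0] and [C0], from which the weight of the
    square root is built, and [w1], which bounds its initial value, do not. *)
Lemma consensus_lyapunov : exists u : 'I_N -> R,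
  exists w0 w1 m C0 thstar : R,
  [/\ (forall i, 0 < u i),
      [/\ 0 < w0, 0 < w1, 0 < m, 0 < C0 & 0 < thstar],
      (forall xi eta, w0 * (n1 xi ^+ 2 + n1s eta ^+ 2) <= lyap u xi eta
                      <= w1 * (n1 xi ^+ 2 + n1s eta ^+ 2)) &
      forall theta, thstar < theta -> exists2 Cth : R, 0 < Cth &
      forall xi eta zeta e, lyap_dot u theta xi eta zeta e <=
        - (m * (n1 xi ^+ 2 + n1s eta ^+ 2))
        + (C0 * n1 e + Cth * n1 zeta) * (n1 xi + n1s eta)].
Proof.
have [u [u0 uP]] := monotone_weights hG.
have [b [b0 bP]] := pgrad_lin_bound G.
have [h [h0 hP]] := graph_coercive N2 hA hund hconn.
have [ulo [U [ulo0 U0 uU]]] := finite_pos_bounds u0.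
have itau0 (p : 'I_N * 'I_N) : 0 < (thbar p.1 p.2)^-1 by rewrite invr_gt0.
have [tlo [tau [tlo0 tau0 tauP]]] := finite_pos_bounds itau0.
have A10 (p : 'I_N * 'I_N) : 0 < A p.1 p.2 + 1 by rewrite ltr_wpDl// hA.1.
have [alo [Am [alo0 Am0 AmP]]] := finite_pos_bounds A10.
have N0 : 0 < N%:R :> R by rewrite ltr0n (leq_trans _ N2).
set n := N%:R in N0.
have Sxi xi : n1 xi ^+ 2 <= 2 * n * \sum_a \sum_i xi a i ^+ 2.
  by rewrite -natrM; exact: n1_le_sum_sqr.
have Seta eta : n1s eta ^+ 2 <= 2 * n ^+ 2 * \sum_i \sum_a \sum_j eta i a j ^+ 2.
  have -> : 2 * n ^+ 2 = (N * (2 * N))%:R by rewrite !natrM -/n; ring.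
  exact: n1s_sqr.
have Sxi' xi : \sum_a \sum_i xi a i ^+ 2 <= n1 xi ^+ 2 by exact: sum_sqr_le_n1.
have Seta' eta : \sum_i \sum_a \sum_j eta i a j ^+ 2 <= n1s eta ^+ 2.
  apply: (le_trans (y := \sum_i n1 (eta i) ^+ 2)).
    by apply: ler_sum => i _; exact: sum_sqr_le_n1.
  rewrite [leRHS]expr2 {1}/n1s mulr_suml; apply: ler_sum => i _.
  by rewrite expr2 ler_wpM2l ?n1_ge0// n1_le_n1s.
(* [B1] is the coefficient of the cross term [X * Y]: estimation errors in the gradients, and
   observer velocities in the consensus errors. In [thstar] the three summands pay for the [Y^2]
   part of Young's inequality for that cross term, for the gradient term in [Y * Y], and for the
   margin [m]; [n ^+ 2 / h] converts the coercivity of the form into a bound by [Y^2]. *)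
pose B1 := 2 * (U * b) + 2 * (tau * b).
have B10 : 0 < B1 by rewrite addr_gt0// !mulr_gt0.
pose thstar := (n * B1 ^+ 2 / 2 + 2 * (tau * b) + (2 * n)^-1) * n ^+ 2 / h.
exists u, (Num.min (ulo / (2 * n)) (tlo / (2 * n ^+ 2))), (U + tau).
exists (2 * n)^-1, (2 * U + 2 * tau), thstar; split=> //.
- split.
  + by rewrite lt_min !divr_gt0// !mulr_gt0// exprn_gt0.
  + exact: addr_gt0.
  + by rewrite invr_gt0 mulr_gt0.
  + by rewrite addr_gt0// mulr_gt0.
  + by rewrite divr_gt0// mulr_gt0 ?exprn_gt0// !addr_gt0 ?invr_gt0 ?mulr_gt0 ?invr_gt0 ?exprn_gt0.
- move=> xi eta.
  have lowxi : ulo * \sum_a \sum_i xi a i ^+ 2 <= \sum_a \sum_i u i * xi a i ^+ 2.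
    rewrite mulr_sumr; apply: ler_sum => a _; rewrite mulr_sumr; apply: ler_sum => i _.
    by rewrite ler_wpM2r ?sqr_ge0//; have /andP[] := uU i.
  have upxi : \sum_a \sum_i u i * xi a i ^+ 2 <= U * \sum_a \sum_i xi a i ^+ 2.
    rewrite mulr_sumr; apply: ler_sum => a _; rewrite mulr_sumr; apply: ler_sum => i _.
    by rewrite ler_wpM2r ?sqr_ge0//; have /andP[] := uU i.
  have loweta : tlo * \sum_i \sum_a \sum_j eta i a j ^+ 2 <=
      \sum_i \sum_a \sum_j (thbar i j)^-1 * eta i a j ^+ 2.
    rewrite mulr_sumr; apply: ler_sum => i _; rewrite mulr_sumr; apply: ler_sum => a _.
    rewrite mulr_sumr; apply: ler_sum => j _.
    by rewrite ler_wpM2r ?sqr_ge0//; have /andP[] := tauP (i, j).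
  have upeta : \sum_i \sum_a \sum_j (thbar i j)^-1 * eta i a j ^+ 2 <=
      tau * \sum_i \sum_a \sum_j eta i a j ^+ 2.
    rewrite mulr_sumr; apply: ler_sum => i _; rewrite mulr_sumr; apply: ler_sum => a _.
    rewrite mulr_sumr; apply: ler_sum => j _.
    by rewrite ler_wpM2r ?sqr_ge0//; have /andP[] := tauP (i, j).
  have X2 := sqr_ge0 (n1 xi); have Y2 := sqr_ge0 (n1s eta).
  rewrite /lyap; apply/andP; split.
    set w0 := Num.min _ _.
    have e1 : w0 * n1 xi ^+ 2 <= ulo * \sum_a \sum_i xi a i ^+ 2.
      apply: (le_trans (y := ulo / (2 * n) * n1 xi ^+ 2)).
        by rewrite ler_wpM2r// ge_min lexx.
      by rewrite -mulrA ler_pM2l// ler_pdivrMl ?mulr_gt0.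
    have e2 : w0 * n1s eta ^+ 2 <= tlo * \sum_i \sum_a \sum_j eta i a j ^+ 2.
      apply: (le_trans (y := tlo / (2 * n ^+ 2) * n1s eta ^+ 2)).
        by rewrite ler_wpM2r// ge_min lexx orbT.
      by rewrite -mulrA ler_pM2l// ler_pdivrMl ?mulr_gt0 ?exprn_gt0.
    lra.
  have e1 := ler_wpM2l (ltW U0) (Sxi' xi).
  have e2 := ler_wpM2l (ltW tau0) (Seta' eta).
  have e3 := mulr_ge0 (ltW tau0) X2; have e4 := mulr_ge0 (ltW U0) Y2.
  lra.
move=> theta thth.
have thstar0 : 0 < thstar.
  by rewrite divr_gt0// mulr_gt0 ?exprn_gt0// !addr_gt0 ?invr_gt0 ?mulr_gt0 ?invr_gt0 ?exprn_gt0.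
have theta0 : 0 < theta by exact: lt_trans thth.
exists (2 * (theta * Am)); first by rewrite !mulr_gt0.
move=> xi eta zeta e.
set X := n1 xi; set Y := n1s eta; set Z := n1 zeta; set E := n1 e.
have X0 : 0 <= X by exact: n1_ge0.
have Y0 : 0 <= Y by exact: n1s_ge0.
have Z0 : 0 <= Z by exact: n1_ge0.
have E0 : 0 <= E by exact: n1_ge0.
have XB (F : 'I_2 -> 'I_N -> R) (K : R) : (forall a i, `|F a i| <= K) ->
    \sum_a \sum_i xi a i * F a i <= X * K.
  move=> FK; rewrite /X /n1 mulr_suml; apply: ler_sum => a _.
  rewrite mulr_suml; apply: ler_sum => i _; exact: ler_mul_norm.
have YB (F : 'I_N -> 'I_2 -> 'I_N -> R) (K : R) : (forall i a j, `|F i a j| <= K) ->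
    \sum_i \sum_a \sum_j eta i a j * F i a j <= Y * K.
  move=> FK; rewrite /Y /n1s mulr_suml; apply: ler_sum => i _.
  rewrite mulr_suml; apply: ler_sum => a _; rewrite mulr_suml; apply: ler_sum => j _.
  exact: ler_mul_norm.
set SX := \sum_a \sum_i xi a i ^+ 2.
set SY := \sum_i \sum_a \sum_j eta i a j ^+ 2.
have T1 : \sum_a \sum_i u i * (xi a i * xi_dot xi eta e a i) <=
    - SX + X * (U * (b * Y) + U * E).
  have -> : \sum_a \sum_i u i * (xi a i * xi_dot xi eta e a i) =
     - \sum_a \sum_i u i * (xi a i * pgrad_lin G i xi a) +
     \sum_a \sum_i xi a i * (u i * (- pgrad_lin G i (eta i) a + e a i)).
    rewrite -sumrN -big_split; apply: eq_bigr => a _ /=.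
    rewrite -sumrN -big_split; apply: eq_bigr => i _ /=.
    by rewrite /xi_dot pgrad_linD; ring.
  rewrite lerD ?lerN2 ?uP//; apply: XB => a i.
  rewrite normrM (gtr0_norm (u0 i)) -mulrDr.
  have /andP[_ uiU] := uU i.
  apply: ler_pM => //; first exact: ltW.
  apply: le_trans (ler_normD _ _) _; rewrite normrN lerD ?le_n1//.
  by apply: le_trans (bP _ _ _) _; rewrite ler_pM2l// n1_le_n1s.
have T2 : \sum_i \sum_a \sum_j
    (thbar i j)^-1 * (eta i a j * eta_dot theta xi eta zeta e i a j) <=
    - (theta * h * SY) + Y * (theta * Am * Z + tau * (b * (X + Y) + E)).
  pose Q i a j := \sum_l A i l * (eta i a j - eta l a j) + A i j * eta i a j.
  have -> : \sum_i \sum_a \sum_j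
      (thbar i j)^-1 * (eta i a j * eta_dot theta xi eta zeta e i a j) =
    - (theta * \sum_i \sum_a \sum_j eta i a j * Q i a j) +
    \sum_i \sum_a \sum_j eta i a j *
      (theta * A i j * zeta a j + (thbar i j)^-1 * - xi_dot xi eta e a j).
    rewrite mulr_sumr -sumrN -big_split; apply: eq_bigr => i _ /=.
    rewrite mulr_sumr -sumrN -big_split; apply: eq_bigr => a _ /=.
    rewrite mulr_sumr -sumrN -big_split; apply: eq_bigr => j _ /=.
    rewrite /eta_dot /Q; move: (xi_dot _ _ _ _ _) (\sum_l _) => xd S.
    by field; exact: lt0r_neq0.
  rewrite lerD//.
    rewrite lerN2 -mulrA ler_pM2l// /SY mulr_sumr.
    have -> : \sum_i h * (\sum_a \sum_j eta i a j ^+ 2) =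
        \sum_a \sum_j h * \sum_i eta i a j ^+ 2.
      under eq_bigr do rewrite mulr_sumr.
      rewrite exchange_big; apply: eq_bigr => a _ /=.
      under eq_bigr do rewrite mulr_sumr.
      by rewrite exchange_big; apply: eq_bigr => j _ /=; rewrite mulr_sumr.
    have -> : \sum_i \sum_a \sum_j eta i a j * Q i a j =
        \sum_a \sum_j \sum_i eta i a j * Q i a j.
      by rewrite exchange_big; apply: eq_bigr => a _ /=; rewrite exchange_big.
    apply: ler_sum => a _; apply: ler_sum => j _.
    exact: (hP j (fun i => eta i a j)).
  apply: YB => i a j; apply: le_trans (ler_normD _ _) _; rewrite lerD//.
    rewrite !normrM (gtr0_norm theta0) -!mulrA ler_pM2l//.
    apply: ler_pM => //; last exact: le_n1.
    have /andP[_] := AmP (i, j); rewrite /= => AmP'.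
    by rewrite ger0_norm ?hA.1//; lra.
  rewrite normrM normrN; have /andP[_ ttau] := tauP (i, j).
  have itij := itau0 (i, j); rewrite /= in ttau itij.
  rewrite (gtr0_norm itij); apply: ler_pM => //; first exact: ltW.
  apply: le_trans (ler_normD _ _) _; rewrite normrN lerD ?le_n1//.
  apply: le_trans (bP _ _ _) _; rewrite ler_pM2l//.
  by apply: le_trans (ler_n1D _ _) _; rewrite lerD// n1_le_n1s.
have HX : (2 * n)^-1 * X ^+ 2 <= SX.
  by rewrite ler_pdivrMl ?mulr_gt0//; exact: Sxi.
have HY : (2 * n ^+ 2)^-1 * Y ^+ 2 <= SY.
  by rewrite ler_pdivrMl ?mulr_gt0 ?exprn_gt0//; exact: Seta.
have HXY : B1 * (X * Y) <= (2 * n)^-1 * X ^+ 2 + n * B1 ^+ 2 / 2 * Y ^+ 2.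
  have : 0 <= (2 * n)^-1 * (X - n * B1 * Y) ^+ 2.
    by rewrite mulr_ge0 ?sqr_ge0// invr_ge0 mulr_ge0// ltW.
  have -> : (2 * n)^-1 * (X - n * B1 * Y) ^+ 2 =
    (2 * n)^-1 * X ^+ 2 + n * B1 ^+ 2 / 2 * Y ^+ 2 - B1 * (X * Y).
    by field; exact: lt0r_neq0.
  lra.
have Hth : (n * B1 ^+ 2 / 2 + 2 * (tau * b) + (2 * n)^-1) * Y ^+ 2 <=
    2 * (theta * h * SY).
  apply: (le_trans (y := theta * h * ((n ^+ 2)^-1 * Y ^+ 2))).
    rewrite [leRHS]mulrA; apply: ler_wpM2r; first exact: sqr_ge0.
    rewrite ler_pdivlMr ?exprn_gt0// -ler_pdivrMr//.
    exact: ltW.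
  have := ler_wpM2l (ltW (mulr_gt0 theta0 h0)) HY.
  have -> : (2 * n ^+ 2)^-1 * Y ^+ 2 = 2^-1 * ((n ^+ 2)^-1 * Y ^+ 2).
    by field; exact: lt0r_neq0.
  lra.
have XZ : 0 <= theta * Am * Z * X by rewrite !mulr_ge0// ltW.
have XE : 0 <= tau * E * X by rewrite !mulr_ge0// ltW.
have YE : 0 <= U * E * Y by rewrite !mulr_ge0// ltW.
rewrite /lyap_dot; move: T1 T2 HX HXY Hth; rewrite /B1 => T1 T2 HX HXY Hth.
lra.
Qed.

End ConsensusLyapunov.

(** * Scalar estimates for the two rates *)

Section ScalarRates.
Variable R : realType.

Lemma ler_norm_mul (x y a b : R) : `|x| <= a -> `|y| <= b -> `|x * y| <= a * b.
Proof. by move=> xa yb; rewrite normrM; exact: ler_pM. Qed.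

(** The terms [k * c * z] cancel, and so do the terms [P * d1]. Since [k >= 1], half of
    [- k * P ^+ 2] absorbs the remaining [|P| * F] by Young's inequality; [Z <= 2 * K] makes the
    quadratic remainder in [Z] linear, and a large [beta] makes all remainders small. Only [Lg * Z]
    escapes the division by [beta]: the dissipation [c * |z|] has to absorb it. *)
Lemma energy_rate (P z dl d1 d2 k c beta Z X Y L Lg B D1 D2 km cm K eps : R) :
  1 <= k <= km -> 0 <= c <= cm -> 0 < beta ->
  `|z| <= Z -> `|dl| <= Lg * Z -> `|d1| <= D1 -> `|d2| <= D2 ->
  0 <= X -> 0 <= Y -> Z <= 2 * K -> 0 <= Lg -> 0 <= B ->
  0 <= L <= Lg * (B * (X + Y) + (km + cm) * Z) ->
  3 / 2 * (Lg * (2 * km + B + cm)) ^+ 2 * (1 + 2 * K) + Lg * D1 + cm * D1 + D2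
    <= beta * eps ->
  beta^-1 * (P * (d1 - k * (P + dl - c * z) - k * c * z) + `|P| * L
             + beta * (`|dl| - c * `|z|))
  - beta^-1 * ((P + dl - c * z) * d1 + z * d2) <=
  - (beta^-1 * (2^-1 * P ^+ 2)) + eps * (X ^+ 2 + Y ^+ 2 + Z) + Lg * Z - c * `|z|.
Proof.
move=> /andP[k1 kkm] /andP[c0 ccm] beta0 zZ dlZ d1D d2D X0 Y0 ZK Lg0 B0 /andP[L0 LL].
set M2 := Lg * (2 * km + B + cm); set M3 := (X in X <= _) => M3b.
have Z0 : 0 <= Z by apply: le_trans zZ.
have K0 : 0 <= K by lra.
have km0 : 0 <= km by lra.
have cm0 : 0 <= cm by lra.
have D10 : 0 <= D1 by apply: le_trans d1D.
have D20 : 0 <= D2 by apply: le_trans d2D.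
set S := X + Y + Z.
have S0 : 0 <= S by rewrite !addr_ge0.
set F := k * (Lg * Z) + L.
have F0 : 0 <= F by rewrite addr_ge0// !mulr_ge0//; lra.
have FS : F <= M2 * S.
  have h1 : k * (Lg * Z) <= km * (Lg * Z) by rewrite ler_wpM2r// mulr_ge0.
  have h2 : 0 <= Lg * km * (X + Y) by rewrite !mulr_ge0// addr_ge0.
  have h3 : 0 <= Lg * cm * (X + Y) by rewrite !mulr_ge0// addr_ge0.
  have h4 : 0 <= Lg * B * Z by rewrite !mulr_ge0.
  by move: LL; rewrite /F /M2 /S; lra.
have F2 : F ^+ 2 <= M2 ^+ 2 * S ^+ 2.
  by rewrite -exprMn lerXn2r// nnegrE// (le_trans F0).
have S2 : S ^+ 2 <= 3 * (X ^+ 2 + Y ^+ 2 + 2 * K * Z).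
  have : 0 <= (X - Y) ^+ 2 + (Y - Z) ^+ 2 + (Z - X) ^+ 2 by rewrite !addr_ge0 ?sqr_ge0.
  have : Z * Z <= 2 * K * Z by rewrite ler_wpM2r.
  by rewrite /S; lra.
have XY0 : 0 <= X ^+ 2 + Y ^+ 2 by rewrite addr_ge0 ?sqr_ge0.
have F3 : 2^-1 * F ^+ 2 <= 3 / 2 * M2 ^+ 2 * (1 + 2 * K) * (X ^+ 2 + Y ^+ 2 + Z).
  have h1 : M2 ^+ 2 * S ^+ 2 <= M2 ^+ 2 * (3 * (X ^+ 2 + Y ^+ 2 + 2 * K * Z)).
    by rewrite ler_wpM2l ?sqr_ge0.
  have h2 : 0 <= M2 ^+ 2 * (K * (X ^+ 2 + Y ^+ 2)).
    by rewrite mulr_ge0 ?sqr_ge0// mulr_ge0.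
  have h3 : 0 <= M2 ^+ 2 * Z by rewrite mulr_ge0 ?sqr_ge0.
  lra.
have PF : `|P| * F <= 2^-1 * P ^+ 2 + 2^-1 * F ^+ 2.
  have : 0 <= (`|P| - F) ^+ 2 by exact: sqr_ge0.
  by rewrite -[P ^+ 2]real_normK ?num_real//; lra.
have Pdl : - (k * (P * dl)) <= k * (`|P| * (Lg * Z)).
  rewrite -mulrN ler_wpM2l//; first lra.
  by rewrite -mulNr -(normrN P); exact: ler_mul_norm.
have kP : P ^+ 2 <= k * P ^+ 2 by rewrite ler_peMl ?sqr_ge0.
have t1 : - (dl * d1) <= Lg * Z * D1.
  by have := ler_norm_mul dlZ d1D; rewrite ler_norml => /andP[]; lra.
have t2 : c * (z * d1) <= cm * (Z * D1).
  apply: (le_trans (y := c * (Z * D1))).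
    rewrite ler_wpM2l//; have := ler_norm_mul zZ d1D.
    by rewrite ler_norml => /andP[].
  by rewrite ler_wpM2r// mulr_ge0.
have t3 : - (z * d2) <= Z * D2.
  by have := ler_norm_mul zZ d2D; rewrite ler_norml => /andP[]; lra.
have bd : beta * `|dl| <= beta * (Lg * Z) by rewrite ler_pM2l.
have M3S : M3 * (X ^+ 2 + Y ^+ 2 + Z) <= beta * eps * (X ^+ 2 + Y ^+ 2 + Z).
  by rewrite ler_wpM2r// addr_ge0.
have M3L : 3 / 2 * M2 ^+ 2 * (1 + 2 * K) * (X ^+ 2 + Y ^+ 2 + Z)
   + (Lg * D1 + cm * D1 + D2) * Z <= M3 * (X ^+ 2 + Y ^+ 2 + Z).
  have : 0 <= (Lg * D1 + cm * D1 + D2) * (X ^+ 2 + Y ^+ 2).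
    by rewrite mulr_ge0// !addr_ge0// mulr_ge0.
  by rewrite /M3 -/M2; lra.
move: PF; rewrite {1}/F => PF.
rewrite -(ler_pM2l beta0).
set lhs := (X in X <= _); set rhs := (X in _ <= X).
have -> : lhs = - (k * P ^+ 2) - k * (P * dl) + `|P| * L + beta * `|dl|
    - beta * (c * `|z|) - dl * d1 + c * (z * d1) - z * d2.
  by rewrite /lhs; field; exact: lt0r_neq0.
have -> : rhs = - (2^-1 * P ^+ 2) + beta * eps * (X ^+ 2 + Y ^+ 2 + Z)
    + beta * (Lg * Z) - beta * (c * `|z|).
  by rewrite /rhs; field; exact: lt0r_neq0.
lra.
Qed.

(** Dividing by [2 * q] turns the factor [X + Y] of the cross term into a constant, since
    [X + Y <= C3 * q]. The value of [kap] is the one for which exactly a quarter of the sliding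
    dissipation [Zc] is spent. *)
Lemma sqrt_rate (W Wd X Y E Z Zc q S kap m w0 C0 Cth : R) :
  0 < w0 -> 0 < C0 -> 0 < Cth -> 0 < m -> 0 <= X -> 0 <= Y ->
  w0 * (X ^+ 2 + Y ^+ 2) <= W -> 0 < q -> q ^+ 2 = 1 + W -> q <= S ->
  Wd <= - (m * (X ^+ 2 + Y ^+ 2)) + (C0 * E + Cth * Z) * (X + Y) ->
  E <= 2 * Zc -> Cth * Z <= Zc -> 0 <= Zc ->
  kap = (2 * (2 * C0 + 1) * (1 + 2 / w0))^-1 ->
  kap * (Wd / (2 * q)) <= - (kap * m / (2 * S) * (X ^+ 2 + Y ^+ 2)) + 4^-1 * Zc.
Proof.
move=> w00 C00 Cth0 m0 X0 Y0 wW q0 qE qS WdE EZ CZ Zc0 kapE.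
(* A square-root-free upper bound of [sqrt (2 / w0)], the constant supplied by
   [(X + Y)^2 <= 2 (X^2 + Y^2) <= 2 W / w0]. *)
set C3 := 1 + 2 / w0 in kapE.
have iw0 : 0 < 2 / w0 by rewrite divr_gt0.
have C30 : 0 < C3 by rewrite /C3; lra.
have D0 : 0 < 2 * C0 + 1 by lra.
have kap0 : 0 < kap by rewrite kapE invr_gt0 !mulr_gt0.
have S0 : 0 < S by apply: lt_le_trans qS.
have XY0 : 0 <= X ^+ 2 + Y ^+ 2 by rewrite addr_ge0 ?sqr_ge0.
have XYq : X + Y <= C3 * q.
  rewrite -(@ler_pXn2r _ 2)// ?nnegrE ?addr_ge0 ?mulr_ge0 ?(ltW C30) ?(ltW q0)//.
  have h1 : (X + Y) ^+ 2 <= 2 * (X ^+ 2 + Y ^+ 2).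
    by have := sqr_ge0 (X - Y); lra.
  have h2 : X ^+ 2 + Y ^+ 2 <= W / w0 by rewrite ler_pdivlMr// mulrC.
  have h3 : 0 <= W by apply: le_trans wW; rewrite mulr_ge0// ltW.
  rewrite exprMn qE; apply: (le_trans h1).
  apply: (le_trans (y := 2 / w0 * (1 + W))).
    have -> : 2 / w0 * (1 + W) = 2 / w0 + 2 * (W / w0) by ring.
    lra.
  rewrite ler_wpM2r ?addr_ge0//.
  by rewrite /C3; have := sqr_ge0 (2 / w0); lra.
have cross : (C0 * E + Cth * Z) * (X + Y) <= (2 * C0 + 1) * Zc * (C3 * q).
  apply: (le_trans (y := (2 * C0 + 1) * Zc * (X + Y))).
    rewrite ler_wpM2r ?addr_ge0//.
    have : C0 * E <= C0 * (2 * Zc) by rewrite ler_pM2l.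
    lra.
  by rewrite ler_wpM2l// mulr_ge0// ltW.
have q20 : 0 < 2 * q by lra.
apply: (le_trans (y := kap * ((- (m * (X ^+ 2 + Y ^+ 2))
    + (2 * C0 + 1) * Zc * (C3 * q)) / (2 * q)))).
  rewrite ler_pM2l// ler_pM2r ?invr_gt0//; lra.
have -> : kap * ((- (m * (X ^+ 2 + Y ^+ 2)) + (2 * C0 + 1) * Zc * (C3 * q)) / (2 * q))
   = - (kap * m * (X ^+ 2 + Y ^+ 2) * (2 * q)^-1)
     + kap * ((2 * C0 + 1) * C3 / 2) * Zc by field; exact: lt0r_neq0.
have -> : kap * ((2 * C0 + 1) * C3 / 2) = 4^-1.
  by rewrite kapE; field; rewrite !lt0r_neq0.
rewrite lerD2r lerN2.
have -> : kap * m / (2 * S) * (X ^+ 2 + Y ^+ 2) =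
   kap * m * (X ^+ 2 + Y ^+ 2) * (2 * S)^-1 by ring.
rewrite ler_wpM2l ?mulr_ge0 ?(ltW kap0) ?(ltW m0)//.
by rewrite lef_pV2 ?posrE ?mulr_gt0// ler_pM2l.
Qed.

End ScalarRates.

(** * Limits taken coordinate by coordinate *)

Section CoordinatewiseLimits.
Variables (R : realType) (T : Type) (F : set_system T).
Context {FF : Filter F}.

Lemma cvg_bigsum (I : finType) (P : pred I) (f : I -> T -> R) (l : I -> R) :
  (forall i, f i r @[r --> F] --> l i) ->
  \sum_(i | P i) f i r @[r --> F] --> \sum_(i | P i) l i.
Proof.
move=> fl; elim: (index_enum I) => [|i s IH].
  rewrite big_nil; under eq_fun do rewrite big_nil; exact: cvg_cst.
rewrite big_cons; under eq_fun do rewrite big_cons.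
by case: ifP => // _; apply: cvgD.
Qed.

Lemma cvg_n1 m n (V : T -> 'M[R]_(m, n)) (V0 : 'M[R]_(m, n)) :
  (forall a j, V r a j @[r --> F] --> V0 a j) ->
  n1 (V r) @[r --> F] --> n1 V0.
Proof.
move=> cV; apply: cvg_bigsum => a; apply: cvg_bigsum => j; exact: cvg_norm.
Qed.

Variables (N : nat) (V : T -> 'M[R]_(2, N)) (V0 : 'M[R]_(2, N)).
Hypothesis cV : forall a j, V r a j @[r --> F] --> V0 a j.

Lemma cvg_pgrad_lin (G : game R N) i a :
  pgrad_lin G i (V r) a @[r --> F] --> pgrad_lin G i V0 a.
Proof.
apply: cvgD; apply: cvgMr; apply: cvg_bigsum => j; apply: cvgMr => //.
exact: cvgB.
Qed.

Lemma cvg_regular h b : regular_unmodeled h ->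
  h (V r) b ord0 @[r --> F] --> h V0 b ord0.
Proof.
move=> /regular_lipschitz/(_ (n1 V0 + 1))[L [L0 LP]].
have n0 : n1 (V r - V0) @[r --> F] --> (0 : R).
  have -> : (0 : R) = n1 (0 : 'M[R]_(2, N)).
    by rewrite /n1 big1// => a _; rewrite big1// => j _; rewrite mxE normr0.
  apply: cvg_n1 => a j; rewrite mxE -(subrr (V0 a j)).
  by under eq_fun do rewrite !mxE; apply: cvgB => //; exact: cvg_cst.
apply/cvgrPdist_le => e e0; near=> r.
have nr : n1 (V r - V0) <= Num.min 1 (e / L).
  by near: r; apply: (cvgr_le _ n0); rewrite lt_min ltr01 divr_gt0.
apply: le_trans (LP _ _ _ _ b) _.
- by move=> a j; apply: (le_trans (le_n1 _ _ _)); rewrite lerDl.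
- move=> a j; rewrite -[V r a j](subrKC (V0 a j)).
  apply: le_trans (ler_normD _ _) _; rewrite lerD ?le_n1//.
  have := le_n1 (V r - V0) a j; rewrite !mxE => /le_trans; apply.
  by apply: le_trans nr _; rewrite ge_min lexx.
have -> : n1 (V0 - V r) = n1 (V r - V0).
  by apply: eq_bigr => a _; apply: eq_bigr => j _; rewrite !mxE distrC.
rewrite mulrC -ler_pdivlMr//; apply: le_trans nr _.
by rewrite ge_min lexx orbT.
Unshelve. all: by end_near. Qed.

End CoordinatewiseLimits.

(** * Error dynamics along a closed-loop trajectory *)

Section Trajectory.
Variables (R : realType) (N : nat) (G : game R N) (A thbar : 'M[R]_N).
Variables (g : 'I_N -> 'M[R]_(2, N) -> 'cV[R]_2) (d : 'I_N -> R -> 'cV[R]_2).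
Variables (xstar : 'M[R]_(2, N)) (t0 theta : R) (k c beta : 'I_N -> R).
Variables (T : trajectory R N) (s : R -> 'M[R]_(2, N)).

Let x i t := col i (pos T t).
Let xh i t := col i (xhat T t).
Let zh i t := col i (zhat T t).
Let y i j t := col j (est T i t).
Let u i t := control G T i t.

Hypotheses (hG : connectivity_game G) (hxstar : is_nash G xstar).
Hypotheses (hg : forall i, regular_unmodeled (g i)).
Hypothesis hd : forall i, regular_disturbance t0 (d i).
Hypothesis sSgn : forall t a i, t0 <= t ->
  Sgn (pos T t a i - xhat T t a i) (s t a i).
Hypothesis sol : forall i,
  [/\ solves t0 (x i) (fun t => u i t + g i (pos T t) + d i t),
      solves t0 (xh i) (fun t => u i t + zh i t + (k i + c i) *: (x i t - xh i t)),
      solves t0 (zh i)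
        (fun t => (k i * c i) *: (x i t - xh i t) + beta i *: col i (s t)) &
      forall j, solves t0 (y i j)
        (fun t => - (theta * thbar i j) *:
           (\sum_(l < N) A i l *: (y i j t - y l j t)
            + A i j *: (y i j t - x j t)))].

Definition xhat_err (t : R) : 'M[R]_(2, N) := xhat T t - xstar.
Definition est_err (i : 'I_N) (t : R) : 'M[R]_(2, N) := est T i t - xhat T t.
Definition injection (t : R) : 'M[R]_(2, N) :=
  \matrix_(a, i) ((k i + c i) * zeta1 T t a i).

(* [gamma] minus the increment [g_gap], whose velocity would involve [gamma]   *)
(* itself; unlike [pos], [xhat] has a velocity free of [gamma].                *)
Definition filtered a i (t : R) : R :=
  (d i t a ord0 - k i * zeta1 T t a i) - zhat T t a i + g i (xhat T t) a ord0.
Definition g_gap a i (t : R) : R :=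
  g i (pos T t) a ord0 - g i (xhat T t) a ord0.

Lemma gamma_filtered a i t : gamma g d k T t a i = filtered a i t + g_gap a i t.
Proof. by rewrite /gamma /zeta2 /filtered /g_gap !mxE; ring. Qed.

Let solves_coord w F a : solves t0 w F ->
  integral_solution t0 (fun t => w t a ord0) (fun t => F t a ord0).
Proof. by move=> wF t t0t; exact: wF. Qed.

(** The gradient is affine and vanishes at the equilibrium, so at [y_i] it equals its linear part at
    [y_i - x*], which splits into [xhat_err] and [est_err]. *)
Let controlE i t a : u i t a ord0 =
  - pgrad_lin G i (xhat_err t + est_err i t) a - zhat T t a i.
Proof.
rewrite /u /control [LHS]mxE [(- grad_own _ _ _) _ _]mxE grad_ownE// !mxE.
congr (- _ - _).
rewrite -[LHS]subr0 -(nash_pgrad hG i a hxstar) pgradB; congr (pgrad_lin _ _ _ _).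
by apply/matrixP => b j; rewrite !mxE; ring.
Qed.

Lemma sol_pos a i : integral_solution t0 (fun t => pos T t a i)
  (fun t => - pgrad_lin G i (xhat_err t + est_err i t) a - zhat T t a i
            + g i (pos T t) a ord0 + d i t a ord0).
Proof.
have [/(@solves_coord _ _ a) + _ _ _] := sol i; congr integral_solution.
  by apply/funext => t; rewrite mxE.
by apply/funext => t; rewrite mxE [(u i t + _) _ _]mxE controlE.
Qed.

Lemma sol_xhat a i : integral_solution t0 (fun t => xhat T t a i)
  (fun t => xi_dot G (xhat_err t) (est_err ^~ t) (injection t) a i).
Proof.
have [_ /(@solves_coord _ _ a) + _ _] := sol i; congr integral_solution.
  by apply/funext => t; rewrite mxE.
apply/funext => t; rewrite mxE [(u i t + _) _ _]mxE controlE.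
by rewrite /zh /x /xh !mxE /xi_dot !mxE; ring.
Qed.

Lemma sol_zhat a i : integral_solution t0 (fun t => zhat T t a i)
  (fun t => k i * c i * zeta1 T t a i + beta i * s t a i).
Proof.
have [_ _ /(@solves_coord _ _ a) + _] := sol i; congr integral_solution.
  by apply/funext => t; rewrite mxE.
by apply/funext => t; rewrite !mxE.
Qed.

Lemma sol_est i a j : integral_solution t0 (fun t => est T i t a j)
  (fun t => eta_dot G A thbar theta (xhat_err t) (est_err ^~ t) (zeta1 T t)
      (injection t) i a j
    + xi_dot G (xhat_err t) (est_err ^~ t) (injection t) a j).
Proof.
have [_ _ _ /(_ j)/(@solves_coord _ _ a)] := sol i; congr integral_solution.
  by apply/funext => t; rewrite mxE.
apply/funext => t; rewrite /eta_dot subrK !mxE summxE; congr (_ * (_ + _)).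
  by apply: eq_bigr => l _; rewrite !mxE; ring.
by ring.
Qed.

(** * Limits along a filter: two-sided at interior times, from the right at [t0] *)

Section Limits.
Variables (F : set_system R) (t : R).
Context {FF : Filter F}.
Hypothesis cvgF : forall w f, integral_solution t0 w f -> w r @[r --> F] --> w t.
Hypothesis cvgd : forall i a, d i r a ord0 @[r --> F] --> d i t a ord0.

Lemma cvg_pos a i : pos T r a i @[r --> F] --> pos T t a i.
Proof. exact: cvgF (sol_pos a i). Qed.

Lemma cvg_xhat a i : xhat T r a i @[r --> F] --> xhat T t a i.
Proof. exact: cvgF (sol_xhat a i). Qed.

Lemma cvg_zhat a i : zhat T r a i @[r --> F] --> zhat T t a i.
Proof. exact: cvgF (sol_zhat a i). Qed.

Lemma cvg_est i a j : est T i r a j @[r --> F] --> est T i t a j.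
Proof. exact: cvgF (sol_est i a j). Qed.

Lemma cvg_zeta1 a i : zeta1 T r a i @[r --> F] --> zeta1 T t a i.
Proof.
rewrite /zeta1 !mxE; under eq_fun do rewrite !mxE.
by apply: cvgB; [exact: cvg_pos|exact: cvg_xhat].
Qed.

Lemma cvg_xhat_err a i : xhat_err r a i @[r --> F] --> xhat_err t a i.
Proof.
rewrite /xhat_err !mxE; under eq_fun do rewrite !mxE.
by apply: cvgB; [exact: cvg_xhat|exact: cvg_cst].
Qed.

Lemma cvg_est_err i a j : est_err i r a j @[r --> F] --> est_err i t a j.
Proof.
rewrite /est_err !mxE; under eq_fun do rewrite !mxE.
by apply: cvgB; [exact: cvg_est|exact: cvg_xhat].
Qed.

Lemma cvg_filtered a i : filtered a i r @[r --> F] --> filtered a i t.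
Proof.
apply: cvgD; last by apply: cvg_regular => //; exact: cvg_xhat.
apply: cvgB; last exact: cvg_zhat.
by apply: cvgB => //; apply: cvgMr; exact: cvg_zeta1.
Qed.

Lemma cvg_lyap (uu : 'I_N -> R) :
  lyap thbar uu (xhat_err r) (est_err ^~ r) @[r --> F] -->
  lyap thbar uu (xhat_err t) (est_err ^~ t).
Proof.
have sq (w : R) (f : R -> R) (l : R) : f r @[r --> F] --> l ->
    w * f r ^+ 2 @[r --> F] --> w * l ^+ 2.
  by move=> fl; apply: cvgMr; under eq_fun do rewrite expr2; rewrite expr2; exact: cvgM.
apply: cvgD.
  apply: cvg_bigsum => a; apply: cvg_bigsum => i; apply: sq; exact: cvg_xhat_err.
apply: cvg_bigsum => i; apply: cvg_bigsum => a; apply: cvg_bigsum => j.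
by apply: sq; exact: cvg_est_err.
Qed.

Let cvg_drive a i : pgrad_lin G i (xhat_err r + est_err i r) a @[r --> F] -->
  pgrad_lin G i (xhat_err t + est_err i t) a.
Proof.
apply: cvg_pgrad_lin => b j; rewrite mxE; under eq_fun do rewrite mxE.
by apply: cvgD; [exact: cvg_xhat_err|exact: cvg_est_err].
Qed.

Lemma cvg_pos_rhs a i :
  - pgrad_lin G i (xhat_err r + est_err i r) a - zhat T r a i
    + g i (pos T r) a ord0 + d i r a ord0 @[r --> F] -->
  - pgrad_lin G i (xhat_err t + est_err i t) a - zhat T t a i
    + g i (pos T t) a ord0 + d i t a ord0.
Proof.
apply: cvgD => //; apply: cvgD; last by apply: cvg_regular => //; exact: cvg_pos.
by apply: cvgB; [apply: cvgN; exact: cvg_drive|exact: cvg_zhat].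
Qed.

Lemma cvg_xi_dot a i :
  xi_dot G (xhat_err r) (est_err ^~ r) (injection r) a i @[r --> F] -->
  xi_dot G (xhat_err t) (est_err ^~ t) (injection t) a i.
Proof.
apply: cvgD; first by apply: cvgN; exact: cvg_drive.
rewrite /injection mxE; under eq_fun do rewrite mxE.
by apply: cvgMr; exact: cvg_zeta1.
Qed.

Lemma cvg_eta_dot i a j :
  eta_dot G A thbar theta (xhat_err r) (est_err ^~ r) (zeta1 T r)
    (injection r) i a j @[r --> F] -->
  eta_dot G A thbar theta (xhat_err t) (est_err ^~ t) (zeta1 T t)
    (injection t) i a j.
Proof.
apply: cvgB; last exact: cvg_xi_dot.
apply: cvgMr; apply: cvgD.
  apply: cvg_bigsum => l; apply: cvgMr.
  by apply: cvgB; exact: cvg_est_err.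
by apply: cvgMr; apply: cvgB; [exact: cvg_est_err|exact: cvg_zeta1].
Qed.

End Limits.

Lemma disturbance_derive i t a : t0 < t ->
  is_derive t (1 : R) (fun r => d i r a ord0) (derive1 (d i) t a ord0).
Proof.
move=> t0t; have [[dd _] _ _ _ _] := hd i.
have dit : derivable (d i) t 1 by apply: dd; rewrite in_itv/= t0t.
have := derivable_mxP (d i) t 1; case=> /(_ dit)/(_ a ord0) da _.
by rewrite derive1E derive_mx// mxE; exact: derivableP.
Qed.

Lemma disturbance_derive2 i t a : t0 < t ->
  is_derive t (1 : R) (fun r => derive1 (d i) r a ord0)
    (derive1 (derive1 (d i)) t a ord0).
Proof.
move=> t0t; have [_ /(_ t t0t) dit _ _ _] := hd i.
have := derivable_mxP (derive1 (d i)) t 1; case=> /(_ dit)/(_ a ord0) da _.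
by rewrite [in X in is_derive _ _ _ X]derive1E derive_mx// mxE; exact: derivableP.
Qed.

Let is_derive_cvg (f : R -> R) t l : is_derive t (1 : R) f l ->
  f r @[r --> t] --> f t.
Proof.
move=> [df _]; apply: differentiable_continuous.
exact/derivable1_diffP.
Qed.

Section Interior.
Variable t : R.
Hypothesis t0t : t0 < t.

Let cvgF w f : integral_solution t0 w f -> w r @[r --> t] --> w t.
Proof. by move=> wf; exact: (integral_solution_continuous wf t0t). Qed.

Let cvgd i a : d i r a ord0 @[r --> t] --> d i t a ord0.
Proof. exact: is_derive_cvg (disturbance_derive i a t0t). Qed.

Lemma derive_xhat a i : is_derive t (1 : R) (fun r => xhat T r a i)
  (xi_dot G (xhat_err t) (est_err ^~ t) (injection t) a i).
Proof.
apply: (integral_solution_derive (sol_xhat a i) t0t); exact: cvg_xi_dot.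
Qed.

Lemma derive_xhat_err a i : is_derive t (1 : R) (fun r => xhat_err r a i)
  (xi_dot G (xhat_err t) (est_err ^~ t) (injection t) a i).
Proof.
rewrite -[X in is_derive _ _ _ X]subr0.
have -> : (fun r => xhat_err r a i) = (fun r => xhat T r a i) - cst (xstar a i).
  by apply/funext => r; rewrite /xhat_err !mxE.
by apply: is_deriveB; exact: derive_xhat.
Qed.

Lemma derive_est_err i a j : is_derive t (1 : R) (fun r => est_err i r a j)
  (eta_dot G A thbar theta (xhat_err t) (est_err ^~ t) (zeta1 T t)
    (injection t) i a j).
Proof.
set l := eta_dot _ _ _ _ _ _ _ _ _ _ _.
rewrite -[l](addrK (xi_dot G (xhat_err t) (est_err ^~ t) (injection t) a j)).
have -> : (fun r => est_err i r a j) = (fun r => est T i r a j) - (fun r => xhat T r a j).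
  by apply/funext => r; rewrite /est_err !mxE.
apply: is_deriveB; last exact: derive_xhat.
apply: (integral_solution_derive (sol_est i a j) t0t).
by apply: cvgD; [exact: cvg_eta_dot|exact: cvg_xi_dot].
Qed.

Lemma derive_zeta1 a i : is_derive t (1 : R) (fun r => zeta1 T r a i)
  (filtered a i t + g_gap a i t - c i * zeta1 T t a i).
Proof.
have -> : (fun r => zeta1 T r a i) = (fun r => pos T r a i) - (fun r => xhat T r a i).
  by apply/funext => r; rewrite /zeta1 !mxE.
have dpos := integral_solution_derive (sol_pos a i) t0t
  (@cvg_pos_rhs _ _ (nbhs_filter t) cvgF cvgd a i).
apply: (is_derive_eq (is_deriveB dpos (derive_xhat a i))).
by rewrite /xi_dot /filtered /g_gap !mxE; ring.
Qed.

Lemma derive_lyap (uu : 'I_N -> R) :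
  is_derive t (1 : R) (fun r => lyap thbar uu (xhat_err r) (est_err ^~ r))
    (lyap_dot G A thbar uu theta (xhat_err t) (est_err ^~ t) (zeta1 T t)
      (injection t)).
Proof.
by apply: is_derive_lyap => *; [exact: derive_xhat_err|exact: derive_est_err].
Qed.

(** The composite is not differentiated: the Lipschitz bound on the box is applied to the
    first-order increment of [xhat]. The strict bound on [xhat T t] keeps [xhat T (t + h)] in the
    box for small [h]. *)
Lemma g_xhat_increment (L rho : R) a i : 0 < L ->
  (forall X Y : 'M[R]_(2, N), (forall a j, `|X a j| <= rho) -> (forall a j, `|Y a j| <= rho) ->
    forall i b, `|g i X b ord0 - g i Y b ord0| <= L * n1 (X - Y)) ->
  (forall a j, `|xhat T t a j| < rho) -> forall e, 0 < e ->
  \forall h \near 0^'+,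
    `|g i (xhat T (t + h)) a ord0 - g i (xhat T t) a ord0| <=
    h * (L * (\sum_a \sum_j
      `|xi_dot G (xhat_err t) (est_err ^~ t) (injection t) a j|) + e).
Proof.
move=> L0 LP xr e e0; pose v := xi_dot G (xhat_err t) (est_err ^~ t) (injection t).
rewrite -/v.
have inc e' : 0 < e' -> \forall h \near 0^'+, forall p : 'I_2 * 'I_N,
    `|xhat T (t + h) p.1 p.2 - xhat T t p.1 p.2| <= h * (`|v p.1 p.2| + e').
  move=> e'0; apply: filter_forall => -[b j] /=.
  near=> h; have h0 : 0 < h by [].
  have : `|xhat T (t + h) b j - xhat T t b j - h * v b j| <= h * e'.
    by near: h; exact: (is_derive_right (derive_xhat b j) e'0).
  move=> H; have -> : xhat T (t + h) b j - xhat T t b j = h * v b j +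
      (xhat T (t + h) b j - xhat T t b j - h * v b j) by rewrite subrKC.
  apply: le_trans (ler_normD _ _) _.
  rewrite [leRHS]mulrDr; apply: lerD; last exact: H.
  by rewrite normrM (gtr0_norm h0).
have xnear : \forall h \near 0^'+, forall p : 'I_2 * 'I_N,
    `|xhat T (t + h) p.1 p.2| <= rho.
  apply: filter_forall => -[b j] /=.
  have gap0 : 0 < (rho - `|xhat T t b j|) / (`|v b j| + 1).
    by rewrite divr_gt0 ?subr_gt0// ltr_wpDl.
  near=> h.
  have : `|xhat T (t + h) b j - xhat T t b j| <= h * (`|v b j| + 1).
    suff H : forall p : 'I_2 * 'I_N, `|xhat T (t + h) p.1 p.2 - xhat T t p.1 p.2|
        <= h * (`|v p.1 p.2| + 1) by exact: (H (b, j)).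
    by near: h; exact: inc.
  have : h <= (rho - `|xhat T t b j|) / (`|v b j| + 1).
    by near: h; exact: nbhs_right_le.
  rewrite ler_pdivlMr ?ltr_wpDl// => h1 h2.
  rewrite -[xhat T (t + h) b j](subrK (xhat T t b j)).
  apply: le_trans (ler_normD _ _) _.
  by rewrite -lerBrDr; exact: le_trans h1.
pose n : R := (2 * N)%:R.
have n0 : 0 <= n by [].
have e'0 : 0 < e / (L * n + 1) by rewrite divr_gt0// ltr_wpDl// mulr_ge0// ltW.
near=> h; have h0 : 0 < h by [].
apply: (le_trans (LP _ _ _ _ i a)).
- suff H : forall p : 'I_2 * 'I_N, `|xhat T (t + h) p.1 p.2| <= rho.
    by move=> b j; exact: (H (b, j)).
  by near: h; exact: xnear.
- by move=> b j; exact: ltW.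
have : n1 (xhat T (t + h) - xhat T t) <=
    h * (\sum_b \sum_j `|v b j| + n * (e / (L * n + 1))).
  have -> : n * (e / (L * n + 1)) = \sum_(b < 2) \sum_(j < N) (e / (L * n + 1)).
    by rewrite !sumr_const !card_ord -mulrnA mulr_natl mulnC.
  rewrite -big_split mulr_sumr; apply: ler_sum => b _ /=.
  rewrite -big_split mulr_sumr; apply: ler_sum => j _ /=.
  rewrite !mxE; suff H : forall p : 'I_2 * 'I_N,
      `|xhat T (t + h) p.1 p.2 - xhat T t p.1 p.2|
        <= h * (`|v p.1 p.2| + e / (L * n + 1)) by exact: (H (b, j)).
  by near: h; exact: inc.
rewrite -(ler_pM2l L0) => /le_trans; apply.
rewrite mulrCA ler_pM2l// mulrDr lerD2l.
have : (L * n + 1) * (e / (L * n + 1)) = e.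
  by field; rewrite gt_eqF// ltr_wpDl// mulr_ge0// ltW.
by have := e'0; lra.
Unshelve. all: by end_near. Qed.

End Interior.

(** * The composite energy and its rate *)

Hypothesis beta0 : forall i, 0 < beta i.

Definition energy a i (r : R) : R :=
  (beta i)^-1 * (2^-1 * filtered a i r ^+ 2 + beta i * `|zeta1 T r a i|)
  + - ((beta i)^-1 * (zeta1 T r a i * derive1 (d i) r a ord0)).

(* Dividing the energy of sensor [i] by [beta i] makes its initial value       *)
(* bounded independently of the gains, whose ratios are arbitrary.             *)
Definition total_energy (kap : R) (uu : 'I_N -> R) (r : R) : R :=
  \sum_a \sum_i energy a i r
  + kap * (Num.sqrt (1 + lyap thbar uu (xhat_err r) (est_err ^~ r)) - 1).

Section EnergyRate.
Variable t : R.
Hypothesis t0t : t0 < t.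

Lemma dini_energy_coord a i L : 0 <= L ->
  (forall e, 0 < e -> \forall h \near 0^'+,
    `|g i (xhat T (t + h)) a ord0 - g i (xhat T t) a ord0| <= h * (L + e)) ->
  let P := filtered a i t in let z := zeta1 T t a i in
  let dl := g_gap a i t in
  let d1 := derive1 (d i) t a ord0 in
  let d2 := derive1 (derive1 (d i)) t a ord0 in
  dini (energy a i) t
    ((beta i)^-1 * (P * (d1 - k i * (P + dl - c i * z) - k i * c i * z)
                    + `|P| * L + beta i * (`|dl| - c i * `|z|))
     - (beta i)^-1 * ((P + dl - c i * z) * d1 + z * d2)).
Proof.
move=> L0 Gt P z dl d1 d2; apply: diniD.
  apply: diniZ; first by rewrite invr_ge0 ltW.
  apply: (@dini_energy R (fun r => zeta1 T r a i) (fun r => zhat T r a i)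
    (fun r => k i * c i * zeta1 T r a i + beta i * s r a i)
    (fun r => s r a i) (fun r => g i (xhat T r) a ord0)
    (fun r => d i r a ord0 - k i * zeta1 T r a i) t0 t) => //.
  - exact: ltW.
  - exact: sol_zhat.
  - by move=> r t0r; have := @sSgn r a i t0r; rewrite /zeta1 !mxE.
  - apply: is_deriveB; first exact: disturbance_derive.
    apply: (is_deriveZ (k i)); exact: derive_zeta1.
  - exact: derive_zeta1.
apply: is_derive_dini.
have -> : (fun r => - ((beta i)^-1 * (zeta1 T r a i * derive1 (d i) r a ord0))) =
   (- (beta i)^-1) *: ((fun r => zeta1 T r a i) * (fun r => derive1 (d i) r a ord0)).
  by apply/funext => r; rewrite -mulNr.
have := is_deriveZ (- (beta i)^-1)
  (is_deriveM (derive_zeta1 t0t a i) (disturbance_derive2 i a t0t)).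
set l := _ *: _; suff -> : l = - ((beta i)^-1 * ((P + dl - c i * z) * d1 + z * d2)) by [].
by rewrite /l /P /z /dl /d1 /d2 /GRing.scale /=; ring.
Qed.

Lemma dini_total_energy kap uu L : 0 <= L ->
  0 <= lyap thbar uu (xhat_err t) (est_err ^~ t) ->
  (forall a i e, 0 < e -> \forall h \near 0^'+,
    `|g i (xhat T (t + h)) a ord0 - g i (xhat T t) a ord0| <= h * (L + e)) ->
  dini (total_energy kap uu) t
   (\sum_a \sum_i
     (let P := filtered a i t in let z := zeta1 T t a i in
      let dl := g_gap a i t in
      let d1 := derive1 (d i) t a ord0 in
      let d2 := derive1 (derive1 (d i)) t a ord0 in
      (beta i)^-1 * (P * (d1 - k i * (P + dl - c i * z) - k i * c i * z)
                    + `|P| * L + beta i * (`|dl| - c i * `|z|))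
     - (beta i)^-1 * ((P + dl - c i * z) * d1 + z * d2))
   + kap * (lyap_dot G A thbar uu theta (xhat_err t) (est_err ^~ t) (zeta1 T t)
      (injection t)
      / (2 * Num.sqrt (1 + lyap thbar uu (xhat_err t) (est_err ^~ t))))).
Proof.
move=> L0 W0 Gt; apply: diniD.
  apply: dini_sum => a; apply: dini_sum => i.
  by apply: dini_energy_coord => // e; exact: Gt.
apply: is_derive_dini.
set W := fun r => lyap thbar uu (xhat_err r) (est_err ^~ r).
set W' := lyap_dot _ _ _ _ _ _ _ _ _.
have dW : is_derive t (1 : R) (fun r => 1 + W r) (0 + W').
  by apply: is_deriveD; exact: derive_lyap.
have W1 : 0 < 1 + W t by rewrite ltr_pwDl.
have := @is_derive1_comp _ (@Num.sqrt R) (fun r => 1 + W r) t _ _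
  (is_derive1_sqrt W1) dW; rewrite add0r => dq.
have := is_deriveZ kap (is_deriveB dq (is_derive_cst (1 : R) t (1 : R))).
set l := _ *: _; suff -> : l = kap * (W' / (2 * Num.sqrt (1 + W t))) by [].
by rewrite /l subr0 /GRing.scale /=; ring.
Qed.

Lemma cvg_total_energy kap uu :
  {for t, continuous (total_energy kap uu)}.
Proof.
have cvgF w f : integral_solution t0 w f -> w r @[r --> t] --> w t.
  by move=> wf; exact: (integral_solution_continuous wf t0t).
have cvgd i a : d i r a ord0 @[r --> t] --> d i t a ord0.
  exact: is_derive_cvg (disturbance_derive i a t0t).
have cz a i := @cvg_zeta1 _ _ (nbhs_filter t) cvgF a i.
have cf a i := @cvg_filtered _ _ (nbhs_filter t) cvgF cvgd a i.
apply: cvgD; last first.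
  apply: cvgMr; apply: cvgB; last exact: cvg_cst.
  apply: (@continuous_cvg _ _ _ _ _ _ (@Num.sqrt R)); first exact: sqrt_continuous.
  apply: cvgD; first exact: cvg_cst.
  exact: (@cvg_lyap _ _ (nbhs_filter t) cvgF).
apply: cvg_bigsum => a; apply: cvg_bigsum => i; apply: cvgD.
  apply: cvgMr; apply: cvgD; apply: cvgMr; last exact: cvg_norm.
  by under eq_fun do rewrite expr2; rewrite expr2; exact: cvgM.
apply: cvgN; apply: cvgMr; apply: cvgM => //.
exact: is_derive_cvg (disturbance_derive2 i a t0t).
Qed.

End EnergyRate.

(** * Decay on a sublevel set and convergence of the errors *)

Section Convergence.
Variables (uu : 'I_N -> R) (w0 w1 m C0 Cth kap K S rho Lg b D1 D2 km cm eps1 P0 v1 : R).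

Let W t := lyap thbar uu (xhat_err t) (est_err ^~ t).
Let q t := Num.sqrt (1 + W t).
Let X t := n1 (xhat_err t).
Let Y t := n1s (est_err ^~ t).
Let Z t := n1 (zeta1 T t).
Let V := total_energy kap uu.
Let SP t := \sum_a \sum_i (beta i)^-1 * (2^-1 * filtered a i t ^+ 2).
Let n : R := (2 * N)%:R.

Hypotheses (w00 : 0 < w0) (w10 : 0 < w1) (m0 : 0 < m) (C00 : 0 < C0) (Cth0 : 0 < Cth).
Hypotheses (Lg0 : 0 < Lg) (b0 : 0 < b) (eps10 : 0 < eps1) (v10 : 0 < v1).
Hypothesis lyapP : forall xi eta, w0 * (n1 xi ^+ 2 + n1s eta ^+ 2)
  <= lyap thbar uu xi eta <= w1 * (n1 xi ^+ 2 + n1s eta ^+ 2).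
Hypothesis lyap_dotP : forall xi eta zeta e,
  lyap_dot G A thbar uu theta xi eta zeta e <=
  - (m * (n1 xi ^+ 2 + n1s eta ^+ 2))
  + (C0 * n1 e + Cth * n1 zeta) * (n1 xi + n1s eta).
Hypothesis drive_bound : forall i (M : 'M[R]_(2, N)) a,
  `|pgrad_lin G i M a| <= b * n1 M.
Hypothesis kapE : kap = (2 * (2 * C0 + 1) * (1 + 2 / w0))^-1.
Hypothesis SE : S = 1 + K / kap.
Hypothesis rhoP : n1 xstar + 2 + S ^+ 2 / w0 + 2 * K <= rho.
Hypothesis g_lip : forall X Y : 'M[R]_(2, N),
  (forall a j, `|X a j| <= rho) -> (forall a j, `|Y a j| <= rho) ->
  forall i a, `|g i X a ord0 - g i Y a ord0| <= Lg * n1 (X - Y).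
Hypothesis d1_bound : forall i t a, t0 < t -> `|derive1 (d i) t a ord0| <= D1.
Hypothesis d2_bound : forall i t a, t0 < t ->
  `|derive1 (derive1 (d i)) t a ord0| <= D2.
Hypothesis k_bound : forall i, 1 <= k i <= km.
Hypothesis c_bound : forall i,
  [/\ k i <= c i, Cth <= c i, 4 * (1 + n * Lg) <= c i & c i <= cm].
Hypothesis beta_bound : forall i,
  [/\ 2 * D1 <= beta i, n * P0 ^+ 2 <= beta i &
      3 / 2 * (Lg * (2 * km + n * b + cm)) ^+ 2 * (1 + 2 * K)
        + Lg * D1 + cm * D1 + D2 <= beta i * eps1].
Hypotheses (eps11 : n * eps1 <= 1) (eps12 : n * eps1 <= kap * m / (4 * S)).
Hypothesis K_bound : 2 + 2 * (n * (v1 + 1))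
  + kap * (w1 * ((n * (2 * v1 + 1)) ^+ 2 + (N%:R * (n * (2 * v1 + 1))) ^+ 2)) <= K.
Hypotheses (zeta1_t0 : forall a i, `|zeta1 T t0 a i| <= v1)
  (xhat_err_t0 : forall a i, `|xhat_err t0 a i| <= 2 * v1)
  (est_err_t0 : forall i a j, `|est_err i t0 a j| <= 2 * v1)
  (filtered_t0 : forall a i, `|filtered a i t0| + 1 <= P0).

Let kap0 : 0 < kap.
Proof.
by rewrite kapE invr_gt0 !mulr_gt0// addr_gt0// ?divr_gt0// mulr_gt0.
Qed.

Let n0 : 0 <= n. Proof. exact: ler0n. Qed.

Let K0 : 0 < K.
Proof.
apply: lt_le_trans K_bound; rewrite -addrA ltr_pwDl// addr_ge0//.
  by rewrite mulr_ge0// mulr_ge0// addr_ge0// ltW.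
by rewrite mulr_ge0 ?(ltW kap0)// mulr_ge0 ?(ltW w10)// addr_ge0 ?sqr_ge0.
Qed.

Let S1 : 1 <= S. Proof. by rewrite SE lerDl divr_ge0// ltW. Qed.

Let W_ge0 t : 0 <= W t.
Proof.
have /andP[+ _] := lyapP (xhat_err t) (est_err ^~ t); apply: le_trans.
by rewrite mulr_ge0 ?(ltW w00)// addr_ge0 ?sqr_ge0.
Qed.

Let q_sqr t : q t ^+ 2 = 1 + W t.
Proof. by rewrite sqr_sqrtr// addr_ge0. Qed.

Let q_ge1 t : 1 <= q t.
Proof. by rewrite -[leLHS]sqrtr1 ler_wsqrtr// lerDl. Qed.

Let SP_ge0 t : 0 <= SP t.
Proof.
apply: sumr_ge0 => a _; apply: sumr_ge0 => i _.
by rewrite mulr_ge0 ?invr_ge0 ?(ltW (beta0 i))// mulr_ge0 ?sqr_ge0.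
Qed.

(** The condition [2 * D1 <= beta i] keeps the indefinite term [zeta . d' / beta] below half of
    [|zeta|]. *)
Let total_energy_bounds t : t0 < t ->
  SP t + 2^-1 * Z t + kap * (q t - 1) <= V t <= SP t + 2 * Z t + kap * (q t - 1).
Proof.
move=> t0t.
have coord a i : (beta i)^-1 * (2^-1 * filtered a i t ^+ 2)
    + 2^-1 * `|zeta1 T t a i| <= energy a i t
    <= (beta i)^-1 * (2^-1 * filtered a i t ^+ 2) + 2 * `|zeta1 T t a i|.
  rewrite /energy mulrDr mulKf ?gt_eqF//.
  set E := (beta i)^-1 * (zeta1 T t a i * _).
  have : `|E| <= 2^-1 * `|zeta1 T t a i|.
    rewrite /E normrM normfV (gtr0_norm (beta0 i)) ler_pdivrMl//.
    rewrite normrM mulrC mulrA ler_wpM2r//.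
    have := d1_bound i a t0t; have [+ _ _] := beta_bound i; lra.
  by have := normr_ge0 (zeta1 T t a i); rewrite ler_norml => ? /andP[? ?]; apply/andP; split; lra.
have half : 2^-1 * Z t = \sum_a \sum_i 2^-1 * `|zeta1 T t a i|.
  by rewrite mulr_sumr; apply: eq_bigr => a _; rewrite mulr_sumr.
have twice : 2 * Z t = \sum_a \sum_i 2 * `|zeta1 T t a i|.
  by rewrite mulr_sumr; apply: eq_bigr => a _; rewrite mulr_sumr.
rewrite /V /total_energy -/(W t) -/(q t) !lerD2r half twice /SP -!big_split /=.
apply/andP; split; apply: ler_sum => a _; rewrite -big_split; apply: ler_sum => i _ /=;
  by have /andP[] := coord a i.
Qed.

(** This is what makes the Lipschitz constant legitimate: [kap * (q - 1) <= K] bounds [q] by [S],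
    coercivity then bounds [xhat], and [Z <= 2 * K] bounds [pos]. The 2 in the bound on [rho] leaves
    room for [X <= 1 + X^2] and for the strict inequality on [xhat]. *)
Let region t : t0 < t -> V t <= K ->
  [/\ Z t <= 2 * K, q t <= S, (forall a j, `|xhat T t a j| < rho) &
      forall a j, `|pos T t a j| <= rho].
Proof.
move=> t0t VK; have /andP[lowV _] := total_energy_bounds t0t.
have Z0 : 0 <= Z t by exact: n1_ge0.
have kq0 : 0 <= kap * (q t - 1) by rewrite mulr_ge0 ?(ltW kap0)// subr_ge0.
have ZK : Z t <= 2 * K by have := SP_ge0 t; lra.
have qS : q t <= S.
  rewrite SE -lerBlDl ler_pdivlMr// mulrC; have := SP_ge0 t; lra.
have X2 : X t ^+ 2 <= S ^+ 2 / w0.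
  rewrite ler_pdivlMr// mulrC.
  have /andP[h1 _] := lyapP (xhat_err t) (est_err ^~ t).
  have h2 : 0 <= w0 * Y t ^+ 2 by rewrite mulr_ge0 ?sqr_ge0// ltW.
  have h3 : q t ^+ 2 <= S ^+ 2.
    by rewrite lerXn2r// nnegrE ?(le_trans ler01)// (le_trans _ S1).
  have h4 := q_sqr t; move: h1 h2 h3 h4; rewrite /X /Y /W; lra.
have X1 : X t <= 1 + S ^+ 2 / w0 by have := sqr_ge0 (X t - 1); have := sqr_ge0 (X t); lra.
have xb a j : `|xhat T t a j| <= n1 xstar + X t.
  have -> : xhat T t a j = xstar a j + xhat_err t a j by rewrite !mxE subrKC.
  by apply: le_trans (ler_normD _ _) _; rewrite lerD// le_n1.
have rP := rhoP; have kp := K0.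
split=> // a j; first by have := xb a j; lra.
have -> : pos T t a j = xhat T t a j + zeta1 T t a j by rewrite !mxE subrKC.
apply: le_trans (ler_normD _ _) _.
by have := xb a j; have := le_n1 (zeta1 T t) a j; rewrite -/(Z t); lra.
Qed.

(** Since [q - 1 <= W <= w1 * (X^2 + Y^2)], the second entry matches [kap * (q - 1)] with the
    available dissipation [kap * m / (4 * S) * (X^2 + Y^2)]. *)
Let rate := Num.min 1 (m / (4 * S * w1)).

(** The sliding dissipation [Zc] is at least [4 * (1 + n * Lg) * Z]. One quarter of it pays for the
    square-root part; the other three exceed [n * Lg * Z] and [n * eps1 * Z] by at least [2 * Z],
    the amount in the upper bound of [V]. Half of the quadratic dissipation pays for
    [n * eps1 * (X^2 + Y^2)]. *)
Let decay t : t0 < t -> V t <= K -> dini V t (- (rate * V t)).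
Proof.
move=> t0t VK; have [ZK qS xr pr] := region t0t VK.
have Z0 : 0 <= Z t by exact: n1_ge0.
have X0 : 0 <= X t by exact: n1_ge0.
have Y0 : 0 <= Y t by exact: n1s_ge0.
pose E := n1 (injection t).
pose Zc := \sum_a \sum_i c i * `|zeta1 T t a i|.
pose v a i := xi_dot G (xhat_err t) (est_err ^~ t) (injection t) a i.
pose L := Lg * (\sum_a \sum_i `|v a i|).
have L0 : 0 <= L.
  by rewrite mulr_ge0 ?(ltW Lg0)//; apply: sumr_ge0 => a _; exact: sumr_ge0.
have k0 i : 0 <= k i by have /andP[+ _] := k_bound i; exact: le_trans.
have c0 i : 0 <= c i by have [+ _ _ _] := c_bound i; apply: le_trans.
have EE : E = \sum_a \sum_i (k i + c i) * `|zeta1 T t a i|.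
  apply: eq_bigr => a _; apply: eq_bigr => i _.
  by rewrite mxE normrM ger0_norm ?addr_ge0.
have EZ : E <= (km + cm) * Z t.
  rewrite EE mulr_sumr; apply: ler_sum => a _; rewrite mulr_sumr; apply: ler_sum => i _.
  rewrite ler_wpM2r// lerD//; first by have /andP[] := k_bound i.
  by have [] := c_bound i.
have EZc : E <= 2 * Zc.
  rewrite EE mulr_sumr; apply: ler_sum => a _; rewrite mulr_sumr; apply: ler_sum => i _.
  rewrite mulrA ler_wpM2r//; have [+ _ _ _] := c_bound i; lra.
have cZ (C : R) : (forall i, C <= c i) -> C * Z t <= Zc.
  move=> Cc; rewrite mulr_sumr; apply: ler_sum => a _; rewrite mulr_sumr.
  by apply: ler_sum => i _; rewrite ler_wpM2r.
have Zc0 : 0 <= Zc.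
  by apply: sumr_ge0 => a _; apply: sumr_ge0 => i _; rewrite mulr_ge0.
have LL : 0 <= L <= Lg * (n * b * (X t + Y t) + (km + cm) * Z t).
  rewrite L0 /= /L ler_pM2l//.
  apply: (le_trans (y := n * b * (X t + Y t) + E)); last by rewrite lerD2l.
  have -> : n * b * (X t + Y t) = \sum_(a < 2) \sum_(i < N) b * (X t + Y t).
    by rewrite !sumr_const !card_ord -mulrnA -mulrA mulr_natl mulnC.
  rewrite /E /n1 -big_split; apply: ler_sum => a _ /=.
  rewrite -big_split; apply: ler_sum => i _ /=.
  apply: le_trans (ler_normD _ _) _; rewrite normrN lerD//.
  apply: le_trans (drive_bound _ _ _) _; rewrite ler_pM2l//.
  by apply: le_trans (ler_n1D _ _) _; rewrite lerD// n1_le_n1s.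
have gap a i : `|g_gap a i t| <= Lg * Z t.
  apply: g_lip => // b' j; exact: ltW.
have H := dini_total_energy (t := t) t0t kap (uu := uu) L0 (W_ge0 t).
apply: dini_le (H _); last first.
  by move=> a i e e0; apply: (g_xhat_increment t0t) => //; exact: g_lip.
rewrite -/(W t) -/(q t).
have D := lyap_dotP (xhat_err t) (est_err ^~ t) (zeta1 T t) (injection t).
have /andP[Wlo Wup] := lyapP (xhat_err t) (est_err ^~ t).
have q1 := q_ge1 t.
have q0 : 0 < q t by apply: lt_le_trans q1.
have SR := @sqrt_rate R (W t) _ (X t) (Y t) E (Z t) Zc (q t) S kap m w0 C0 Cth
  w00 C00 Cth0 m0 X0 Y0 Wlo q0 (q_sqr t) qS D EZc
  (cZ Cth (fun i => let: And4 _ h _ _ := c_bound i in h)) Zc0 kapE.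
set r1 := \sum_a _.
have R1 : r1 <= - SP t + n * (eps1 * (X t ^+ 2 + Y t ^+ 2 + Z t) + Lg * Z t) - Zc.
  have -> : - SP t + n * (eps1 * (X t ^+ 2 + Y t ^+ 2 + Z t) + Lg * Z t) - Zc =
    \sum_a \sum_i (- ((beta i)^-1 * (2^-1 * filtered a i t ^+ 2))
       + eps1 * (X t ^+ 2 + Y t ^+ 2 + Z t) + Lg * Z t - c i * `|zeta1 T t a i|).
    have -> : n * (eps1 * (X t ^+ 2 + Y t ^+ 2 + Z t) + Lg * Z t) =
      \sum_(a < 2) \sum_(i < N) (eps1 * (X t ^+ 2 + Y t ^+ 2 + Z t) + Lg * Z t).
      by rewrite !sumr_const !card_ord -mulrnA mulr_natl mulnC.
    rewrite /SP /Zc -!sumrN -!big_split; apply: eq_bigr => a _ /=.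
    rewrite -!sumrN -!big_split; apply: eq_bigr => i _ /=.
    by rewrite addrA.
  apply: ler_sum => a _; apply: ler_sum => i _.
  have [_ _ b3] := beta_bound i.
  have [_ _ _ ccm] := c_bound i.
  apply: (@energy_rate R _ _ _ _ _ _ _ _ _ _ _ _ Lg (n * b) D1 D2 km cm K) => //.
  - by rewrite c0.
  - exact: le_n1.
  - exact: d1_bound.
  - exact: d2_bound.
  - exact: ltW.
  - by rewrite mulr_ge0 ?(ltW b0).
have cLg : 4 * (1 + n * Lg) * Z t <= Zc by apply: cZ => i; have [] := c_bound i.
have e1 : n * eps1 * Z t <= Z t by rewrite ler_piMl.
have XY0 : 0 <= X t ^+ 2 + Y t ^+ 2 by rewrite addr_ge0 ?sqr_ge0.
have e2 : n * eps1 * (X t ^+ 2 + Y t ^+ 2) <=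
    kap * m / (4 * S) * (X t ^+ 2 + Y t ^+ 2) by rewrite ler_wpM2r.
have S0 : 0 < S by exact: lt_le_trans S1.
have e3 : kap * m / (2 * S) * (X t ^+ 2 + Y t ^+ 2) =
    2 * (kap * m / (4 * S) * (X t ^+ 2 + Y t ^+ 2)) by field; exact: lt0r_neq0.
set D2S := kap * m / (4 * S) * (X t ^+ 2 + Y t ^+ 2) in e2 e3.
have LgZ : 0 <= n * Lg * Z t by rewrite !mulr_ge0// ltW.
have key : r1 + kap * (lyap_dot G A thbar uu theta (xhat_err t) (est_err ^~ t)
   (zeta1 T t) (injection t) / (2 * q t)) <= - SP t - 2 * Z t - D2S.
  by move: SR R1 cLg e1 e2 e3 LgZ; rewrite -/E -/(Z t); lra.
apply: (le_trans key).
have /andP[_ upV] := total_energy_bounds t0t.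
have r1' : rate <= 1 by rewrite ge_min lexx.
have r0 : 0 <= rate.
  by rewrite le_min ler01 divr_ge0 ?(ltW m0)// !mulr_ge0// ltW.
have r2 : rate * (kap * (q t - 1)) <= D2S.
  apply: (le_trans (y := m / (4 * S * w1) * (kap * (w1 * (X t ^+ 2 + Y t ^+ 2))))).
    apply: ler_pM => //.
    - by rewrite mulr_ge0 ?(ltW kap0)// subr_ge0.
    - by rewrite ge_min lexx orbT.
    rewrite ler_pM2l//; apply: le_trans Wup; rewrite -/(W t).
    have : q t * 1 <= q t * q t by rewrite ler_pM2l.
    by rewrite mulr1 -expr2 q_sqr; lra.
  rewrite le_eqVlt; apply/orP; left; apply/eqP; rewrite /D2S; field.
  by rewrite !lt0r_neq0.
have r3 : rate * (SP t + 2 * Z t) <= SP t + 2 * Z t.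
  by rewrite ler_piMl// addr_ge0// mulr_ge0.
have : rate * V t <= rate * (SP t + 2 * Z t + kap * (q t - 1)) by rewrite ler_wpM2l.
lra.
Qed.

(** At [t0] the energy has no meaningful value, for it contains [d']. Right-continuity of the errors
    carries their initial bounds, enlarged by 1, to some [tau > t0], where the bound on [d']
    applies. *)
Let initial : exists2 tau, t0 < tau & V tau < K.
Proof.
have cvgF w f : integral_solution t0 w f -> w r @[r --> t0^'+] --> w t0.
  exact: integral_solution_right.
have cvgd i a : d i r a ord0 @[r --> t0^'+] --> d i t0 a ord0.
  have [[_ dr] _ _ _ _] := hd i.
  apply: (@continuous_cvg _ _ _ _ _ _ (fun M : 'cV[R]_2 => M a ord0)) dr.
  exact: coord_continuous.
have near1 (I : finType) (f : I -> R -> R) (B : I -> R) :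
    (forall p, f p r @[r --> t0^'+] --> f p t0) -> (forall p, `|f p t0| <= B p) ->
    \forall r \near t0^'+, forall p, `|f p r| <= B p + 1.
  move=> cf fB; apply: filter_forall => p.
  near=> r; apply: (le_trans (y := `|f p t0| + 1)); last by rewrite lerD2r.
  near: r; apply: (cvgr_le _ (cvg_norm (cf p))).
  by rewrite ltrDl.
have nz := @near1 ('I_2 * 'I_N)%type (fun p r => zeta1 T r p.1 p.2) (fun=> v1)
  (fun p => @cvg_zeta1 _ _ _ cvgF p.1 p.2) (fun p => zeta1_t0 p.1 p.2).
have nx := @near1 ('I_2 * 'I_N)%type (fun p r => xhat_err r p.1 p.2) (fun=> 2 * v1)
  (fun p => @cvg_xhat_err _ _ _ cvgF p.1 p.2) (fun p => xhat_err_t0 p.1 p.2).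
have ne := @near1 ('I_N * ('I_2 * 'I_N))%type (fun p r => est_err p.1 r p.2.1 p.2.2)
  (fun=> 2 * v1) (fun p => @cvg_est_err _ _ _ cvgF p.1 p.2.1 p.2.2)
  (fun p => est_err_t0 p.1 p.2.1 p.2.2).
have nf := @near1 ('I_2 * 'I_N)%type (fun p r => filtered p.1 p.2 r)
  (fun p => `|filtered p.1 p.2 t0|)
  (fun p => @cvg_filtered _ _ _ cvgF cvgd p.1 p.2) (fun p => lexx _).
near t0^'+ => tau.
have t0tau : t0 < tau by near: tau; exact: nbhs_right_gt.
exists tau => //.
have z1 a i : `|zeta1 T tau a i| <= v1 + 1.
  suff H : forall p : 'I_2 * 'I_N, `|zeta1 T tau p.1 p.2| <= v1 + 1 by exact: (H (a, i)).
  by near: tau; exact: nz.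
have x1 a i : `|xhat_err tau a i| <= 2 * v1 + 1.
  suff H : forall p : 'I_2 * 'I_N, `|xhat_err tau p.1 p.2| <= 2 * v1 + 1 by exact: (H (a, i)).
  by near: tau; exact: nx.
have e1 i a j : `|est_err i tau a j| <= 2 * v1 + 1.
  suff H : forall p : 'I_N * ('I_2 * 'I_N), `|est_err p.1 tau p.2.1 p.2.2| <= 2 * v1 + 1
    by exact: (H (i, (a, j))).
  by near: tau; exact: ne.
have f1 a i : `|filtered a i tau| <= P0.
  suff H : forall p : 'I_2 * 'I_N, `|filtered p.1 p.2 tau| <= `|filtered p.1 p.2 t0| + 1.
    by apply: le_trans (filtered_t0 a i); exact: (H (a, i)).
  by near: tau; exact: nf.
have /andP[_ upV] := total_energy_bounds t0tau.
have ZB : Z tau <= n * (v1 + 1) by rewrite /n mulr_natl; exact: n1_sum_const.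
have XB : X tau <= n * (2 * v1 + 1) by rewrite /n mulr_natl; exact: n1_sum_const.
have YB : Y tau <= N%:R * (n * (2 * v1 + 1)).
  rewrite mulr_natl -[X in _ *+ X](card_ord N) -sumr_const; apply: ler_sum => i _.
  by rewrite /n mulr_natl; apply: n1_sum_const => a j; exact: e1.
(* [n * P0 ^+ 2 <= beta i] makes each of the [n] summands at most [1 / (2 n)], however large the
   gains are. *)
have SPB : SP tau <= 1.
  apply: (le_trans (y := \sum_(a < 2) \sum_(i < N) 2^-1 * n^-1)).
    apply: ler_sum => a _; apply: ler_sum => i _.
    rewrite mulrCA ler_pM2l// ler_pdivrMl//.
    have n00 : 0 < n by rewrite ltr0n muln_gt0/=; exact: leq_ltn_trans (ltn_ord i).
    rewrite ler_pdivlMr// mulrC.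
    have [_ + _] := beta_bound i; apply: le_trans.
    rewrite ler_pM2l// -real_normK ?num_real// lerXn2r// nnegrE//.
    exact: le_trans (f1 a i).
  rewrite !sumr_const !card_ord -mulrnA mulnC -[leLHS]mulr_natl -/n.
  have [->|nn0] := eqVneq n 0; first by rewrite mul0r.
  rewrite mulrCA divff// mulr1.
  by rewrite invf_le1// ler1n.
have qW : q tau - 1 <= W tau.
  have : q tau * 1 <= q tau * q tau.
    by rewrite ler_wpM2l ?q_ge1// (le_trans ler01 (q_ge1 _)).
  by rewrite mulr1 -expr2 q_sqr; lra.
have /andP[_ Wup] := lyapP (xhat_err tau) (est_err ^~ tau).
have Wb : W tau <= w1 * ((n * (2 * v1 + 1)) ^+ 2 + (N%:R * (n * (2 * v1 + 1))) ^+ 2).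
  apply: (le_trans Wup); rewrite ler_pM2l// lerD// lerXn2r// nnegrE ?n1_ge0 ?n1s_ge0//.
    by apply: le_trans XB; exact: n1_ge0.
  by apply: le_trans YB; exact: n1s_ge0.
have kW : kap * (q tau - 1) <= kap * (w1 * ((n * (2 * v1 + 1)) ^+ 2
    + (N%:R * (n * (2 * v1 + 1))) ^+ 2)).
  by rewrite ler_pM2l//; apply: le_trans Wb.
have := K_bound; lra.
Unshelve. all: by end_near. Qed.

(** [V] dominates [|zeta|] and the squares of the filtered variables and of the observer and
    consensus errors, with constants that may now depend on the gains. The original errors follow
    from [gamma = filtered + g_gap], [zeta2 = gamma + k zeta1], [xi = xhat_err + zeta1] and
    [eta = est_err - zeta1]. *)
Lemma error_norm_cvg : error_norm g d k xstar T t @[t --> +oo] --> 0.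
Proof.
have [tau t0tau Vtau] := initial.
have S0 : 0 < S by exact: lt_le_trans S1.
have rate0 : 0 < rate by rewrite lt_min ltr01 divr_gt0// !mulr_gt0.
have V0 t : t0 < t -> 0 <= V t.
  move=> t0t; have /andP[+ _] := total_energy_bounds t0t; apply: le_trans.
  by rewrite !addr_ge0 ?SP_ge0// mulr_ge0 ?n1_ge0 ?(ltW kap0)// subr_ge0.
have lt_tau t : tau <= t -> t0 < t by exact: lt_le_trans.
have [Vle Vcvg] := @dini_decay R V tau K rate rate0 (fun t h => V0 t (lt_tau t h))
  (fun t h => @cvg_total_energy t (lt_tau t h) kap uu)
  (fun t h => decay (lt_tau t h)) Vtau.
have VK t : tau <= t -> V t <= K by move=> /Vle/le_trans; apply; exact: ltW.
have VC (C : R) : C * V t @[t --> +oo] --> (0 : R).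
  have H : C * V t @[t --> +oo] --> C * 0 by apply: cvgMr.
  by rewrite mulr0 in H.
have lin (f : R -> R) (C : R) : (forall t, tau <= t -> `|f t| <= C * V t) ->
    f t @[t --> +oo] --> (0 : R).
  move=> fC; apply/cvgr0Pnorm_le => e e0; near=> t.
  have tt : tau <= t by near: t; apply: nbhs_pinfty_ge; exact: num_real.
  apply: le_trans (fC t tt) _; apply: le_trans (ler_norm _) _.
  by near: t; exact: (cvgr0_norm_le _ (VC C)).
have quadr (f : R -> R) (C : R) : (forall t, tau <= t -> f t ^+ 2 <= C * V t) ->
    f t @[t --> +oo] --> (0 : R).
  move=> fC; apply/cvgr0Pnorm_le => e e0; near=> t.
  have tt : tau <= t by near: t; apply: nbhs_pinfty_ge; exact: num_real.
  rewrite -(@ler_pXn2r _ 2)// ?nnegrE ?(ltW e0)// real_normK ?num_real//.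
  apply: le_trans (fC t tt) _; apply: le_trans (ler_norm _) _.
  by near: t; apply: (cvgr0_norm_le _ (VC C)); exact: exprn_gt0.
have kq0 t : 0 <= kap * (q t - 1) by rewrite mulr_ge0 ?(ltW kap0)// subr_ge0.
have ZV t : tau <= t -> Z t <= 2 * V t.
  move=> tt; have /andP[+ _] := total_energy_bounds (lt_tau t tt).
  by have := SP_ge0 t; have := kq0 t; lra.
have z_cvg a i : zeta1 T t a i @[t --> +oo] --> (0 : R).
  by apply: (lin _ 2) => t tt; apply: le_trans (ZV t tt); exact: le_n1.
have gap_cvg a i : g_gap a i t @[t --> +oo] --> (0 : R).
  apply: (lin _ (Lg * 2)) => t tt.
  have [_ _ xr pr] := region (lt_tau t tt) (VK t tt).
  apply: (le_trans (g_lip _ _ _ _)) => //; first by move=> b' j; exact: ltW.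
  by rewrite -mulrA ler_pM2l//; exact: ZV.
have P_cvg a i : filtered a i t @[t --> +oo] --> (0 : R).
  apply: (quadr _ (beta i * 2)) => t tt.
  have /andP[h1 _] := total_energy_bounds (lt_tau t tt).
  have h2 : (beta i)^-1 * (2^-1 * filtered a i t ^+ 2) <= SP t.
    rewrite /SP (bigD1 a)//= (bigD1 i)//= -addrA lerDl addr_ge0//.
      apply: sumr_ge0 => j _.
      by rewrite mulr_ge0 ?invr_ge0 ?(ltW (beta0 j))// mulr_ge0 ?sqr_ge0.
    apply: sumr_ge0 => b' _; apply: sumr_ge0 => j _.
    by rewrite mulr_ge0 ?invr_ge0 ?(ltW (beta0 j))// mulr_ge0 ?sqr_ge0.
  have h3 : (beta i)^-1 * (2^-1 * filtered a i t ^+ 2) <= V t.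
    by have := n1_ge0 (zeta1 T t); have := kq0 t; rewrite -/(Z t); lra.
  by move: h3; rewrite ler_pdivrMl// ler_pdivrMl// mulrCA mulrA.
(* From [W = (q + 1) * (q - 1)], with [q <= S] on the sublevel set and [kap * (q - 1) <= V]. *)
pose C := ((S + 1) / kap) / w0.
have XYV t : tau <= t -> X t ^+ 2 + Y t ^+ 2 <= C * V t.
  move=> tt; have [_ qS _ _] := region (lt_tau t tt) (VK t tt).
  have /andP[h1 _] := total_energy_bounds (lt_tau t tt).
  have h2 : kap * (q t - 1) <= V t.
    by have := n1_ge0 (zeta1 T t); have := SP_ge0 t; rewrite -/(Z t); lra.
  have /andP[h3 _] := lyapP (xhat_err t) (est_err ^~ t).
  have h4 : W t <= (S + 1) / kap * V t.
    have -> : W t = (q t + 1) * (q t - 1).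
      by have := q_sqr t; rewrite expr2 => h; rewrite mulrDl mulrBr h; ring.
    rewrite -mulrA; apply: ler_pM => //.
    - by rewrite addr_ge0// (le_trans ler01).
    - by rewrite subr_ge0.
    - by rewrite lerD2r.
    - by rewrite ler_pdivlMl.
  rewrite /C mulrAC ler_pdivlMr// mulrC; exact: le_trans h4.
have x_cvg a i : xhat_err t a i @[t --> +oo] --> (0 : R).
  apply: (quadr _ C) => t tt; apply: le_trans (XYV t tt).
  apply: (le_trans (y := X t ^+ 2)); last by rewrite lerDl sqr_ge0.
  rewrite -real_normK ?num_real// lerXn2r// ?nnegrE// ?n1_ge0//.
  exact: le_n1.
have e_cvg i a j : est_err i t a j @[t --> +oo] --> (0 : R).
  apply: (quadr _ C) => t tt; apply: le_trans (XYV t tt).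
  apply: (le_trans (y := Y t ^+ 2)); last by rewrite lerDr sqr_ge0.
  rewrite -real_normK ?num_real// lerXn2r// ?nnegrE// ?n1s_ge0//.
  apply: le_trans (le_n1 _ _ _) _; exact: (n1_le_n1s (est_err ^~ t) i).
have sumc (f1 f2 : R -> R) : f1 t @[t --> +oo] --> (0 : R) ->
    f2 t @[t --> +oo] --> (0 : R) -> f1 t + f2 t @[t --> +oo] --> (0 : R).
  move=> c1 c2; have H : f1 t + f2 t @[t --> +oo] --> (0 : R) + 0 by apply: cvgD.
  by rewrite addr0 in H.
have en (M : R -> 'M[R]_(2, N)) :
    (forall a j, M t a j @[t --> +oo] --> (0 : R)) ->
    enorm (M t) ^+ 2 @[t --> +oo] --> (0 : R).
  move=> cM.
  have -> : (fun t => enorm (M t) ^+ 2) =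
      (fun t => \sum_(a < 2) \sum_(j < N) M t a j * M t a j).
    by apply/funext => t; rewrite enorm_sqr.
  have H : \sum_(a < 2) \sum_(j < N) M t a j * M t a j @[t --> +oo] -->
      \sum_(a < 2) \sum_(j < N) (0 : R) * 0.
    by apply: cvg_bigsum => a; apply: cvg_bigsum => j; exact: cvgM.
  have E0 : \sum_(a < 2) \sum_(j < N) (0 : R) * 0 = 0.
    by rewrite big1// => a _; rewrite big1// => j _; rewrite mulr0.
  by rewrite E0 in H.
have gam_cvg a i : gamma g d k T t a i @[t --> +oo] --> (0 : R).
  by under eq_fun do rewrite gamma_filtered; exact: sumc.
have kz_cvg a i : k i * zeta1 T t a i @[t --> +oo] --> (0 : R).
  have H : k i * zeta1 T t a i @[t --> +oo] --> k i * 0 by apply: cvgMr.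
  by rewrite mulr0 in H.
have inner : enorm (zeta1 T t) ^+ 2 + enorm (zeta2 g d T t) ^+ 2
    + enorm (Defs.xi xstar T t) ^+ 2 + \sum_(i < N) enorm (Defs.eta T i t) ^+ 2
    + enorm (gamma g d k T t) ^+ 2 @[t --> +oo] --> (0 : R).
  apply: (sumc _ _ _ (en _ gam_cvg)); apply: (sumc); last first.
    have H (f : 'I_N -> R -> R) : (forall i, f i t @[t --> +oo] --> (0 : R)) ->
        \sum_(i < N) f i t @[t --> +oo] --> (0 : R).
      by move=> /(@cvg_bigsum _ _ _ _ _ predT f (fun=> 0)); rewrite big1.
    apply: H => i; apply: (en) => a j.
    have -> : (fun t => Defs.eta T i t a j) =
        (fun t => est_err i t a j + - zeta1 T t a j).
      by apply/funext => t; rewrite !mxE; ring.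
    apply: (sumc) => //.
    have H : - zeta1 T t a j @[t --> +oo] --> - (0 : R) by apply: cvgN.
    by rewrite oppr0 in H.
  apply: (sumc); last first.
    apply: (en) => a j.
    have -> : (fun t => Defs.xi xstar T t a j) =
        (fun t => xhat_err t a j + zeta1 T t a j).
      by apply/funext => t; rewrite !mxE; ring.
    exact: sumc.
  apply: (sumc); first exact: (en).
  apply: (en) => a j.
  have -> : (fun t => zeta2 g d T t a j) =
      (fun t => gamma g d k T t a j + k j * zeta1 T t a j).
    by apply/funext => t; rewrite [gamma _ _ _ _ _ _ _]mxE subrK.
  exact: sumc.
have H : error_norm g d k xstar T t @[t --> +oo] --> Num.sqrt (0 : R).
  apply: (@continuous_cvg _ _ _ _ _ _ (@Num.sqrt R)) inner.
  exact: sqrt_continuous.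
by rewrite sqrtr0 in H.
Unshelve. all: by end_near. Qed.

End Convergence.

End Trajectory.

(** * Bounds from the initial error and on the disturbances *)

Section InitialBounds.
Variables (R : realType) (N : nat).
Variables (g : 'I_N -> 'M[R]_(2, N) -> 'cV[R]_2) (d : 'I_N -> R -> 'cV[R]_2).
Variables (k : 'I_N -> R) (xstar : 'M[R]_(2, N)) (T : trajectory R N) (t : R).

Lemma error_norm_coord v : error_norm g d k xstar T t <= v -> forall a i,
  [/\ `|zeta1 T t a i| <= v, `|Defs.xi xstar T t a i| <= v,
      forall l, `|Defs.eta T l t a i| <= v & `|gamma g d k T t a i| <= v].
Proof.
move=> ev a i.
pose e2 := enorm (zeta1 T t) ^+ 2 + enorm (zeta2 g d T t) ^+ 2
  + enorm (Defs.xi xstar T t) ^+ 2 + \sum_(i < N) enorm (Defs.eta T i t) ^+ 2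
  + enorm (gamma g d k T t) ^+ 2.
have p1 := sqr_ge0 (enorm (zeta1 T t)).
have p2 := sqr_ge0 (enorm (zeta2 g d T t)).
have p3 := sqr_ge0 (enorm (Defs.xi xstar T t)).
have p4 : 0 <= \sum_(i < N) enorm (Defs.eta T i t) ^+ 2.
  by apply: sumr_ge0 => j _; exact: sqr_ge0.
have p5 := sqr_ge0 (enorm (gamma g d k T t)).
have v0 : 0 <= v by apply: le_trans ev; exact: sqrtr_ge0.
have e2v : e2 <= v ^+ 2.
  rewrite -[leLHS]sqr_sqrtr; last by rewrite /e2; lra.
  by rewrite lerXn2r// nnegrE// sqrtr_ge0.
have coord (M : 'M[R]_(2, N)) : enorm M ^+ 2 <= e2 -> `|M a i| <= v.
  move=> Me; apply: le_trans (le_enorm _ _ _) _.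
  rewrite -(@ler_pXn2r _ 2)// ?nnegrE ?sqrtr_ge0//.
  exact: le_trans e2v.
split; try (apply: coord; rewrite /e2; lra).
move=> l; apply: coord; rewrite /e2 [X in _ + X + _](bigD1 l)//=.
have : 0 <= \sum_(j | j != l) enorm (Defs.eta T j t) ^+ 2.
  by apply: sumr_ge0 => j _; exact: sqr_ge0.
lra.
Qed.

Lemma disturbance_bounds t0 : (forall i, regular_disturbance t0 (d i)) ->
  exists D1 D2 : R, forall i r a, t0 < r ->
  `|derive1 (d i) r a ord0| <= D1 /\
  `|derive1 (derive1 (d i)) r a ord0| <= D2.
Proof.
move=> hd.
have [M1 M1P] := choice (fun i => let: And5 _ _ _ h _ := hd i in h).
have [M2 M2P] := choice (fun i => let: And5 _ _ _ _ h := hd i in h).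
have le_sum (M : 'I_N -> R) i : M i <= \sum_j `|M j|.
  by apply: le_trans (ler_norm _) _; rewrite (bigD1 i)//= lerDl sumr_ge0.
exists (\sum_j `|M1 j|), (\sum_j `|M2 j|) => i r a t0r; split.
  apply: le_trans (le_sum M1 i); apply: le_trans (le_enorm _ _ _) _; exact: M1P.
apply: le_trans (le_sum M2 i); apply: le_trans (le_enorm _ _ _) _; exact: M2P.
Qed.
End InitialBounds.

(** * Choice of the gains *)

Unset Implicit Arguments.
Set Strict Implicit.

Theorem corollary3 (R : realType) (N : nat) (hN : (2 <= N)%N)
  (G : game R N) (hG : connectivity_game G)
  (xstar : 'M[R]_(2, N)) (hxstar : is_nash G xstar)
  (A : 'M[R]_N) (hA : weighted_adjacency A)
  (hund : undirected A) (hconn : connected_graph A)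
  (thbar : 'M[R]_N) (hthbar : forall i j, 0 < thbar i j)
  (t0 : R)
  (g : 'I_N -> 'M[R]_(2, N) -> 'cV[R]_2) (hg : forall i, regular_unmodeled (g i))
  (d : 'I_N -> R -> 'cV[R]_2) (hd : forall i, regular_disturbance t0 (d i)) :
  forall v1 : R, 0 < v1 ->
  exists thstar : R, 0 < thstar /\
  forall theta : R, thstar < theta ->
  exists kr : R, 0 < kr /\
  forall k : 'I_N -> R, (forall i, kr < k i) ->
  exists cr : R, 0 < cr /\
  forall c : 'I_N -> R, (forall i, cr < c i) ->
  exists br : R, 0 < br /\
  forall beta : 'I_N -> R, (forall i, br < beta i) ->
  forall T : trajectory R N,
    closed_loop G A thbar g d t0 theta k c beta T ->
    error_norm g d k xstar T t0 <= v1 ->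
    error_norm g d k xstar T t @[t --> +oo] --> 0.
Proof.
move=> v1 v10.
have [u [w0 [w1 [m [C0 [thstar [u0 [w00 w10 m0 C00 th0] lyapP thP]]]]]]] :=
  consensus_lyapunov hN hG hA hund hconn hthbar.
have [b [b0 bP]] := pgrad_lin_bound G.
have [D1 [D2 DP]] := disturbance_bounds hd.
pose n : R := (2 * N)%:R.
have n4 : 4 <= n by rewrite (ler_nat R 4) (leq_mul2l 2 2).
have n0 : 0 < n by lra.
pose kap := (2 * (2 * C0 + 1) * (1 + 2 / w0))^-1.
have kap0 : 0 < kap.
  by rewrite invr_gt0 !mulr_gt0// addr_gt0// ?divr_gt0// mulr_gt0.
pose K0 := kap * (w1 * ((n * (2 * v1 + 1)) ^+ 2 + (N%:R * (n * (2 * v1 + 1))) ^+ 2)).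
have K00 : 0 <= K0.
  by rewrite mulr_ge0 ?(ltW kap0)// mulr_ge0 ?(ltW w10)// addr_ge0 ?sqr_ge0.
(* The summands bound, shortly after [t0], the filtered part with some slack, twice [Z], and
   [kap * (q - 1)]. No gain occurs in [K], nor in [S], [rho] and [Lg] built from it. *)
pose K := 2 + 2 * (n * (v1 + 1)) + K0.
have Kv1 : 2 * v1 <= K.
  have : 4 * v1 <= n * v1 by rewrite ler_pM2r.
  by rewrite /K; lra.
have Kpos : 0 < K by lra.
pose S := 1 + K / kap.
have S0 : 0 < S by rewrite addr_gt0// divr_gt0.
pose rho := n1 xstar + 2 + S ^+ 2 / w0 + 2 * K.
have Sw0 : 0 <= S ^+ 2 / w0 by rewrite divr_ge0 ?sqr_ge0// ltW.
have [Lg [Lg0 LgP]] := regular_lipschitz_family hg rho.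
exists thstar; split=> // theta thth; have [Cth Cth0 CthP] := thP _ thth.
exists 1; split=> // k k1.
have kpos i : 0 < k i by exact: lt_trans (k1 i).
have [klo [km [_ km0 kP]]] := finite_pos_bounds kpos.
(* The three parts of the threshold for [c] serve the Lipschitz term, the drive of the consensus
   errors by [zeta], and [k i <= c i]. *)
have cr0 : 0 < 4 * (1 + n * Lg) + Cth + km.
  by rewrite !addr_gt0// mulr_gt0// addr_gt0// mulr_gt0.
exists (4 * (1 + n * Lg) + Cth + km); split=> // c cP.
have cpos i : 0 < c i by exact: lt_trans (cP i).
have [clo [cm [_ cm0 cmP]]] := finite_pos_bounds cpos.
(* At [t0] the filtered variable is [gamma - g_gap], with [|gamma| <= v1] and
   [|g_gap| <= Lg * (n * v1)]; the last 1 is the slack for moving to a later time. *)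
pose P0 := v1 + Lg * (n * v1) + 1.
pose eps1 := Num.min 1 (kap * m / (4 * S)) / n.
have eps10 : 0 < eps1.
  by rewrite divr_gt0// lt_min ltr01 divr_gt0// mulr_gt0.
have neps : n * eps1 = Num.min 1 (kap * m / (4 * S)).
  by rewrite /eps1 mulrCA divff ?mulr1// gt_eqF.
pose M3 := 3 / 2 * (Lg * (2 * km + n * b + cm)) ^+ 2 * (1 + 2 * K)
  + Lg * D1 + cm * D1 + D2.
have nP0 : 0 <= n * P0 ^+ 2 by rewrite mulr_ge0 ?sqr_ge0// ltW.
have M3e : 0 <= `|M3| / eps1 by rewrite divr_ge0// ltW.
have D1n := normr_ge0 D1.
(* The terms control, in turn, the correction by [d'], the initial filtered energy, and the
   remainders of [energy_rate]. Absolute values appear because [D1] and [M3] are not known to be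
   nonnegative here. *)
exists (1 + 2 * `|D1| + n * P0 ^+ 2 + `|M3| / eps1); split; first lra.
move=> beta betaP T [s [sSgn sol]] ev1.
have ev := error_norm_coord ev1.
have beta0 i : 0 < beta i by have := betaP i; lra.
have z0 a i : `|zeta1 T t0 a i| <= v1 by have [] := ev a i.
have xe a i : `|xhat_err xstar T t0 a i| <= 2 * v1.
  have [h1 h2 _ _] := ev a i.
  have -> : xhat_err xstar T t0 a i = Defs.xi xstar T t0 a i - zeta1 T t0 a i.
    by rewrite !mxE; ring.
  by apply: le_trans (ler_normB _ _) _; lra.
have xh a i : `|xhat T t0 a i| <= rho.
  have -> : xhat T t0 a i = xstar a i + xhat_err xstar T t0 a i.
    by rewrite !mxE subrKC.
  apply: le_trans (ler_normD _ _) _.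
  by have := le_n1 xstar a i; have := xe a i; rewrite /rho; lra.
have xp a i : `|pos T t0 a i| <= rho.
  have -> : pos T t0 a i = xstar a i + Defs.xi xstar T t0 a i.
    by rewrite !mxE subrKC.
  have [_ h2 _ _] := ev a i.
  apply: le_trans (ler_normD _ _) _.
  by have := le_n1 xstar a i; rewrite /rho; lra.
apply: (@error_norm_cvg R N G A thbar g d xstar t0 theta k c beta T s hG hxstar
  hg hd sSgn sol beta0 u w0 w1 m C0 Cth kap K S rho Lg b D1 D2 km cm eps1 P0 v1)
  => //.
- by move=> i r a t0r; have [] := DP i r a t0r.
- by move=> i r a t0r; have [] := DP i r a t0r.
- by move=> i; rewrite (ltW (k1 i)); have /andP[] := kP i.
- move=> i; have /andP[_ kkm] := kP i; have := cP i.
  have : 0 <= n * Lg by rewrite mulr_ge0// ltW.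
  by split; [lra|lra|lra|have /andP[] := cmP i].
- move=> i; have bi := betaP i; split.
  + by have := ler_norm D1; lra.
  + lra.
  apply: le_trans (ler_norm _) _; rewrite -/M3 -ler_pdivrMr//; lra.
- by rewrite -/n neps ge_min lexx.
- by rewrite -/n neps ge_min lexx orbT.
- move=> l a i; have [h1 _ /(_ l) h3 _] := ev a i.
  have -> : est_err T l t0 a i = Defs.eta T l t0 a i + zeta1 T t0 a i.
    by rewrite !mxE; ring.
  by apply: le_trans (ler_normD _ _) _; lra.
move=> a i; have [_ _ _ h4] := ev a i.
have gap : `|g_gap g T a i t0| <= Lg * (n * v1).
  apply: le_trans (LgP _ _ xp xh i a) _; rewrite ler_pM2l//.
  by rewrite /n mulr_natl; exact: n1_sum_const.
have -> : filtered g d k T a i t0 = gamma g d k T t0 a i - g_gap g T a i t0.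
  by rewrite gamma_filtered addrK.
by rewrite /P0 lerD2r; apply: le_trans (ler_normB _ _) _; exact: lerD.
Qed.
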